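(* Suppose that $V(r)=V^*(r)$, that the function $\|V(r)\|$ is bounded and belongs to $L^1(\mathbb{R}^3)$, and that $$\int_{-\infty}^{+\infty}\Big[\int_{|r|>|t|\varepsilon}\|V(r)\|^{2}\,dr\Big]^{1/2}dt<\infty,\qquad \varepsilon>0 .$$ Then for each $\lambda\in E_+$ the operators $T_1(\lambda)$ and $T_2(\lambda)$ belong to the Hilbert–Schmidt class.
   Context: Fix $m>0$ and let $E=(-\infty,-m]\cup[m,\infty)$. Let $\alpha=(\alpha_1,\alpha_2,\alpha_3)$, $\alpha_s=\begin{pmatrix}0&\sigma_s\\ \sigma_s&0\end{pmatrix}$ ($s=1,2,3$, $\sigma_s$ the Pauli matrices), $\beta=\mathrm{diag}(1,1,-1,-1)$. The Dirac operator is $\mathcal{L}=m\beta+\alpha\cdot(-i\nabla)+V$ in $L^2(\mathbb{R}^3;\mathbb{C}^4)$, where $V(r)=-e\nu(r)I_4+e\,\alpha\cdot A(r)$ is the $4\times4$ matrix potential ($\nu$ scalar potential, $A$ vector potential, $-e$ the electron charge); $\|V(r)\|$ is the matrix norm. Factorization: write $V(r)=U(r)D(r)U^*(r)$ with $U(r)$ unitary and $D(r)=\mathrm{diag}(d_1(r),\dots,d_4(r))$; put $V_1=U\,\mathrm{diag}(|d_j|^{1/2})\,U^*$ and $W_1=U\,\mathrm{diag}(\mathrm{sgn}\,d_j)\,U^*$, so $V=V_1W_1V_1$. Free symbol: $H_0(q)=m\beta+\alpha\cdot q$, with eigenvalues $\lambda_{1,2}(q)=-\sqrt{m^2+|q|^2}$,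 $\lambda_{3,4}(q)=\sqrt{m^2+|q|^2}$ and eigenvectors (with $\lambda_3=\lambda_3(q)$) $g_1=[\frac{-q_1+iq_2}{m+\lambda_3},\frac{q_3}{m+\lambda_3},0,1]^T$, $g_2=[\frac{-q_3}{m+\lambda_3},\frac{-q_1-iq_2}{m+\lambda_3},1,0]^T$, $g_3=[\frac{-q_1+iq_2}{m-\lambda_3},\frac{q_3}{m-\lambda_3},0,1]^T$, $g_4=[\frac{-q_3}{m-\lambda_3},\frac{-q_1-iq_2}{m-\lambda_3},1,0]^T$; $\hat g_n=g_n/\|g_n\|$. Kernel: for $\lambda\in E$ put $\varkappa=\sqrt{\lambda^2-m^2}$, $J_+(r,\lambda)=\sqrt{\pi/2}\,e^{i\varkappa|r|}/|r|$ for positive $\lambda$ and $J_+(r,\lambda)=\sqrt{\pi/2}\,e^{-i\varkappa|r|}/|r|$ for negative $\lambda$, $Q(r)=\sqrt{\pi/2}\,e^{-m|r|}[m\beta+i(m+1/|r|)\,r\cdot\alpha/|r|]/|r|$, and $$B_+(r,\lambda)=Q(r)+(2\pi)^{3/2}\lambda^2\,Q(r)*J_+(r,\lambda)+\lambda J_+(r,\lambda),$$ where $(F*G)(r)=\int_{\mathbb{R}^3}F(r-v)G(v)\,dv$. Let $B_+(\lambda)f(r)=\int_{\mathbb{R}^3}V_1(r)B_+(r-s,\lambda)V_1(s)W_1(s)f(s)\,ds$ in $L^2(\mathbb{R}^3;\mathbb{C}^4)$. A point $\lambda\in E$ is exceptional if $[I+(2\pi)^{3/2}B_+(\lambda)]\psi=0$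 has a nontrivial solution $\psi\in L^2$. $\mathcal{E}_+$ is the set of exceptional points and $E_+=E\setminus\mathcal{E}_+$. Generalized eigenfunctions: for $1\le n\le4$ and $k\in\mathbb{R}^3$ with $\lambda=\lambda_n(k)\in E_+$, $\phi_n(r,k,\lambda)$ is the unique solution with $V_1\phi_n\in L^2$ of $$\phi_n(r,k,\lambda)=e^{ik\cdot r}\hat g_n(k)-(2\pi)^{3/2}\int_{\mathbb{R}^3}B_+(r-s,\lambda)V(s)\phi_n(s,k,\lambda)\,ds .$$ Definition of $T_1(\lambda),T_2(\lambda)$: let $U_0(k)=[\hat g_1(k),\hat g_2(k),\hat g_3(k),\hat g_4(k)]$ and $\Phi(r,k,\lambda)=[\phi_1(r,k,\lambda),\phi_2(r,k,\lambda),\phi_3(r,k,\lambda),\phi_4(r,k,\lambda)]$, where in the $n$-th column $\lambda=-\sqrt{k^2+m^2}$ if $n=1,2$ and $\lambda=\sqrt{k^2+m^2}$ if $n=3,4$. Let $T_{s,n}(q,k,\lambda)$ be the entries of the $4\times4$ matrix $$T(q,k,\lambda)=(2\pi)^{-3}\int_{\mathbb{R}^3}e^{-iq\cdot r}V(r)\Phi(r,k,\lambda)U_0^*(k)\,dr .$$ Put $T_1(q,k,\lambda)=(T_{s,n}(q,k,\lambda))_{s,n\in\{1,2\}}$ with $\lambda=-\sqrt{k^2+m^2}$, and $T_2(q,k,\lambda)=(T_{s,n}(q,k,\lambda))_{s,n\in\{3,4\}}$ with $\lambda=\sqrt{k^2+m^2}$. With $a(|k|)=2\pi\sqrt{k^2+m^2}\,|k|$,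 $|k|=\sqrt{\lambda^2-m^2}$, $S^2$ the unit sphere of $\mathbb{R}^3$ and $d\Omega$ its standard measure, for $p=1,2$ (so $\lambda<-m$ for $p=1$ and $\lambda>m$ for $p=2$) $$T_p(\lambda)h(\omega)=a(|k|)\int_{S^2}T_p(|k|\omega,|k|\omega',\lambda)\,h(\omega')\,d\Omega(\omega'),$$ where $h$ is a $2\times1$ vector function. Let $\mathcal{M}$ be the Hilbert space of vector functions $h=\mathrm{col}[h_1,h_2]$ on $S^2$ with $\|h\|^2=\int_{S^2}(|h_1|^2+|h_2|^2)\,d\Omega$; the subset of $\mathcal{M}$ which corresponds to the absolutely continuous spectrum is denoted $\mathcal{M}_{ac}$, and $T_1(\lambda)$, $T_2(\lambda)$ act in $\mathcal{M}_{ac}$. *)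

(* Defs.v *)
From HB Require Import structures.
From mathcomp Require Import all_boot all_order all_algebra.
From mathcomp Require Import all_classical all_reals all_analysis.
From mathcomp Require Import measurable_realfun.
From mathcomp Require Export complex.

Set Implicit Arguments.
Unset Strict Implicit.
Unset Printing Implicit Defensive.
Import Order.TTheory GRing.Theory Num.Theory.
Import numFieldNormedType.Exports.

Local Open Scope classical_set_scope.
Local Open Scope ring_scope.
Local Open Scope complex_scope.
Local Open Scope sesquilinear_scope.

(* The product type carries the product (Borel) sigma-algebra; its canonical
   norm is the max norm, so the Euclidean one is [norm3] below. *)
Notation R3 R :=
  (measurableTypeR R * measurableTypeR R * measurableTypeR R)%type.

Section Space.
Variable R : realType.

Definition dot3 (x y : R3 R) : R := x.1.1 * y.1.1 + x.1.2 * y.1.2 + x.2 * y.2.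

Definition norm3 (x : R3 R) : R := Num.sqrt (dot3 x x).

Definition scale3 (a : R) (x : R3 R) : R3 R := (a * x.1.1, a * x.1.2, a * x.2).

Definition leb3 : {measure set (R3 R) -> \bar R} :=
  (@lebesgue_measure R \x @lebesgue_measure R \x @lebesgue_measure R)%E.

Definition sphere : set (R3 R) := [set x | norm3 x = 1].

Definition punctured_ball : set (R3 R) := [set x | 0 < norm3 x <= 1].

Definition normalize3 (x : R3 R) : R3 R := scale3 (norm3 x)^-1 x.

Lemma measurable_norm3 : measurable_fun setT norm3.
Proof.
have m11 : measurable_fun setT (fun x : R3 R => x.1.1 : R).
  exact: (measurableT_comp measurable_fst measurable_fst).
have m12 : measurable_fun setT (fun x : R3 R => x.1.2 : R).
  exact: (measurableT_comp measurable_snd measurable_fst).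
have m2 : measurable_fun setT (fun x : R3 R => x.2 : R).
  exact: measurable_snd.
apply: (measurableT_comp (f := @Num.sqrt R)).
  by apply: continuous_measurable_fun; exact: sqrt_continuous.
by apply: measurable_funD; [apply: measurable_funD|]; apply: measurable_funM.
Qed.

Lemma measurable_punctured_ball : measurable punctured_ball.
Proof.
have -> : punctured_ball = norm3 @^-1` `]0, 1]%classic.
  by apply/seteqP; split => x /=; rewrite in_itv.
by rewrite -[X in measurable X]setTI; apply: measurable_norm3.
Qed.

Lemma measurable_normalize3 : measurable_fun setT normalize3.
Proof.
have mV : measurable_fun setT (fun x => (norm3 x)^-1).
  rewrite (_ : (fun x => _) = (@powR R ^~ (-1)) \o norm3); last first.
    by apply/funext => x /=; rewrite powR_inv1// sqrtr_ge0.
  exact: measurableT_comp measurable_norm3.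
have m11 : measurable_fun setT (fun x : R3 R => x.1.1 : R).
  exact: (measurableT_comp measurable_fst measurable_fst).
have m12 : measurable_fun setT (fun x : R3 R => x.1.2 : R).
  exact: (measurableT_comp measurable_snd measurable_fst).
have m2 : measurable_fun setT (fun x : R3 R => x.2 : R).
  exact: measurable_snd.
apply: measurable_fun_pair; first apply: measurable_fun_pair.
- exact: measurable_funM mV m11.
- exact: measurable_funM mV m12.
- exact: measurable_funM mV m2.
Qed.

(* The surface measure dOmega of the unit sphere, seen as a measure on R^3
   carried by [sphere]: dOmega(A) = 3 vol {x | 0 < |x| <= 1, x / |x| \in A}
   (total mass 4 pi). *)
Definition sphere_measure (A : set (R3 R)) : \bar R :=
  (3%:E * leb3 (normalize3 @^-1` A `&` punctured_ball))%E.

Let sphere_measure0 : sphere_measure set0 = 0%E.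
Proof. by rewrite /sphere_measure preimage_set0 set0I measure0 mule0. Qed.

Let sphere_measure_ge0 A : (0 <= sphere_measure A)%E.
Proof. by rewrite /sphere_measure mule_ge0. Qed.

Let sphere_measure_sigma_additive : semi_sigma_additive sphere_measure.
Proof.
pose mu : {measure set (R3 R) -> \bar R} :=
  mrestr leb3 measurable_punctured_ball.
pose nu : {measure set (R3 R) -> \bar R} :=
  measure_function_pushforward__canonical__measure_function_Measure mu
    measurable_normalize3.
exact: (@measure_semi_sigma_additive _ _ _ (mscale (3%:nng) nu)).
Qed.

HB.instance Definition _ := isMeasure.Build _ _ _ sphere_measure
  sphere_measure0 sphere_measure_ge0 sphere_measure_sigma_additive.

End Space.

Section ComplexValued.
Variable R : realType.
Local Notation C := R[i].

Definition cis (t : R) : C := cos t +i* sin t.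

Definition vnormsq n (v : 'cV[C]_n) : R :=
  \sum_i (complex.Re (v i 0) ^+ 2 + complex.Im (v i 0) ^+ 2).

Definition opnorm n (A : 'M[C]_n) : R :=
  sup [set Num.sqrt (vnormsq (A *m v)) | v in [set v | vnormsq v = 1]].

Context d (T : measurableType d) (mu : {measure set T -> \bar R}) (D : set T).

Definition mx_measurable p q (F : T -> 'M[C]_(p, q)) : Prop :=
  forall i j, measurable_fun D (fun x => complex.Re (F x i j)) /\
              measurable_fun D (fun x => complex.Im (F x i j)).

Definition mx_integral p q (F : T -> 'M[C]_(p, q)) : 'M[C]_(p, q) :=
  \matrix_(i, j) ((\int[mu]_(x in D) complex.Re (F x i j)) +i*
                  (\int[mu]_(x in D) complex.Im (F x i j))).

Definition L2normsq n (f : T -> 'cV[C]_n) : \bar R :=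
  (\int[mu]_(x in D) (vnormsq (f x))%:E)%E.

Definition L2 n : set (T -> 'cV[C]_n) :=
  [set f | mx_measurable f /\ (L2normsq f < +oo)%E].

Definition L2dot n (f g : T -> 'cV[C]_n) : C :=
  mx_integral (fun x => (g x)^t* *m f x) 0 0.

Definition closed_subspace n (N : set (T -> 'cV[C]_n)) : Prop :=
  [/\ N `<=` L2 (n := n),
      N (fun=> 0),
      forall (c : C) f g, N f -> N g -> N (fun x => c *: f x + g x) &
      forall (f_ : nat -> T -> 'cV[C]_n) f, (forall j, N (f_ j)) -> L2 f ->
        L2normsq (fun x => f_ j x - f x) @[j --> \oo] --> 0%E -> N f].

(* Functions are not quotiented by a.e. equality: a "zero" vector is one of
   norm 0. *)
Definition orthonormal_basis n (N : set (T -> 'cV[C]_n)) (I : choiceType)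
    (e_ : I -> T -> 'cV[C]_n) : Prop :=
  [/\ forall i, N (e_ i),
      forall i j, L2dot (e_ i) (e_ j) = (i == j)%:R &
      forall f, N f -> (forall i, L2dot f (e_ i) = 0) -> L2normsq f = 0%E].

(* [A] restricted to the closed subspace [N] of L^2 is a Hilbert-Schmidt
   operator from [N] to L^2.  The target does not matter: if [A] maps [N] to
   itself, this says that [A] is a Hilbert-Schmidt operator in [N]. *)
Definition hilbert_schmidt n (N : set (T -> 'cV[C]_n))
    (A : (T -> 'cV[C]_n) -> T -> 'cV[C]_n) : Prop :=
  [/\ forall f, N f -> L2 (A f),
      forall (c : C) f g, N f -> N g ->
        {ae mu, forall x, D x -> A (fun y => c *: f y + g y) x =
                                 c *: A f x + A g x},
      exists K : R, forall f, N f -> (L2normsq (A f) <= K%:E * L2normsq f)%E &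
      forall (I : choiceType) (e_ : I -> T -> 'cV[C]_n),
        orthonormal_basis N e_ ->
        (\esum_(i in [set: I]) L2normsq (A (e_ i)) < +oo)%E].

End ComplexValued.

Section Dirac.
Variable R : realType.
Local Notation C := R[i].

Definition mx2 (a b c d : C) : 'M[C]_2 :=
  \matrix_(i < 2, j < 2) nth 0 (nth [::] [:: [:: a; b]; [:: c; d]] i) j.

Definition pauli (s : 'I_3) : 'M[C]_2 :=
  nth 0 [:: mx2 0 1 1 0; mx2 0 (0 -i* 1) (0 +i* 1) 0; mx2 1 0 0 (-1)] s.

Definition alpha (s : 'I_3) : 'M[C]_4 :=
  block_mx (0 : 'M[C]_2) (pauli s) (pauli s) (0 : 'M[C]_2).

Definition beta : 'M[C]_4 :=
  block_mx (1%:M : 'M[C]_2) (0 : 'M[C]_2) (0 : 'M[C]_2) (- 1%:M : 'M[C]_2).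

Definition coord3 (x : R3 R) (s : 'I_3) : R := nth 0 [:: x.1.1; x.1.2; x.2] s.

Definition alpha_dot (x : R3 R) : 'M[C]_4 :=
  \sum_(s < 3) (coord3 x s)%:C *: alpha s.

Definition potential (e : R) (nu : R3 R -> C) (A : 'I_3 -> R3 R -> C)
    (r : R3 R) : 'M[C]_4 :=
  - (e%:C * nu r)%:M + e%:C *: \sum_(s < 3) A s r *: alpha s.

(* V = U diag(d) U^* gives |V|^(1/2) and sgn V, which depend on V only. *)
Definition sqrt_abs (U : 'M[C]_4) (d : 'rV[R]_4) : 'M[C]_4 :=
  U *m diag_mx (map_mx (fun x : R => (Num.sqrt `|x|)%:C) d) *m U^t*.

Definition sign_mx (U : 'M[C]_4) (d : 'rV[R]_4) : 'M[C]_4 :=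
  U *m diag_mx (map_mx (fun x : R => (Num.sg x)%:C) d) *m U^t*.

Variable m : R.

Definition spectrum0 : set R := [set l | l <= - m \/ m <= l].

Definition omega (q : R3 R) : R := Num.sqrt (m ^+ 2 + dot3 q q).

(* The index n = 1, ..., 4 of the eigenvectors is n : 'I_4 = {0, ..., 3}. *)
Definition eigval (n : 'I_4) (q : R3 R) : R :=
  if (n < 2)%N then - omega q else omega q.

Definition eigvec (n : 'I_4) (q : R3 R) : 'cV[C]_4 :=
  let q1 : R := q.1.1 in let q2 : R := q.1.2 in let q3 : R := q.2 in
  let odd_vec (D : R) := [:: ((- q1) +i* q2) / D%:C; q3%:C / D%:C; 0; 1] in
  let even_vec (D : R) :=
    [:: (- q3)%:C / D%:C; ((- q1) +i* (- q2)) / D%:C; 1; 0] in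
  \col_(i < 4) nth 0 (nth [::] [:: odd_vec (m + omega q); even_vec (m + omega q);
                              odd_vec (m - omega q); even_vec (m - omega q)] n) i.

Definition eigvec_hat (n : 'I_4) (q : R3 R) : 'cV[C]_4 :=
  ((Num.sqrt (vnormsq (eigvec n q)))^-1)%:C *: eigvec n q.

Definition U0 (k : R3 R) : 'M[C]_4 := \matrix_(i, n) eigvec_hat n k i 0.

Definition sub3 (x y : R3 R) : R3 R :=
  ((x.1.1 : R) - y.1.1, (x.1.2 : R) - y.1.2, (x.2 : R) - y.2).

Definition varkappa (lambda : R) : R := Num.sqrt (lambda ^+ 2 - m ^+ 2).

Definition J_plus (lambda : R) (r : R3 R) : C :=
  (Num.sqrt (pi / 2) / norm3 r)%:C *
  cis (if 0 < lambda then varkappa lambda * norm3 r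
       else - (varkappa lambda * norm3 r)).

Definition Q (r : R3 R) : 'M[C]_4 :=
  (Num.sqrt (pi / 2) * expR (- m * norm3 r) / norm3 r)%:C *:
  (m%:C *: beta + (0 +i* ((m + (norm3 r)^-1) / norm3 r)) *: alpha_dot r).

Definition c32 : R := (2 * pi) `^ (3 / 2).

Definition B_kernel (lambda : R) (r : R3 R) : 'M[C]_4 :=
  Q r
  + (c32 * lambda ^+ 2)%:C *:
    mx_integral (leb3 R) setT (fun v => J_plus lambda v *: Q (sub3 r v))
  + (lambda%:C * J_plus lambda r) *: 1%:M.

Variables V V1 W1 : R3 R -> 'M[C]_4.

Definition B_op (lambda : R) (f : R3 R -> 'cV[C]_4) (r : R3 R) : 'cV[C]_4 :=
  mx_integral (leb3 R) setT
    (fun s => V1 r *m B_kernel lambda (sub3 r s) *m V1 s *m W1 s *m f s).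

Definition exceptional (lambda : R) : Prop :=
  exists psi : R3 R -> 'cV[C]_4,
    [/\ L2 (leb3 R) setT psi,
        ~ {ae leb3 R, forall r, psi r = 0} &
        {ae leb3 R, forall r, psi r + c32%:C *: B_op lambda psi r = 0}].

Definition E_plus : set R :=
  [set lambda | spectrum0 lambda /\ ~ exceptional lambda].

Definition gen_eigenfunction (n : 'I_4) (k : R3 R) (phi : R3 R -> 'cV[C]_4) :
    Prop :=
  L2 (leb3 R) setT (fun r => V1 r *m phi r) /\
  {ae leb3 R, forall r, phi r = cis (dot3 k r) *: eigvec_hat n k
     - c32%:C *: mx_integral (leb3 R) setT (fun s =>
         B_kernel (eigval n k) (sub3 r s) *m V s *m phi s)}.

(* The generalized eigenfunction is unique up to a.e. equality; at the energies
   outside E_+, where it is not defined, it takes the conventional value 0. *)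
Definition phi (n : 'I_4) (k : R3 R) : R3 R -> 'cV[C]_4 :=
  if `[< E_plus (eigval n k) >]
  then xget (fun=> 0) [set f | gen_eigenfunction n k f] else fun=> 0.

Definition Phi (r k : R3 R) : 'M[C]_4 := \matrix_(i, n) phi n k r i 0.

Definition T_mx (q k : R3 R) : 'M[C]_4 :=
  ((2 * pi) ^- 3)%:C *: mx_integral (leb3 R) setT (fun r =>
    cis (- dot3 q r) *: (V r *m Phi r k *m (U0 k)^t*)).

Definition T1_mx (q k : R3 R) : 'M[C]_2 := @ulsubmx C 2 2 2 2 (T_mx q k).
Definition T2_mx (q k : R3 R) : 'M[C]_2 := @drsubmx C 2 2 2 2 (T_mx q k).

Definition sphere_op (K : R3 R -> R3 R -> 'M[C]_2) (lambda : R)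
    (h : R3 R -> 'cV[C]_2) (w : R3 R) : 'cV[C]_2 :=
  let k := varkappa lambda in
  (2 * pi * Num.sqrt (k ^+ 2 + m ^+ 2) * k)%:C *:
  mx_integral (@sphere_measure R) (@sphere R)
    (fun w' => K (scale3 k w) (scale3 k w') *m h w').

Definition T1_op := sphere_op T1_mx.
Definition T2_op := sphere_op T2_mx.

End Dirac.

(* Main.v *)
(** Write [B(r-s) = near + far] by cutting off the values [|B| > M].  The free
    resolvent kernel is bounded plus integrable, so by Young's inequality the near
    part of [V_1 B V_1 W_1] has small norm for [M] large; the far part is bounded,
    its weights [V_1(r)], [V_1(s) W_1(s)] are in L^2, and a bounded kernel is
    approximated in weighted L^2 by finite sums of products.  Hence the operator is
    finite rank plus small and the Fredholm alternative applies: off the exceptional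
    set, [psi + (2 pi)^(3/2) B_+ psi = f] has one solution and it depends boundedly
    on [f].  The [V_1 phi_n] solve this equation with [f] of norm bounded uniformly
    in the momentum, and they depend continuously on the momentum by dominated
    convergence.  Therefore the kernel of [T_p] is bounded and measurable on the
    sphere, which has finite measure, and Bessel's inequality in the second variable
    bounds the Hilbert-Schmidt sum.

    The matrices [U], [d] need not be measurable; [V_1] and [W_1] are, because they
    are pointwise limits of polynomials in [V]. *)

Require Import Defs.
From HB Require Import structures.
From mathcomp Require Import all_boot all_order all_algebra.
From mathcomp Require Import all_classical all_reals all_analysis.
From mathcomp Require Import measurable_realfun ring lra.
From mathcomp Require Import complex.

Set Implicit Arguments.
Unset Strict Implicit.
Unset Printing Implicit Defensive.
Import Order.TTheory GRing.Theory Num.Theory.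
Import numFieldNormedType.Exports.

Local Open Scope classical_set_scope.
Local Open Scope ring_scope.
Local Open Scope complex_scope.
Local Open Scope sesquilinear_scope.

(** * Matrix norms and integrals *)

Section Norms.
Variable R : realType.
Local Notation C := R[i].

(** The free kernel has an [r^-2] singularity, whose square is not locally integrable in dimension
    3, so the sandwiched kernel need not be square integrable and compactness comes only from
    approximation. Functions are not classes: operators are linear, and equations solved, only
    almost everywhere. The Fredholm argument therefore runs in a complete seminormed space modulo
    null vectors, with squared norms and factors 2 in place of the triangle inequality. Moreover
    [phi n k] is picked by choice separately for each [k], which gives no regularity in [k]. The
    proof works instead with a matrix solution [X k] for the plane wave, independent of [n];
    uniqueness identifies [V phi] with [V1 W1 (X k)] applied to the explicit eigenvector, for almost
    every [r]. Finally, the adjoint of [U0] mixes the four columns of [Phi], so each block [T_p]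
    involves both energies [lambda] and [- lambda]. The second may be exceptional; its columns are
    then 0 by convention, so both cases satisfy the same estimates. *)

Definition l1 (z : C) : R := `|complex.Re z| + `|complex.Im z|.

(** An entrywise norm is visibly measurable, submultiplicative and compatible with integration of
    entries; the comparison with [vnormsq] costs only constants depending on the dimension. *)
Definition nm p q (A : 'M[C]_(p, q)) : R := \sum_i \sum_j l1 (A i j).

Lemma l1_ge0 z : 0 <= l1 z. Proof. by rewrite addr_ge0. Qed.

Lemma cReD (x y : C) : complex.Re (x + y) = complex.Re x + complex.Re y.
Proof. by case: x y => [a b] [c d]. Qed.
Lemma cImD (x y : C) : complex.Im (x + y) = complex.Im x + complex.Im y.
Proof. by case: x y => [a b] [c d]. Qed.
Lemma cReN (x : C) : complex.Re (- x) = - complex.Re x.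
Proof. by case: x. Qed.
Lemma cImN (x : C) : complex.Im (- x) = - complex.Im x.
Proof. by case: x. Qed.
Lemma cReM (x y : C) : complex.Re (x * y) =
  complex.Re x * complex.Re y - complex.Im x * complex.Im y.
Proof. by case: x y => [a b] [c d]. Qed.
Lemma cImM (x y : C) : complex.Im (x * y) =
  complex.Re x * complex.Im y + complex.Im x * complex.Re y.
Proof. by case: x y => [a b] [c d]. Qed.
Lemma cReJ (x : C) : complex.Re (x^*)%R = complex.Re x.
Proof. by case: x. Qed.
Lemma cImJ (x : C) : complex.Im (x^*)%R = - complex.Im x.
Proof. by case: x. Qed.
Lemma eq_cReIm (x y : C) : complex.Re x = complex.Re y ->
  complex.Im x = complex.Im y -> x = y.
Proof. by case: x y => [a b] [c d] /= -> ->. Qed.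
Lemma cRe_sum I (r : seq I) (P : pred I) (F : I -> C) :
  complex.Re (\sum_(i <- r | P i) F i) = \sum_(i <- r | P i) complex.Re (F i).
Proof. by elim/big_rec2 : _ => [|i y1 y2 Pi <-] //; rewrite cReD. Qed.
Lemma cIm_sum I (r : seq I) (P : pred I) (F : I -> C) :
  complex.Im (\sum_(i <- r | P i) F i) = \sum_(i <- r | P i) complex.Im (F i).
Proof. by elim/big_rec2 : _ => [|i y1 y2 Pi <-] //; rewrite cImD. Qed.

Lemma l1_0 : l1 0 = 0. Proof. by rewrite /l1 /= normr0 addr0. Qed.

Lemma l1_eq0 z : l1 z = 0 -> z = 0.
Proof.
move/eqP; rewrite /l1 paddr_eq0// !normr_eq0 => /andP[/eqP a /eqP b].
exact: eq_cReIm.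
Qed.

Lemma l1D x y : l1 (x + y) <= l1 x + l1 y.
Proof. by rewrite /l1 cReD cImD addrACA lerD// ler_normD. Qed.

Lemma l1N x : l1 (- x) = l1 x.
Proof. by rewrite /l1 cReN cImN !normrN. Qed.

Lemma l1J x : l1 (x^*)%R = l1 x.
Proof. by rewrite /l1 cReJ cImJ normrN. Qed.

Lemma l1M x y : l1 (x * y) <= l1 x * l1 y.
Proof.
rewrite /l1 cReM cImM mulrDl !mulrDr -!normrM.
rewrite (le_trans (lerD (ler_normD _ _) (ler_normD _ _)))// normrN.
by rewrite le_eqVlt; apply/orP; left; apply/eqP; ring.
Qed.

Lemma l1_real (a : R) : l1 a%:C = `|a|.
Proof. by rewrite /l1 /= normr0 addr0. Qed.

Lemma l1_realM (a : R) z : l1 (a%:C * z) = `|a| * l1 z.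
Proof. by rewrite /l1 cReM cImM /= !mul0r subr0 addr0 !normrM mulrDr. Qed.

Lemma l1_sum I (r : seq I) (P : pred I) (F : I -> C) :
  l1 (\sum_(i <- r | P i) F i) <= \sum_(i <- r | P i) l1 (F i).
Proof.
elim/big_rec2 : _ => [|i y1 y2 Pi H]; first by rewrite l1_0.
by rewrite (le_trans (l1D _ _))// lerD2l.
Qed.

Lemma l1_cis t : l1 (cis t) <= 2.
Proof.
rewrite /l1/=; apply: (@le_trans _ _ (1 + 1)); last by lra.
by rewrite lerD// ler_norml ?cos_geN1 ?cos_le1 ?sin_geN1 ?sin_le1.
Qed.

Lemma normRe_l1 (z : C) : `|complex.Re z| <= l1 z.
Proof. by rewrite lerDl. Qed.

Lemma normIm_l1 (z : C) : `|complex.Im z| <= l1 z.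
Proof. by rewrite lerDr. Qed.

Lemma l1_sqr_le (z : C) :
  complex.Re z ^+ 2 + complex.Im z ^+ 2 <= l1 z ^+ 2.
Proof.
rewrite /l1 sqrrD -!normrX !(ger0_norm (sqr_ge0 _)) addrAC lerDl.
by rewrite mulrn_wge0// mulr_ge0.
Qed.

Lemma sqrD_le (a b : R) : (a + b) ^+ 2 <= 2 * (a ^+ 2 + b ^+ 2).
Proof.
rewrite -subr_ge0 [leRHS](_ : _ = (a - b) ^+ 2) ?sqr_ge0//.
by ring.
Qed.

Lemma l1_sqr_ge (z : C) :
  l1 z ^+ 2 <= 2 * (complex.Re z ^+ 2 + complex.Im z ^+ 2).
Proof.
rewrite /l1 -[X in 2 * (X + _)]real_normK ?num_real//.
rewrite -[X in 2 * (_ + X)]real_normK ?num_real//.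
exact: sqrD_le.
Qed.

Lemma nm_ge0 p q (A : 'M[C]_(p, q)) : 0 <= nm A.
Proof. by rewrite sumr_ge0// => i _; rewrite sumr_ge0// => j _; exact: l1_ge0. Qed.

Lemma l1_nm p q (A : 'M[C]_(p, q)) i j : l1 (A i j) <= nm A.
Proof.
rewrite /nm (bigD1 i)//= (bigD1 j)//= -addrA lerDl addr_ge0//.
  by rewrite sumr_ge0// => k _; exact: l1_ge0.
by rewrite sumr_ge0// => k _; rewrite sumr_ge0// => k' _; exact: l1_ge0.
Qed.

Lemma nm0 p q : nm (0 : 'M[C]_(p, q)) = 0.
Proof.
by rewrite /nm big1// => i _; rewrite big1// => j _; rewrite mxE l1_0.
Qed.

Lemma nm_eq0 p q (A : 'M[C]_(p, q)) : nm A = 0 -> A = 0.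
Proof.
move=> A0; apply/matrixP => i j; rewrite mxE; apply: l1_eq0.
by apply/eqP; rewrite eq_le l1_ge0 andbT -A0 l1_nm.
Qed.

Lemma nmD p q (A B : 'M[C]_(p, q)) : nm (A + B) <= nm A + nm B.
Proof.
rewrite /nm -big_split ler_sum//= => i _; rewrite -big_split ler_sum//= => j _.
by rewrite mxE l1D.
Qed.

Lemma nmN p q (A : 'M[C]_(p, q)) : nm (- A) = nm A.
Proof. by apply: eq_bigr => i _; apply: eq_bigr => j _; rewrite mxE l1N. Qed.

Lemma nm_sum p q I (r : seq I) (P : pred I) (F : I -> 'M[C]_(p, q)) :
  nm (\sum_(i <- r | P i) F i) <= \sum_(i <- r | P i) nm (F i).
Proof.
elim/big_rec2 : _ => [|i y1 y2 Pi H]; first by rewrite nm0.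
by rewrite (le_trans (nmD _ _))// lerD2l.
Qed.

Lemma nmZ p q (c : C) (A : 'M[C]_(p, q)) : nm (c *: A) <= l1 c * nm A.
Proof.
rewrite /nm mulr_sumr ler_sum// => i _; rewrite mulr_sumr ler_sum// => j _.
by rewrite mxE l1M.
Qed.

Lemma nmZr p q (c : R) (A : 'M[C]_(p, q)) : nm (c%:C *: A) = `|c| * nm A.
Proof.
rewrite /nm mulr_sumr; apply: eq_bigr => i _; rewrite mulr_sumr.
by apply: eq_bigr => j _; rewrite mxE l1_realM.
Qed.

Lemma nmM p q r (A : 'M[C]_(p, q)) (B : 'M[C]_(q, r)) :
  nm (A *m B) <= nm A * nm B.
Proof.
rewrite /nm mulr_suml ler_sum// => i _.
apply: (@le_trans _ _ (\sum_k \sum_j l1 (A i j) * l1 (B j k))).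
  rewrite ler_sum// => k _; rewrite mxE (le_trans (l1_sum _ _ _))//.
  by rewrite ler_sum// => j _; exact: l1M.
rewrite exchange_big/= mulr_suml ler_sum// => j _.
rewrite -mulr_sumr ler_wpM2l ?l1_ge0//.
rewrite [leRHS](bigD1 j)//= lerDl.
by rewrite sumr_ge0// => k _; rewrite sumr_ge0// => k' _; exact: l1_ge0.
Qed.

Lemma nm_trC p q (A : 'M[C]_(p, q)) : nm (A ^t*) = nm A.
Proof.
rewrite /nm exchange_big; apply: eq_bigr => i _; apply: eq_bigr => j _.
by rewrite !mxE l1J.
Qed.

Lemma nm_cv n (v : 'cV[C]_n) : nm v = \sum_i l1 (v i 0).
Proof. by apply: eq_bigr => i _; rewrite big_ord1. Qed.

Lemma vnormsq_ge0 n (v : 'cV[C]_n) : 0 <= vnormsq v.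
Proof. by rewrite sumr_ge0// => i _; rewrite addr_ge0// sqr_ge0. Qed.

Lemma vnormsq_le_nm n (v : 'cV[C]_n) : vnormsq v <= nm v ^+ 2.
Proof.
rewrite nm_cv expr2 mulr_suml /vnormsq ler_sum// => i _.
rewrite (le_trans (l1_sqr_le _))// expr2 ler_wpM2l ?l1_ge0//.
rewrite (bigD1 i)//= lerDl.
by rewrite sumr_ge0// => k _; exact: l1_ge0.
Qed.

Lemma sqr_sum_le n (f : 'I_n -> R) :
  (\sum_i f i) ^+ 2 <= n%:R * \sum_i f i ^+ 2.
Proof.
have E : \sum_(i < n) \sum_(j < n) f j ^+ 2 = n%:R * \sum_i f i ^+ 2.
  by rewrite sumr_const card_ord mulr_natl.
apply: (@le_trans _ _ (\sum_i \sum_j (f i ^+ 2 / 2 + f j ^+ 2 / 2))).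
  rewrite expr2 mulr_suml ler_sum// => i _; rewrite mulr_sumr ler_sum// => j _.
  by have := sqr_ge0 (f i - f j); lra.
under eq_bigr do rewrite big_split/=.
rewrite big_split/= [X in X + _]exchange_big/=.
under eq_bigr do rewrite -mulr_suml.
by rewrite -mulr_suml E -splitr.
Qed.

(** In the factor [2 * n], the 2 comes from replacing [l1] by the modulus and [n] from
    Cauchy-Schwarz over the entries. *)
Lemma nm_le_vnormsq n (v : 'cV[C]_n) : nm v ^+ 2 <= (2 * n)%:R * vnormsq v.
Proof.
rewrite nm_cv (le_trans (sqr_sum_le _))// mulnC natrM -mulrA ler_wpM2l//.
rewrite /vnormsq mulr_sumr ler_sum// => i _.
exact: l1_sqr_ge.
Qed.

End Norms.

(** * Measurability of matrix-valued functions *)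

Section Measurability.
Context d (T : measurableType d) (R : realType) (D : set T).
Local Notation C := R[i].

Definition cmeasurable (f : T -> C) : Prop :=
  measurable_fun D (fun x => complex.Re (f x)) /\
  measurable_fun D (fun x => complex.Im (f x)).

Lemma cmeasurable_cst (c : C) : cmeasurable (fun=> c).
Proof. by split; exact: measurable_cst. Qed.

Lemma cmeasurable_real (f : T -> R) :
  measurable_fun D f -> cmeasurable (fun x => (f x)%:C).
Proof. by move=> mf; split => //=; exact: measurable_cst. Qed.

Lemma cmeasurableD f g : cmeasurable f -> cmeasurable g ->
  cmeasurable (fun x => f x + g x).
Proof.
move=> [f1 f2] [g1 g2]; split.
  by under eq_fun do rewrite cReD; exact: measurable_funD.
by under eq_fun do rewrite cImD; exact: measurable_funD.
Qed.

Lemma cmeasurableM f g : cmeasurable f -> cmeasurable g ->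
  cmeasurable (fun x => f x * g x).
Proof.
move=> [f1 f2] [g1 g2]; split.
  apply: (eq_measurable_fun (fun x => complex.Re (f x) * complex.Re (g x) -
      complex.Im (f x) * complex.Im (g x))) => [x _|]; first by rewrite cReM.
  by apply: measurable_funB; exact: measurable_funM.
apply: (eq_measurable_fun (fun x => complex.Re (f x) * complex.Im (g x) +
    complex.Im (f x) * complex.Re (g x))) => [x _|]; first by rewrite cImM.
by apply: measurable_funD; exact: measurable_funM.
Qed.

Lemma cmeasurable_sum I (r : seq I) (F : I -> T -> C) :
  (forall i, cmeasurable (F i)) -> cmeasurable (fun x => \sum_(i <- r) F i x).
Proof.
move=> mF; elim: r => [|i r ih].
  by under eq_fun do rewrite big_nil; exact: cmeasurable_cst.
by under eq_fun do rewrite big_cons; exact: cmeasurableD.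
Qed.

Lemma cmeasurable_conj f : cmeasurable f -> cmeasurable (fun x => (f x)^*)%R.
Proof.
move=> [f1 f2]; split; first by under eq_fun do rewrite cReJ.
by under eq_fun do rewrite cImJ; exact: measurableT_comp.
Qed.

Lemma cmeasurable_cis (f : T -> R) :
  measurable_fun D f -> cmeasurable (fun x => cis (f x)).
Proof.
move=> mf; split => /=; apply: measurableT_comp mf.
  by apply: continuous_measurable_fun; exact: continuous_cos.
by apply: continuous_measurable_fun; exact: continuous_sin.
Qed.

Lemma measurable_l1 f : cmeasurable f -> measurable_fun D (fun x => l1 (f x)).
Proof. by move=> [f1 f2]; apply: measurable_funD; exact: measurableT_comp. Qed.

Lemma mx_measurable_entry p q (F : T -> 'M[C]_(p, q)) i j :
  mx_measurable D F -> cmeasurable (fun x => F x i j).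
Proof. by move=> /(_ i j). Qed.

Lemma mx_measurable_cst p q (A : 'M[C]_(p, q)) : mx_measurable D (fun=> A).
Proof. by move=> i j; exact: cmeasurable_cst. Qed.

Lemma mx_measurableD p q (F G : T -> 'M[C]_(p, q)) :
  mx_measurable D F -> mx_measurable D G -> mx_measurable D (fun x => F x + G x).
Proof.
move=> mF mG i j.
rewrite (_ : (fun x => _) = fun x => complex.Re (F x i j + G x i j)); last first.
  by apply/funext => x; rewrite mxE.
rewrite (_ : (fun x => complex.Im _) =
    fun x => complex.Im (F x i j + G x i j)); last first.
  by apply/funext => x; rewrite mxE.
by apply: cmeasurableD; exact: mx_measurable_entry.
Qed.

Lemma eq_mx_measurable p q (F G : T -> 'M[C]_(p, q)) :
  {in D, F =1 G} -> mx_measurable D F -> mx_measurable D G.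
Proof.
move=> FG mF i j; have [m1 m2] := mF i j; split.
  by apply: eq_measurable_fun m1 => x xD; rewrite FG.
by apply: eq_measurable_fun m2 => x xD; rewrite FG.
Qed.

Lemma mx_measurable_mx p q (f : 'I_p -> 'I_q -> T -> C) :
  (forall i j, cmeasurable (f i j)) ->
  mx_measurable D (fun x => \matrix_(i, j) f i j x).
Proof.
move=> mf i j; have [m1 m2] := mf i j; split.
  by apply: eq_measurable_fun m1 => x xD; rewrite mxE.
by apply: eq_measurable_fun m2 => x xD; rewrite mxE.
Qed.

Lemma mx_measurableZ p q (f : T -> C) (G : T -> 'M[C]_(p, q)) :
  cmeasurable f -> mx_measurable D G -> mx_measurable D (fun x => f x *: G x).
Proof.
move=> mf mG; apply: (@eq_mx_measurable _ _
    (fun x => \matrix_(i, j) (f x * G x i j))).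
  by move=> x _; apply/matrixP => i j; rewrite !mxE.
by apply: mx_measurable_mx => i j; apply: cmeasurableM.
Qed.

Lemma mx_measurableZc p q (c : C) (G : T -> 'M[C]_(p, q)) :
  mx_measurable D G -> mx_measurable D (fun x => c *: G x).
Proof. exact: (@mx_measurableZ _ _ (fun=> c) _ (cmeasurable_cst c)). Qed.

Lemma mx_measurableN p q (G : T -> 'M[C]_(p, q)) :
  mx_measurable D G -> mx_measurable D (fun x => - G x).
Proof.
move=> mG; under eq_fun do rewrite -scaleN1r.
by apply: mx_measurableZ => //; exact: cmeasurable_cst.
Qed.

Lemma mx_measurableB p q (F G : T -> 'M[C]_(p, q)) :
  mx_measurable D F -> mx_measurable D G -> mx_measurable D (fun x => F x - G x).
Proof. by move=> mF mG; apply: mx_measurableD => //; exact: mx_measurableN. Qed.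

Lemma mx_measurableM p q r (F : T -> 'M[C]_(p, q)) (G : T -> 'M[C]_(q, r)) :
  mx_measurable D F -> mx_measurable D G -> mx_measurable D (fun x => F x *m G x).
Proof.
move=> mF mG; apply: (@eq_mx_measurable _ _
    (fun x => \matrix_(i, j) \sum_k (F x i k * G x k j))).
  by move=> x _; apply/matrixP => i j; rewrite !mxE.
apply: mx_measurable_mx => i j; apply: cmeasurable_sum => k.
by apply: cmeasurableM; exact: mx_measurable_entry.
Qed.

Lemma mx_measurable_sum p q I (r : seq I) (F : I -> T -> 'M[C]_(p, q)) :
  (forall i, mx_measurable D (F i)) ->
  mx_measurable D (fun x => \sum_(i <- r) F i x).
Proof.
move=> mF; elim: r => [|i r ih].
  by under eq_fun do rewrite big_nil; exact: mx_measurable_cst.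
by under eq_fun do rewrite big_cons; exact: mx_measurableD.
Qed.

Lemma mx_measurable_trC p q (F : T -> 'M[C]_(p, q)) :
  mx_measurable D F -> mx_measurable D (fun x => (F x)^t*).
Proof.
move=> mF; apply: (@eq_mx_measurable _ _
    (fun x => \matrix_(i, j) (F x j i)^*)%R).
  by move=> x _; apply/matrixP => i j; rewrite !mxE.
apply: mx_measurable_mx => i j; apply: cmeasurable_conj.
exact: mx_measurable_entry.
Qed.

Lemma measurable_nm p q (F : T -> 'M[C]_(p, q)) :
  mx_measurable D F -> measurable_fun D (fun x => nm (F x)).
Proof.
move=> mF; apply: measurable_sum => i; apply: measurable_sum => j.
by apply: measurable_l1; exact: mx_measurable_entry.
Qed.

Lemma measurable_vnormsq n (F : T -> 'cV[C]_n) :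
  mx_measurable D F -> measurable_fun D (fun x => vnormsq (F x)).
Proof.
move=> mF; apply: measurable_sum => i; have [m1 m2] := mF i 0.
by apply: measurable_funD; exact: measurable_funX.
Qed.

End Measurability.

Lemma mx_measurable_comp d1 d2 (T1 : measurableType d1) (T2 : measurableType d2)
    (R : realType) p q (F : T2 -> 'M[R[i]]_(p, q)) (g : T1 -> T2) :
  mx_measurable setT F -> measurable_fun setT g ->
  mx_measurable setT (fun x => F (g x)).
Proof.
by move=> mF mg i j; have [m1 m2] := mF i j; split;
  [exact: (measurableT_comp m1 mg)|exact: (measurableT_comp m2 mg)].
Qed.

Lemma mx_measurable_subT d (T : measurableType d) (R : realType) p q
    (D : set T) (F : T -> 'M[R[i]]_(p, q)) :
  mx_measurable setT F -> mx_measurable D F.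
Proof.
by move=> mF i j; have [m1 m2] := mF i j; split; exact: measurable_funTS.
Qed.

(** * Integrals of matrix-valued functions *)

Section Integral.
Context d (T : measurableType d) (R : realType).
Variables (mu : {measure set T -> \bar R}) (D : set T).
Hypothesis mD : measurable D.
Local Notation C := R[i].

Lemma le_integral_fin (f g : T -> R) : measurable_fun D f -> measurable_fun D g ->
  (forall x, D x -> 0 <= f x) -> (forall x, D x -> f x <= g x) ->
  (\int[mu]_(x in D) (f x)%:E <= \int[mu]_(x in D) (g x)%:E)%E.
Proof.
move=> mf mg f0 fg; apply: ge0_le_integral => //.
- exact/measurable_EFinP.
- exact/measurable_EFinP.
Qed.

Lemma integralZl_fin (c : R) (f : T -> R) : measurable_fun D f -> 0 <= c ->
  (forall x, D x -> 0 <= f x) ->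
  (\int[mu]_(x in D) (c * f x)%:E = c%:E * \int[mu]_(x in D) (f x)%:E)%E.
Proof.
move=> mf c0 f0; under eq_integral do rewrite EFinM.
by rewrite ge0_integralZl//; exact/measurable_EFinP.
Qed.

Lemma integralD_fin (f g : T -> R) : measurable_fun D f -> measurable_fun D g ->
  (forall x, D x -> 0 <= f x) -> (forall x, D x -> 0 <= g x) ->
  (\int[mu]_(x in D) (f x + g x)%:E =
   \int[mu]_(x in D) (f x)%:E + \int[mu]_(x in D) (g x)%:E)%E.
Proof.
move=> mf mg f0 g0; under eq_integral do rewrite EFinD.
by rewrite ge0_integralD//; exact/measurable_EFinP.
Qed.

Definition mx_integrable p q (F : T -> 'M[C]_(p, q)) : Prop :=
  mx_measurable D F /\ (\int[mu]_(x in D) (nm (F x))%:E < +oo)%E.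

Lemma mx_integrable_le p q (F : T -> 'M[C]_(p, q)) (g : T -> R) :
  mx_measurable D F -> measurable_fun D g ->
  (forall x, D x -> nm (F x) <= g x) -> (\int[mu]_(x in D) (g x)%:E < +oo)%E ->
  mx_integrable F.
Proof.
move=> mF mg Fg goo; split => //; apply: le_lt_trans goo.
apply: le_integral_fin => //; first exact: measurable_nm.
by move=> x _; exact: nm_ge0.
Qed.

Lemma mx_integrable_entry p q (F : T -> 'M[C]_(p, q)) i j : mx_integrable F ->
  mu.-integrable D (fun x => (complex.Re (F x i j))%:E) /\
  mu.-integrable D (fun x => (complex.Im (F x i j))%:E).
Proof.
move=> [mF iF]; have [m1 m2] := mF i j.
have iN : mu.-integrable D (fun x => (nm (F x))%:E).
  apply/integrableP; split; first exact/measurable_EFinP/measurable_nm.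
  by under eq_integral do rewrite gee0_abs ?lee_fin ?nm_ge0//.
split; apply: le_integrable iN => //; try exact/measurable_EFinP.
  move=> x _; rewrite !abse_EFin lee_fin (ger0_norm (nm_ge0 _)).
  by rewrite (le_trans (normRe_l1 _))// l1_nm.
move=> x _; rewrite !abse_EFin lee_fin (ger0_norm (nm_ge0 _)).
by rewrite (le_trans (normIm_l1 _))// l1_nm.
Qed.

Lemma mx_integrableD p q (F G : T -> 'M[C]_(p, q)) : mx_integrable F ->
  mx_integrable G -> mx_integrable (fun x => F x + G x).
Proof.
move=> [mF iF] [mG iG]; apply: (@mx_integrable_le _ _ _
    (fun x => nm (F x) + nm (G x))).
- exact: mx_measurableD.
- by apply: measurable_funD; exact: measurable_nm.
- by move=> x _; exact: nmD.
- rewrite integralD_fin//; last 4 first.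
  + exact: measurable_nm.
  + exact: measurable_nm.
  + by move=> x _; exact: nm_ge0.
  + by move=> x _; exact: nm_ge0.
  exact: lte_add_pinfty.
Qed.

Lemma mx_integrable_mull p q r (A : 'M[C]_(p, q)) (F : T -> 'M[C]_(q, r)) :
  mx_integrable F -> mx_integrable (fun x => A *m F x).
Proof.
move=> [mF iF]; apply: (@mx_integrable_le _ _ _ (fun x => nm A * nm (F x))).
- by apply: mx_measurableM => //; exact: mx_measurable_cst.
- by apply: measurable_funM => //; exact: measurable_nm.
- by move=> x _; exact: nmM.
- rewrite integralZl_fin ?nm_ge0//; last 2 first.
  + exact: measurable_nm.
  + by move=> x _; exact: nm_ge0.
  by rewrite lte_mul_pinfty// ?lee_fin ?nm_ge0.
Qed.

Lemma mx_integrable_mulr p q r (A : 'M[C]_(q, r)) (F : T -> 'M[C]_(p, q)) :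
  mx_integrable F -> mx_integrable (fun x => F x *m A).
Proof.
move=> [mF iF]; apply: (@mx_integrable_le _ _ _ (fun x => nm A * nm (F x))).
- by apply: mx_measurableM => //; exact: mx_measurable_cst.
- by apply: measurable_funM => //; exact: measurable_nm.
- by move=> x _; rewrite mulrC; exact: nmM.
- rewrite integralZl_fin ?nm_ge0//; last 2 first.
  + exact: measurable_nm.
  + by move=> x _; exact: nm_ge0.
  by rewrite lte_mul_pinfty// ?lee_fin ?nm_ge0.
Qed.

Lemma mx_integrableZ p q (c : C) (F : T -> 'M[C]_(p, q)) :
  mx_integrable F -> mx_integrable (fun x => c *: F x).
Proof.
by move=> iF; under eq_fun do rewrite -mul_scalar_mx; exact: mx_integrable_mull.
Qed.

Lemma mx_integralD p q (F G : T -> 'M[C]_(p, q)) : mx_integrable F ->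
  mx_integrable G -> mx_integral mu D (fun x => F x + G x) =
  mx_integral mu D F + mx_integral mu D G.
Proof.
move=> iF iG; apply/matrixP => i j; rewrite !mxE.
have [F1 F2] := mx_integrable_entry i j iF.
have [G1 G2] := mx_integrable_entry i j iG.
apply: eq_cReIm => /=.
  by rewrite -RintegralD//; apply: eq_Rintegral => x _; rewrite mxE cReD.
by rewrite -RintegralD//; apply: eq_Rintegral => x _; rewrite mxE cImD.
Qed.

Lemma Rintegral_lin (a b : R) (f g : T -> R) :
  mu.-integrable D (EFin \o f) -> mu.-integrable D (EFin \o g) ->
  \int[mu]_(x in D) (a * f x + b * g x) =
  a * \int[mu]_(x in D) f x + b * \int[mu]_(x in D) g x.
Proof.
move=> fi gi; rewrite RintegralD//; first by rewrite !RintegralZl.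
  by apply: (integrableZl mD a fi).
by apply: (integrableZl mD b gi).
Qed.

Lemma mx_integralZ p q (c : C) (F : T -> 'M[C]_(p, q)) : mx_integrable F ->
  mx_integral mu D (fun x => c *: F x) = c *: mx_integral mu D F.
Proof.
move=> iF; apply/matrixP => i j; rewrite !mxE.
have [F1 F2] := mx_integrable_entry i j iF.
apply: eq_cReIm; rewrite ?cReM ?cImM/=.
  rewrite -mulNr -Rintegral_lin//; apply: eq_Rintegral => x _.
  by rewrite mxE cReM mulNr.
rewrite addrC [RHS]addrC -Rintegral_lin//; apply: eq_Rintegral => x _.
by rewrite mxE cImM addrC.
Qed.

Lemma mx_integral0 p q : mx_integral mu D (fun=> 0 : 'M[C]_(p, q)) = 0.
Proof.
apply/matrixP => i j; rewrite !mxE.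
by rewrite /Rintegral integral0.
Qed.

Lemma mx_integrable_sum p q n (F : 'I_n -> T -> 'M[C]_(p, q)) :
  (forall i, mx_integrable (F i)) -> mx_integrable (fun x => \sum_i F i x).
Proof.
elim: n F => [F _|n ih F iF].
  under eq_fun do rewrite big_ord0; split; first exact: mx_measurable_cst.
  by under eq_integral do rewrite nm0; rewrite integral0.
under eq_fun do rewrite big_ord_recl.
by apply: mx_integrableD => //; exact: ih.
Qed.

Lemma mx_integral_sum p q n (F : 'I_n -> T -> 'M[C]_(p, q)) :
  (forall i, mx_integrable (F i)) ->
  mx_integral mu D (fun x => \sum_i F i x) = \sum_i mx_integral mu D (F i).
Proof.
elim: n F => [F _|n ih F iF].
  by under eq_fun do rewrite big_ord0; rewrite big_ord0 mx_integral0.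
under eq_fun do rewrite big_ord_recl.
rewrite mx_integralD//; last exact: mx_integrable_sum.
by rewrite ih// big_ord_recl.
Qed.

Lemma mx_integral_mull p q r (A : 'M[C]_(p, q)) (F : T -> 'M[C]_(q, r)) :
  mx_integrable F ->
  mx_integral mu D (fun x => A *m F x) = A *m mx_integral mu D F.
Proof.
move=> iF; apply/matrixP => i j.
(* Scalar integrals are regarded as integrals of 1 x 1 matrices, so that additivity and homogeneity
   of [mx_integral] apply to each entry of the product. *)
have iE k : mx_integrable (fun x => (F x k j)%:M : 'M[C]_1).
  apply: (@mx_integrable_le _ _ _ (fun x => nm (F x))) => //.
  - move=> i' j'; have [m1 m2] := iF.1 k j.
    by split; [apply: eq_measurable_fun m1|apply: eq_measurable_fun m2] => x _;
      rewrite !mxE !ord1.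
  - exact: measurable_nm iF.1.
  - by move=> x _; rewrite /nm !big_ord1 mxE; exact: l1_nm.
  - exact: iF.2.
have E (f : T -> C) : (mx_integral mu D (fun x => (f x)%:M : 'M[C]_1)) 0 0 =
    (\int[mu]_(x in D) complex.Re (f x)) +i* (\int[mu]_(x in D) complex.Im (f x)).
  by rewrite mxE; congr (_ +i* _); apply: eq_Rintegral => x _; rewrite !mxE.
rewrite !mxE -E.
have -> : (fun x => ((A *m F x) i j)%:M : 'M[C]_1) =
    (fun x => \sum_k A i k *: ((F x k j)%:M : 'M[C]_1)).
  by apply/funext => x; rewrite mxE raddf_sum/=; apply: eq_bigr => k _;
    rewrite scale_scalar_mx.
rewrite mx_integral_sum; last by move=> k; exact: mx_integrableZ.
rewrite summxE; apply: eq_bigr => k _.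
by rewrite mx_integralZ// mxE E mxE.
Qed.

Lemma mx_integral_tr p q (F : T -> 'M[C]_(p, q)) :
  mx_integral mu D (fun x => (F x)^T) = (mx_integral mu D F)^T.
Proof.
apply/matrixP => i j; rewrite !mxE.
by congr (_ +i* _); apply: eq_Rintegral => x _; rewrite mxE.
Qed.

Lemma nm_tr p q (A : 'M[C]_(p, q)) : nm A^T = nm A.
Proof.
rewrite /nm exchange_big; apply: eq_bigr => i _; apply: eq_bigr => j _.
by rewrite mxE.
Qed.

Lemma mx_integrable_tr p q (F : T -> 'M[C]_(p, q)) :
  mx_integrable F -> mx_integrable (fun x => (F x)^T).
Proof.
move=> [mF iF]; split; last by under eq_integral do rewrite nm_tr.
move=> i j; have [m1 m2] := mF j i.
by split; [apply: eq_measurable_fun m1|apply: eq_measurable_fun m2] => x _;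
  rewrite mxE.
Qed.

Lemma mx_integral_mulr p q r (A : 'M[C]_(q, r)) (F : T -> 'M[C]_(p, q)) :
  mx_integrable F ->
  mx_integral mu D (fun x => F x *m A) = mx_integral mu D F *m A.
Proof.
move=> iF; apply: trmx_inj; rewrite trmx_mul -!mx_integral_tr.
under eq_fun do rewrite trmx_mul.
by rewrite mx_integral_mull//; exact: mx_integrable_tr.
Qed.

(** No constant is lost: [nm] is a sum of absolute values of real functions, and the triangle
    inequality for integrals holds for each of them. *)
Lemma nm_mx_integral p q (F : T -> 'M[C]_(p, q)) : mx_integrable F ->
  ((nm (mx_integral mu D F))%:E <= \int[mu]_(x in D) (nm (F x))%:E)%E.
Proof.
move=> iF; have m i j := mx_measurable_entry i j iF.1.
under [leRHS]eq_integral do rewrite /nm -sumEFin.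
rewrite ge0_integral_sum//; first last.
- by move=> i x _; rewrite lee_fin sumr_ge0// => j _; exact: l1_ge0.
- move=> i; apply/measurable_EFinP/measurable_sum => j.
  exact: measurable_l1.
rewrite /nm -sumEFin; apply: lee_sum => i _.
under [leRHS]eq_integral do rewrite -sumEFin.
rewrite ge0_integral_sum//; first last.
- by move=> j x _; rewrite lee_fin l1_ge0.
- move=> j; apply/measurable_EFinP; exact: measurable_l1.
rewrite -sumEFin; apply: lee_sum => j _.
have [F1 F2] := mx_integrable_entry i j iF; have [m1 m2] := m i j.
under [leRHS]eq_integral do rewrite /l1.
rewrite integralD_fin//; try by apply: measurableT_comp.
rewrite mxE /l1 EFinD leeD//=.
  have := le_abse_integral mu mD (measurable_int _ F1).
  by rewrite -(fineK (integrable_fin_num mD F1)).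
have := le_abse_integral mu mD (measurable_int _ F2).
by rewrite -(fineK (integrable_fin_num mD F2)).
Qed.

Lemma ae_eq_mx_integral p q (F G : T -> 'M[C]_(p, q)) :
  mx_measurable D F -> mx_measurable D G ->
  {ae mu, forall x, D x -> F x = G x} ->
  mx_integral mu D F = mx_integral mu D G.
Proof.
move=> mF mG FG; apply/matrixP => i j; rewrite !mxE.
have [F1 F2] := mF i j; have [G1 G2] := mG i j.
congr (_ +i* _); congr fine; apply: ae_eq_integral => //;
  try exact/measurable_EFinP;
  by apply: filterS FG => x FG /FG ->.
Qed.

End Integral.

(** * Cauchy-Schwarz inequalities and convergence criteria *)

Section CauchySchwarz.
Context d (T : measurableType d) (R : realType).
Variable mu : {measure set T -> \bar R}.

Lemma cauchy_schwarz (f g : T -> R) :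
  measurable_fun setT f -> measurable_fun setT g ->
  (forall x, 0 <= f x) -> (forall x, 0 <= g x) ->
  ((\int[mu]_x (f x * g x)%:E) ^+ 2 <=
   \int[mu]_x (f x ^+ 2)%:E * \int[mu]_x (g x ^+ 2)%:E)%E.
Proof.
move=> mf mg f0 g0.
have := @hoelder _ _ _ mu f g 2 2 mf mg ltac:(lra) ltac:(lra) ltac:(lra).
rewrite Lnorm1 unlock/=.
have E (h : T -> R) : (forall x, 0 <= h x) ->
    (\int[mu]_x (`|(h x)%:E| `^ 2) = \int[mu]_x (h x ^+ 2)%:E)%E.
  move=> h0; apply: eq_integral => x _.
  by rewrite abse_EFin ger0_norm// poweR_EFin powR_mulrn.
rewrite !E// !poweR12_sqrt ?integral_ge0//; last 2 first.
- by move=> x _; rewrite lee_fin sqr_ge0.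
- by move=> x _; rewrite lee_fin sqr_ge0.
rewrite (_ : (\int[mu]_x `|(f x * g x)%:E|)%E = (\int[mu]_x (f x * g x)%:E)%E);
  last by apply: eq_integral => x _; rewrite abse_EFin ger0_norm// mulr_ge0.
set a := (\int[mu]_x (f x ^+ 2)%:E)%E; set b := (\int[mu]_x (g x ^+ 2)%:E)%E.
have a0 : (0 <= a)%E by apply: integral_ge0 => x _; rewrite lee_fin sqr_ge0.
have b0 : (0 <= b)%E by apply: integral_ge0 => x _; rewrite lee_fin sqr_ge0.
move=> H; rewrite -[leRHS](_ : (sqrte a * sqrte b) ^+ 2 = _)%E.
  rewrite lee_sqr// ?mule_ge0 ?sqrte_ge0//.
  by apply: integral_ge0 => x _; rewrite lee_fin mulr_ge0.
by rewrite expe2 muleACA -!expe2 !sqr_sqrte.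
Qed.

(** For Young's inequality, where the weight [n] is a translated convolution kernel. *)
Lemma cauchy_schwarz_weight (n g : T -> R) :
  measurable_fun setT n -> measurable_fun setT g ->
  (forall x, 0 <= n x) -> (forall x, 0 <= g x) ->
  ((\int[mu]_x (n x * g x)%:E) ^+ 2 <=
   \int[mu]_x (n x)%:E * \int[mu]_x (n x * g x ^+ 2)%:E)%E.
Proof.
move=> mn mg n0 g0.
have ms : measurable_fun setT (fun x => Num.sqrt (n x)).
  apply: (measurableT_comp (f := @Num.sqrt R)) => //.
  by apply: continuous_measurable_fun; exact: sqrt_continuous.
have := @cauchy_schwarz (fun x => Num.sqrt (n x))
  (fun x => Num.sqrt (n x) * g x) ms (measurable_funM ms mg).
under eq_integral do rewrite mulrA -expr2 sqr_sqrtr//.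
under [X in (_ <= X * _)%E]eq_integral do rewrite sqr_sqrtr//.
under [X in (_ <= _ * X)%E]eq_integral do rewrite exprMn sqr_sqrtr//.
by apply => x; rewrite ?mulr_ge0// sqrtr_ge0.
Qed.

End CauchySchwarz.

Lemma cvg_geometric_increments (R : realType) (a : R^nat) (s : R) :
  (forall n, `|a n.+1 - a n| <= s / 2 ^+ n) ->
  cvgn a /\ forall n, `|a n - limn a| <= 2 * s / 2 ^+ n.
Proof.
move=> H.
(* The subtracted term is the part of the geometric series beyond [n + k]; keeping it makes the
   induction on [k] close. *)
have B n k : `|a (n + k)%N - a n| <= 2 * s / 2 ^+ n - 2 * s / 2 ^+ (n + k).
  elim: k => [|k ih]; first by rewrite addn0 !subrr normr0.
  have -> : a (n + k.+1)%N - a n =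
      (a (n + k).+1 - a (n + k)%N) + (a (n + k)%N - a n).
    by rewrite addnS addrA subrK.
  rewrite (le_trans (ler_normD _ _))// (le_trans (lerD (H _) ih))//.
  rewrite addnS exprS invfM.
  have : (2 ^+ (n + k))^-1 != 0 :> R by [].
  move: (_^-1) => u _; move: (_ / 2 ^+ n) => v; lra.
have s0 : 0 <= s.
  by have := H 0%N; rewrite expr0 divr1; apply: le_trans; rewrite normr_ge0.
have P n k : (n <= k)%N -> `|a n - a k| <= 2 * s / 2 ^+ n.
  move=> nk; rewrite distrC -(subnKC nk) (le_trans (B _ _))// gerBl.
  by rewrite divr_ge0// ?mulr_ge0// exprn_ge0.
have ca : cvgn a.
  apply: cauchy_cvg; apply/cauchyP => e e0.
  have : (fun n => 2 * s * 2^-1 ^+ n) @ \oo --> 2 * s * 0.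
    by apply: cvgMr; apply: (@cvg_expr R 2^-1); rewrite ger0_norm ?invr_ge0// invf_lt1// ltr1n.
  rewrite mulr0 => /cvgr0Pnorm_lt/(_ e e0)[N _ /(_ N (leqnn N))/= HN].
  exists (a N); exists N => //= k Nk.
  rewrite /ball/= (le_lt_trans (P _ _ Nk))// -exprVn.
  by rewrite (le_lt_trans (ler_norm _)).
split=> // n.
apply: (@cvgr_to_le _ \oo _ _ (fun k => `|a n - a k|)).
  exact: (cvg_norm (cvgB (cvg_cst (a n)) ca)).
by exists n => // k nk; exact: P.
Qed.

Lemma cvge0_lt (R : realType) (u : nat -> \bar R) (e : R) :
  u @ \oo --> 0%E -> 0 < e -> exists N, forall n, (N <= n)%N -> (u n < e%:E)%E.
Proof.
move=> u0 e0.
have : nbhs (0%E : \bar R) [set y | (y < (0 + e)%:E)%E].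
  by apply: (@nbhs_open_ereal_lt _ 0 (fun x => x + e)); rewrite add0r.
rewrite add0r => /u0[N _ HN]; exists N => n; exact: HN.
Qed.

Lemma dominated_cvg0 d (T : measurableType d) (R : realType)
    (mu : {measure set T -> \bar R}) (f : nat -> T -> R) (g : T -> R) :
  (forall n, measurable_fun setT (f n)) -> measurable_fun setT g ->
  (forall n x, 0 <= f n x <= g x) -> (\int[mu]_x (g x)%:E < +oo)%E ->
  (forall x, (fun n => f n x) @ \oo --> 0) ->
  forall e, 0 < e -> exists N, forall n, (N <= n)%N ->
    (\int[mu]_x (f n x)%:E <= e%:E)%E.
Proof.
move=> mf mg fg goo f0 e e0.
have g0 x : 0 <= g x by case/andP: (fg 0%N x) => h1 h2; exact: le_trans h1 h2.
have ig : mu.-integrable setT (EFin \o g).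
  apply/integrableP; split; first exact/measurable_EFinP.
  by under eq_integral do rewrite gee0_abs ?lee_fin//.
have [||_ _] := @dominated_convergence _ _ _ mu setT measurableT
  (fun n x => (f n x)%:E) (cst 0%E) (EFin \o g)
  (fun n => proj2 (measurable_EFinP _ _) (mf n)) (measurable_cst _) _ ig.
- by apply: aeW => x _; apply/fine_cvgP; split; [exact: nearW|exact: f0].
- apply: aeW => x n _; case/andP: (fg n x) => a b.
  by rewrite abse_EFin lee_fin ger0_norm.
rewrite integral0 => /cvge0_lt/(_ e0)[N HN].
by exists N => n /HN/ltW.
Qed.

(** * Square-integrable matrix functions *)

Section L2.
Context d (T : measurableType d) (R : realType).
Variable mu : {measure set T -> \bar R}.
Local Notation C := R[i].

Definition l2n p q (F : T -> 'M[C]_(p, q)) : \bar R :=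
  (\int[mu]_x (nm (F x) ^+ 2)%:E)%E.

Definition is_l2 p q (F : T -> 'M[C]_(p, q)) : Prop :=
  mx_measurable setT F /\ (l2n F < +oo)%E.

Lemma l2n_ge0 p q (F : T -> 'M[C]_(p, q)) : (0 <= l2n F)%E.
Proof. by apply: integral_ge0 => x _; rewrite lee_fin sqr_ge0. Qed.

Lemma measurable_nm_sqr p q (F : T -> 'M[C]_(p, q)) :
  mx_measurable setT F -> measurable_fun setT (fun x => nm (F x) ^+ 2).
Proof. by move=> mF; apply: measurable_funX; exact: measurable_nm. Qed.

Lemma is_l2_le p q (F : T -> 'M[C]_(p, q)) (g : T -> R) :
  mx_measurable setT F -> measurable_fun setT g ->
  (forall x, nm (F x) ^+ 2 <= g x) -> (\int[mu]_x (g x)%:E < +oo)%E -> is_l2 F.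
Proof.
move=> mF mg Fg goo; split => //; apply: le_lt_trans goo.
apply: le_integral_fin => //; first exact: measurable_nm_sqr.
by move=> x _; exact: sqr_ge0.
Qed.

Lemma l2nD p q (F G : T -> 'M[C]_(p, q)) :
  mx_measurable setT F -> mx_measurable setT G ->
  (l2n (fun x => F x + G x)%R <= 2%:E * l2n F + 2%:E * l2n G)%E.
Proof.
move=> mF mG.
rewrite /l2n -!integralZl_fin//; try exact: measurable_nm_sqr;
  try by move=> x _; exact: sqr_ge0.
rewrite -integralD_fin//; first last.
- by move=> x _; rewrite mulr_ge0// sqr_ge0.
- by move=> x _; rewrite mulr_ge0// sqr_ge0.
- by apply: measurable_funM => //; exact: measurable_nm_sqr.
- by apply: measurable_funM => //; exact: measurable_nm_sqr.
apply: le_integral_fin => //.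
- by apply: measurable_nm_sqr; exact: mx_measurableD.
- by apply: measurable_funD; apply: measurable_funM => //; exact: measurable_nm_sqr.
- by move=> x _; exact: sqr_ge0.
- move=> x _; rewrite -mulrDr (le_trans _ (sqrD_le _ _))//.
  by rewrite ler_pXn2r ?nnegrE ?addr_ge0 ?nm_ge0// nmD.
Qed.

Lemma is_l2D p q (F G : T -> 'M[C]_(p, q)) :
  is_l2 F -> is_l2 G -> is_l2 (fun x => F x + G x).
Proof.
move=> [mF iF] [mG iG]; split; first exact: mx_measurableD.
rewrite (le_lt_trans (l2nD mF mG))// lte_add_pinfty//.
  by rewrite lte_mul_pinfty.
by rewrite lte_mul_pinfty.
Qed.

Lemma l2nZ p q (c : C) (F : T -> 'M[C]_(p, q)) : mx_measurable setT F ->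
  (l2n (fun x => c *: F x)%R <= (l1 c ^+ 2)%:E * l2n F)%E.
Proof.
move=> mF; rewrite /l2n -integralZl_fin ?sqr_ge0//; first last.
- by move=> x _; exact: sqr_ge0.
- exact: measurable_nm_sqr.
apply: le_integral_fin => //.
- by apply: measurable_nm_sqr; exact: mx_measurableZc.
- by apply: measurable_funM => //; exact: measurable_nm_sqr.
- by move=> x _; exact: sqr_ge0.
- move=> x _; rewrite -exprMn ler_pXn2r ?nnegrE ?nm_ge0 ?mulr_ge0 ?l1_ge0 ?nm_ge0//.
  exact: nmZ.
Qed.

Lemma is_l2Z p q (c : C) (F : T -> 'M[C]_(p, q)) :
  is_l2 F -> is_l2 (fun x => c *: F x).
Proof.
move=> [mF iF]; split; first exact: mx_measurableZc.
by rewrite (le_lt_trans (l2nZ _ mF))// lte_mul_pinfty// lee_fin sqr_ge0.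
Qed.

Lemma l2nN p q (F : T -> 'M[C]_(p, q)) : l2n (fun x => - F x) = l2n F.
Proof. by apply: eq_integral => x _; rewrite nmN. Qed.

Lemma is_l2B p q (F G : T -> 'M[C]_(p, q)) :
  is_l2 F -> is_l2 G -> is_l2 (fun x => F x - G x).
Proof.
move=> lF [mG iG]; apply: is_l2D => //; split; last by rewrite l2nN.
exact: mx_measurableN.
Qed.

Lemma is_l2_0 p q : is_l2 (fun=> 0 : 'M[C]_(p, q)).
Proof.
split; first exact: mx_measurable_cst.
by rewrite /l2n; under eq_integral do rewrite nm0 expr0n; rewrite integral0.
Qed.

Lemma l2n_eq0P p q (F : T -> 'M[C]_(p, q)) : mx_measurable setT F ->
  l2n F = 0%E <-> {ae mu, forall x, F x = 0}.
Proof.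
move=> mF.
have mF2 : measurable_fun setT (fun x => (nm (F x) ^+ 2)%:E).
  by apply/measurable_EFinP; exact: measurable_nm_sqr.
have E : l2n F = (\int[mu]_x `|(nm (F x) ^+ 2)%:E|)%E.
  by apply: eq_integral => x _; rewrite abse_EFin ger0_norm// sqr_ge0.
rewrite E; split.
  move/(ae_eq_integral_abs _ measurableT mF2); apply: filterS => x /(_ I)/= [].
  by move/eqP; rewrite sqrf_eq0 => /eqP/nm_eq0.
move=> F0; apply/(ae_eq_integral_abs _ measurableT mF2).
by apply: filterS F0 => x /= -> _; rewrite nm0 expr0n.
Qed.

Lemma eq_ae_l2n p q (F G : T -> 'M[C]_(p, q)) :
  mx_measurable setT F -> mx_measurable setT G ->
  {ae mu, forall x, F x = G x} -> l2n F = l2n G.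
Proof.
move=> mF mG FG; apply: ge0_ae_eq_integral => //.
- by apply/measurable_EFinP; exact: measurable_nm_sqr.
- by apply/measurable_EFinP; exact: measurable_nm_sqr.
- by move=> x _; rewrite lee_fin sqr_ge0.
- by move=> x _; rewrite lee_fin sqr_ge0.
- by apply: filterS FG => x ->.
Qed.

End L2.

(** * Completeness of L^2 and the Fredholm alternative *)

Section Completeness.
Context d (T : measurableType d) (R : realType).
Variable mu : {measure set T -> \bar R}.
Local Notation C := R[i].
Variables (p q : nat) (x : nat -> T -> 'M[C]_(p, q)) (c : R).
Hypothesis xl2 : forall n, is_l2 mu (x n).
Hypothesis xc : forall n,
  (l2n mu (fun r => x n.+1 r - x n r)%R <= (c / 16 ^+ n)%:E)%E.

Let dx n r := x n.+1 r - x n r.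

Let dxl2 n : is_l2 mu (dx n). Proof. exact: is_l2B. Qed.

(* The weight 4^n makes the pointwise increments geometric wherever the sum is
   finite. *)
Let S r : \bar R := (\sum_(n <oo) (4 ^+ n * nm (dx n r) ^+ 2)%:E)%E.

Let u_ge0 n r : 0 <= 4 ^+ n * nm (dx n r) ^+ 2.
Proof. by rewrite mulr_ge0 ?exprn_ge0// nm_ge0. Qed.

Let mu_ n : measurable_fun setT (fun r => 4 ^+ n * nm (dx n r) ^+ 2).
Proof. by apply: measurable_funM => //; exact: measurable_nm_sqr (dxl2 n).1. Qed.

Let mS : measurable_fun setT S.
Proof.
apply: ge0_emeasurable_sum => [n r _ _|n _]; first by rewrite lee_fin u_ge0.
exact/measurable_EFinP.
Qed.

Let S_ge0 r : (0 <= S r)%E.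
Proof. by apply: nneseries_ge0 => n _ _; rewrite lee_fin u_ge0. Qed.

Let S_fin : (\int[mu]_r S r < +oo)%E.
Proof.
rewrite integral_nneseries//; last 2 first.
- by move=> n; exact/measurable_EFinP.
- by move=> n r _; rewrite lee_fin u_ge0.
apply: (@le_lt_trans _ _ (\sum_(n <oo) (c / 4 ^+ n)%:E)%E).
  apply: lee_nneseries => n *.
    by apply: integral_ge0 => r _; rewrite lee_fin u_ge0.
  rewrite integralZl_fin ?exprn_ge0//; last 2 first.
  - exact: measurable_nm_sqr (dxl2 n).1.
  - by move=> r _; exact: sqr_ge0.
  apply: (@le_trans _ _ ((4 ^+ n)%:E * (c / 16 ^+ n)%:E)%E).
    by apply: lee_wpmul2l; [rewrite lee_fin exprn_ge0|exact: xc].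
  have n4 : 4 ^+ n != 0 :> R by rewrite expf_neq0.
  rewrite -EFinM lee_fin (_ : 16 = 4 * 4); last by ring.
  by rewrite exprMn le_eqVlt; apply/orP; left; apply/eqP; field.
rewrite (_ : (fun N => \sum_(0 <= n < N) _)%E = EFin \o series (geometric c 4^-1)).
  2: by apply/funext => N; rewrite /series/= -sumEFin; apply: eq_bigr => n _;
    rewrite /geometric/= exprVn.
rewrite EFin_lim ?ltry//.
by apply: is_cvg_geometric_series; rewrite ger0_norm// invf_lt1// ltr1n.
Qed.

Let G := [set r | (S r < +oo)%E].

Let mG : measurable G.
Proof.
rewrite (_ : G = ~` (S @^-1` [set +oo%E])).
  by apply: measurableC; rewrite -[X in measurable X]setTI; exact: mS.
by apply/seteqP; split => r; rewrite /G/= ltey => /eqP.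
Qed.

Let aeG : {ae mu, forall r, G r}.
Proof.
have : mu.-integrable setT S.
  apply/integrableP; split => //.
  by under eq_integral do rewrite gee0_abs//.
move/(integrable_ae measurableT); apply: filterS => r /(_ I).
by rewrite ge0_fin_numE.
Qed.

Let s r := Num.sqrt (fine (S r)).

Let dx_le n r : G r -> nm (dx n r) <= s r / 2 ^+ n.
Proof.
move=> Gr; have Sf : S r \is a fin_num by rewrite ge0_fin_numE.
have : 4 ^+ n * nm (dx n r) ^+ 2 <= fine (S r).
  rewrite -lee_fin fineK//.
  rewrite -[leLHS]/((fun k => (4 ^+ k * nm (dx k r) ^+ 2)%:E) n).
  rewrite (@le_trans _ _ (\sum_(0 <= k < n.+1) (4 ^+ k * nm (dx k r) ^+ 2)%:E)%E)//.
    rewrite big_nat_recr//= leeDr// sume_ge0// => k _.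
    by rewrite lee_fin u_ge0.
  by apply: nneseries_lim_ge => k _ _; rewrite lee_fin u_ge0.
rewrite -ler_sqrt ?fine_ge0// => H; rewrite ler_pdivlMr ?exprn_gt0//.
rewrite (le_trans _ H)// (_ : 4 = 2 ^+ 2); last by ring.
by rewrite exprAC -exprMn sqrtr_sqr ger0_norm ?mulr_ge0 ?nm_ge0 ?exprn_ge0// mulrC.
Qed.

Let y r : 'M[C]_(p, q) := if r \in G then
  \matrix_(i, j) (limn (fun n => complex.Re (x n r i j)) +i*
                  limn (fun n => complex.Im (x n r i j))) else 0.

Let entry_incr n r i j : G r ->
  `|complex.Re (x n.+1 r i j) - complex.Re (x n r i j)| <= s r / 2 ^+ n /\
  `|complex.Im (x n.+1 r i j) - complex.Im (x n r i j)| <= s r / 2 ^+ n.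
Proof.
move=> Gr; rewrite -!cReN -!cImN -!cReD -!cImD.
have -> : x n.+1 r i j - x n r i j = dx n r i j by rewrite /dx !mxE.
split; apply: le_trans (dx_le n Gr); apply: le_trans (l1_nm _ i j).
  exact: normRe_l1.
exact: normIm_l1.
Qed.

Let my : mx_measurable setT y.
Proof.
(* Cut off outside [G], the sequence converges everywhere, so [y] is a pointwise limit of measurable
   functions. *)
have mx n : mx_measurable setT (fun r => if r \in G then x n r else 0).
  move=> i j; have [m1 m2] := (xl2 n).1 i j.
  rewrite (_ : (fun r => complex.Re _) =
      (fun r => if r \in G then complex.Re (x n r i j) else 0)); last first.
    by apply/funext => r; case: ifP => //; rewrite mxE.
  rewrite (_ : (fun r => complex.Im _) =
      (fun r => if r \in G then complex.Im (x n r i j) else 0)); last first.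
    by apply/funext => r; case: ifP => //; rewrite mxE.
  have mI : measurable_fun setT (fun r => r \in G).
    apply: (measurable_fun_bool true); rewrite setTI (_ : _ @^-1` _ = G)//.
    by apply/seteqP; split => r /=; [move/set_mem|move/mem_set].
  by split; apply: measurable_fun_ifT.
move=> i j.
have cv r := fun Gr : G r => cvg_geometric_increments
  (fun n => (entry_incr n i j Gr).1).
have cv' r := fun Gr : G r => cvg_geometric_increments
  (fun n => (entry_incr n i j Gr).2).
split.
  apply: (measurable_fun_cvg (h := fun n r =>
      complex.Re ((if r \in G then x n r else 0) i j))).
    by move=> n; exact: (mx n i j).1.
  move=> r _; rewrite /y; case: ifPn => rG; last by rewrite !mxE; exact: cvg_cst.
  by rewrite mxE/=; exact: (cv r (set_mem rG)).1.
apply: (measurable_fun_cvg (h := fun n r =>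
    complex.Im ((if r \in G then x n r else 0) i j))).
  by move=> n; exact: (mx n i j).2.
move=> r _; rewrite /y; case: ifPn => rG; last by rewrite !mxE; exact: cvg_cst.
by rewrite mxE/=; exact: (cv' r (set_mem rG)).1.
Qed.

(** Each of the [p * q] entries contributes [2 * s r / 2 ^+ n] for its real part and as much for its
    imaginary part. *)
Let K : R := (4 * (p * q)%:R) ^+ 2.

Let nm_tail n r : G r -> nm (x n r - y r) ^+ 2 <= K / 4 ^+ n * fine (S r).
Proof.
move=> Gr; have s0 : 0 <= s r by rewrite sqrtr_ge0.
have : nm (x n r - y r) <= 4 * (p * q)%:R * (s r / 2 ^+ n).
  rewrite /nm (@le_trans _ _ (\sum_(i < p) \sum_(j < q) 4 * (s r / 2 ^+ n)))//.
    rewrite ler_sum// => i _; rewrite ler_sum// => j _.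
    rewrite /y mem_set// !mxE /l1 cReD cImD cReN cImN/=.
    have [_ H1] := cvg_geometric_increments (fun n => (entry_incr n i j Gr).1).
    have [_ H2] := cvg_geometric_increments (fun n => (entry_incr n i j Gr).2).
    by rewrite (le_trans (lerD (H1 n) (H2 n)))// -!mulrA -mulrDl; lra.
  rewrite !sumr_const !card_ord -mulrnA -[leLHS]mulr_natr [(q * p)%N]mulnC.
  by rewrite mulrAC.
have t0 : 0 <= s r / 2 ^+ n by rewrite divr_ge0// exprn_ge0.
move=> H; rewrite (le_trans (lerXn2r 2 _ _ H)) ?nnegrE ?nm_ge0 ?mulr_ge0//.
rewrite exprMn -/K exprMn exprVn exprAC (_ : 2 ^+ 2 = 4); last by ring.
by rewrite [s r ^+ 2]sqr_sqrtr ?fine_ge0// -mulrA [fine _ * _]mulrC.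
Qed.

(** Squared increments of order [16^-n] suffice, because the fixed-point iteration below contracts
    the squared norm by 16. With the weight [4^n] they still sum to a finite integral, so almost
    every point has geometric increments and a pointwise limit. The tail bound [nm_tail] is then
    integrated: the squared distance to the limit is at most [K / 4 ^+ n] times the integral of
    [S]. *)
Lemma l2_complete : exists y, is_l2 mu y /\
  forall e : R, 0 < e ->
    exists n, forall k, (n <= k)%N -> (l2n mu (fun r => x k r - y r)%R <= e%:E)%E.
Proof.
have I_ge0 : (0 <= \int[mu]_r S r)%E by exact: integral_ge0.
have I_fin : (\int[mu]_r S r)%E \is a fin_num by rewrite ge0_fin_numE.
have K0 : 0 <= K by exact: sqr_ge0.
have mxy n : mx_measurable setT (fun r => x n r - y r).
  by apply: mx_measurableB => //; exact: (xl2 n).1.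
have B n : (l2n mu (fun r => x n r - y r)%R <=
    (K / 4 ^+ n * fine (\int[mu]_r S r))%:E)%E.
  rewrite EFinM fineK// -ge0_integralZl// ?lee_fin ?divr_ge0 ?exprn_ge0//.
  apply: ae_ge0_le_integral => //.
  - by move=> r _; rewrite lee_fin sqr_ge0.
  - by apply/measurable_EFinP; exact: measurable_nm_sqr.
  - by move=> r _; rewrite mule_ge0// lee_fin divr_ge0// exprn_ge0.
  - exact: measurable_funeM.
  - apply: filterS aeG => r Gr _.
    rewrite (le_trans (_ : _ <= (K / 4 ^+ n * fine (S r))%:E)%E)//.
      by rewrite lee_fin nm_tail.
    by rewrite EFinM fineK// ge0_fin_numE.
exists y; split.
  have -> : y = (fun r => x 0%N r - (x 0%N r - y r)).
    by apply/funext => r; rewrite subKr.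
  apply: is_l2B => //; split => //.
  by rewrite (le_lt_trans (B 0%N))// ltry.
move=> e e0.
have : (fun n => fine (\int[mu]_r S r) * K * 4^-1 ^+ n) @ \oo -->
    fine (\int[mu]_r S r) * K * 0.
  by apply: cvgMr; apply: (@cvg_expr R 4^-1);
    rewrite ger0_norm ?invr_ge0// invf_lt1// ltr1n.
rewrite mulr0 => /cvgr0Pnorm_lt/(_ e e0)[N _ HN].
exists N => k /HN/= Hk; rewrite (le_trans (B k))// lee_fin ltW//.
rewrite (le_lt_trans _ Hk)// (le_trans _ (ler_norm _))// exprVn.
by rewrite le_eqVlt; apply/orP; left; apply/eqP; ring.
Qed.

End Completeness.

(** * The Fredholm alternative in a complete seminormed space *)

Section Fredholm.
Variables (R : realType).
Local Notation C := R[i].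
Variables (E : lmodType C) (D : set E) (q : E -> R).
Hypotheses (D0 : D 0) (DD : forall x y, D x -> D y -> D (x + y))
  (DZ : forall c x, D x -> D (c *: x)).
Hypotheses (q_ge0 : forall x, 0 <= q x) (q0 : q 0 = 0)
  (qD : forall x y, D x -> D y -> q (x + y) <= 2 * q x + 2 * q y)
  (qZ : forall c x, D x -> q (c *: x) <= l1 c ^+ 2 * q x).
Hypothesis q_complete : forall (x : nat -> E) (c : R), (forall n, D (x n)) ->
  (forall n, q (x n.+1 - x n) <= c / 16 ^+ n) ->
  exists y, D y /\ forall e, 0 < e -> exists n, forall k, (n <= k)%N ->
    q (x k - y) <= e.

(** [E] consists of functions and [q] is a squared seminorm, so the operators are linear and the
    equations hold only up to null elements; [eqn] below is the resulting congruence. *)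
Let null z := D z /\ q z = 0.

Let DN x : D x -> D (- x). Proof. by move=> Dx; rewrite -scaleN1r; exact: DZ. Qed.
Let DB x y : D x -> D y -> D (x - y).
Proof. by move=> Dx Dy; apply: DD => //; exact: DN. Qed.
Let Dsum n (c : 'I_n -> C) (y : 'I_n -> E) :
  (forall i, D (y i)) -> D (\sum_i c i *: y i).
Proof. by move=> Dy; elim/big_ind : _ => // i _; exact: DZ. Qed.

Let q_eq0 x : q x <= 0 -> q x = 0.
Proof. by move=> qx; apply/eqP; rewrite eq_le qx q_ge0. Qed.

Let qN x : D x -> q (- x) <= q x.
Proof.
move=> Dx; rewrite -scaleN1r (le_trans (qZ _ Dx))// l1N.
by rewrite /l1/= normr1 normr0 addr0 expr1n mul1r.
Qed.

Let qNE x : D x -> q (- x) = q x.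
Proof.
move=> Dx; apply/eqP; rewrite eq_le qN//=.
by rewrite -[X in q X <= _]opprK qN//; exact: DN.
Qed.

Let nullD x y : null x -> null y -> null (x + y).
Proof.
move=> [Dx qx] [Dy qy]; split; first exact: DD.
by apply: q_eq0; rewrite (le_trans (qD Dx Dy))// qx qy !mulr0 addr0.
Qed.
Let nullZ c x : null x -> null (c *: x).
Proof.
move=> [Dx qx]; split; first exact: DZ.
by apply: q_eq0; rewrite (le_trans (qZ _ Dx))// qx mulr0.
Qed.

Let eqn x y := null (x - y).
Let eqn_refl x : eqn x x. Proof. by rewrite /eqn subrr. Qed.
Let eqn_sym x y : eqn x y -> eqn y x.
Proof. by move=> /(nullZ (-1)); rewrite scaleN1r opprB. Qed.
Let eqn_trans y x z : eqn x y -> eqn y z -> eqn x z.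
Proof. by rewrite /eqn => xy yz; rewrite -(subrKA y); exact: nullD. Qed.
Let eqnD x y x' y' : eqn x y -> eqn x' y' -> eqn (x + x') (y + y').
Proof. by rewrite /eqn => xy xy'; rewrite opprD addrACA; exact: nullD. Qed.
Let eqnZ c x y : eqn x y -> eqn (c *: x) (c *: y).
Proof. by rewrite /eqn -scalerBr; exact: nullZ. Qed.
Let eqn_sum n (f g : 'I_n -> E) :
  (forall i, eqn (f i) (g i)) -> eqn (\sum_i f i) (\sum_i g i).
Proof. by move=> fg; elim/big_ind2 : _ => // *; exact: eqnD. Qed.
Let q_eqn x y : D y -> eqn x y -> q x <= 2 * q y.
Proof.
move=> Dy [Dxy qxy]; rewrite -(subrK y x) (le_trans (qD Dxy Dy))//.
by rewrite qxy mulr0 add0r.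
Qed.

Variable N : E -> E.
Hypotheses (DNN : forall x, D x -> D (N x))
  (N_lin : forall c x y, D x -> D y -> q (N (c *: x + y) - (c *: N x + N y)) = 0)
  (qN_le : forall x, D x -> q (N x) <= q x / 32).

Let N_eqn c x y : D x -> D y -> eqn (N (c *: x + y)) (c *: N x + N y).
Proof.
move=> Dx Dy; split; last exact: N_lin.
by apply: DB; [apply/DNN/DD|apply: DD; [apply/DZ|]; exact: DNN] => //; exact: DZ.
Qed.

(** Passing from [N x - N y] to [N (x - y)] modulo null elements costs a factor 2, which is why [N]
    is assumed to contract by 32: the 16 left over is the rate required by [q_complete]. *)
Let qNB x y : D x -> D y -> q (N x - N y) <= q (x - y) / 16.
Proof.
move=> Dx Dy; have := N_eqn 1 (DB Dx Dy) Dy.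
rewrite !scale1r subrK => h.
have {}h : eqn (N x - N y) (N (x - y)).
  by rewrite -[X in eqn _ X](addrK (N y)); exact: eqnD.
rewrite (le_trans (q_eqn _ h))//; first exact/DNN/DB.
have := qN_le (DB Dx Dy); lra.
Qed.

Let G x := x + N x.

Let DG x : D x -> D (G x). Proof. by move=> Dx; apply: DD => //; exact: DNN. Qed.

Let G_lin c x y : D x -> D y -> eqn (G (c *: x + y)) (c *: G x + G y).
Proof.
move=> Dx Dy; rewrite /G scalerDr addrACA; apply: eqnD => //.
exact: N_eqn.
Qed.

Let G0 : eqn (G 0) 0.
Proof.
have := G_lin 1 D0 D0; rewrite scale1r addr0 => h.
have := eqnD h (eqn_refl (- G 0)); rewrite scale1r subrr addrK.
exact: eqn_sym.
Qed.

Let G_sum n (c : 'I_n -> C) (y : 'I_n -> E) : (forall i, D (y i)) ->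
  eqn (G (\sum_i c i *: y i)) (\sum_i c i *: G (y i)).
Proof.
elim: n c y => [|n ih] c y Dy; first by rewrite !big_ord0.
rewrite !big_ord_recl; apply: (eqn_trans (G_lin _ (Dy _) _)).
  exact: Dsum.
by apply: eqnD => //; exact: ih.
Qed.

(** Neumann series in the form of the iteration [x' = f - N x] started at 0. The limit satisfies
    [q y <= 4 * q f + q y / 8] by two uses of the quasi-triangle inequality, and this gives the
    constant 6 with room to spare. *)
Let G_solve f : D f -> exists x, [/\ D x, eqn (G x) f & q x <= 6 * q f].
Proof.
move=> Df; pose x := fix x n := if n is n'.+1 then f - N (x n') else 0.
have Dx n : D (x n) by elim: n => //= n ih; apply: DB => //; exact: DNN.
have xE n : x n.+1 = f - N (x n) by [].
have xB n : x n.+2 - x n.+1 = - (N (x n.+1) - N (x n)).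
  by rewrite xE [in X in _ - X]xE opprB addrC subrKA opprB.
have dq n : q (x n.+1 - x n) <= q (f - N 0) / 16 ^+ n.
  elim: n => [|n ih]; first by rewrite /= subr0 expr0 divr1.
  rewrite xB qNE; last by apply: DB; exact: DNN.
  rewrite (le_trans (qNB (Dx _) (Dx _)))// exprSr invfM mulrA.
  by rewrite ler_pM2r.
have [y [Dy yl]] := q_complete Dx dq.
have Gy : eqn (G y) f.
  split; first by apply: DB => //; exact: DG.
  apply: q_eq0; apply/ler_addgt0Pl => e e0; rewrite addr0.
  (* The two terms of the decomposition below contribute [2 * (e / 4)] and [2 * (e / 4) / 16],
     together less than [e]. *)
  have [n nl] := yl (e / 4) ltac:(by rewrite divr_gt0).
  have -> : G y - f = - (x n.+1 - y) + - (N (x n) - N y).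
    rewrite /G xE !opprB -!addrA; congr (_ + _).
    by rewrite [RHS]addrA [RHS]addrC subrKA.
  have DA : D (x n.+1 - y) by exact: DB.
  have DB' : D (N (x n) - N y) by apply: DB; exact: DNN.
  rewrite (le_trans (qD (DN DA) (DN DB')))// !qNE//.
  have := qNB (Dx n) Dy; have := nl n (leqnn n); have := nl n.+1 (leqnSn n).
  by lra.
exists y; split => //.
have : eqn y (f - N y).
  by rewrite -[X in eqn X _](addrK (N y)); exact: eqnD.
move=> /(q_eqn (DB Df (DNN Dy))).
have := qD Df (DN (DNN Dy)); rewrite qNE; last exact: DNN.
have := qN_le Dy; have := q_ge0 f; lra.
Qed.

Variables (n : nat) (a : 'I_n -> E) (b : 'I_n -> E -> C) (Kb : R).
Hypotheses (Da : forall j, D (a j))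
  (b_lin : forall j c x y, D x -> D y -> b j (c *: x + y) = c * b j x + b j y)
  (b_le : forall j x, D x -> l1 (b j x) ^+ 2 <= Kb * q x).

Variable T : E -> E.
Hypotheses (DT : forall x, D x -> D (T x))
  (T_dec : forall x, D x -> q (T x - (N x + \sum_j b j x *: a j)) = 0)
  (T_inj : forall x, D x -> q (x + T x) = 0 -> q x = 0).

Let F x := \sum_j b j x *: a j.
Let DF x : D (F x). Proof. exact: Dsum. Qed.

Let TE x : D x -> eqn (x + T x) (G x + F x).
Proof.
move=> Dx; rewrite /G -addrA; apply: eqnD => //; split; last exact: T_dec.
by apply: DB; [exact: DT|apply: DD => //; exact: DNN].
Qed.

Let b0 j : b j 0 = 0.
Proof.
have := b_lin j 1 D0 D0; rewrite scale1r addr0 mul1r => h.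
by apply: (addrI (b j 0)); rewrite addr0.
Qed.

Let b_sum j m (c : 'I_m -> C) (y : 'I_m -> E) : (forall i, D (y i)) ->
  b j (\sum_i c i *: y i) = \sum_i c i * b j (y i).
Proof.
elim: m c y => [|m ih] c y Dy; first by rewrite !big_ord0 b0.
rewrite !big_ord_recl b_lin//; first by rewrite ih.
exact: Dsum.
Qed.

Let b_null j x : D x -> q x = 0 -> b j x = 0.
Proof.
move=> Dx qx; apply: l1_eq0; apply/eqP; rewrite -sqrf_eq0 eq_le sqr_ge0 andbT.
by rewrite (le_trans (b_le j Dx))// qx mulr0.
Qed.

Let q_sum m (y : 'I_m -> E) : (forall i, D (y i)) ->
  exists2 K, 0 <= K & forall c : 'rV[C]_m,
    q (\sum_i c 0 i *: y i) <= K * nm c ^+ 2.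
Proof.
elim: m y => [|m ih] y Dy.
  by exists 0 => // c; rewrite big_ord0 q0 mul0r.
have [K K0 HK] := ih (fun i => y (lift ord0 i)) (fun i => Dy _).
exists (2 * q (y ord0) + 2 * K).
  by rewrite addr_ge0// mulr_ge0.
move=> c; rewrite big_ord_recl.
have D1 : D (c 0 ord0 *: y ord0) by exact: DZ.
have D2 : D (\sum_(i < m) c 0 (lift ord0 i) *: y (lift ord0 i)).
  exact: (@Dsum m (fun i => c 0 (lift ord0 i)) (fun i => y (lift ord0 i))).
pose c' : 'rV[C]_m := \row_i c 0 (lift ord0 i).
have E2 : q (\sum_(i < m) c 0 (lift ord0 i) *: y (lift ord0 i)) <= K * nm c ^+ 2.
  rewrite (eq_bigr (fun i => c' 0 i *: y (lift ord0 i))); last first.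
    by move=> i _; rewrite mxE.
  rewrite (le_trans (HK c'))// ler_wpM2l// ler_pXn2r ?nnegrE ?nm_ge0//.
  rewrite /nm !big_ord1 [leRHS]big_ord_recl/=.
  under eq_bigr do rewrite mxE.
  by rewrite lerDr l1_ge0.
have E1 : q (c 0 ord0 *: y ord0) <= q (y ord0) * nm c ^+ 2.
  rewrite (le_trans (qZ _ (Dy _)))// mulrC ler_wpM2l//.
  by rewrite ler_pXn2r ?nnegrE ?nm_ge0 ?l1_ge0// l1_nm.
rewrite (le_trans (qD D1 D2))// [leRHS]mulrDl -!mulrA.
by rewrite lerD// ler_pM2l.
Qed.

(** Reduction to a matrix equation. Let [y j] solve [G (y j) = a j] and [z] solve [G z = f]. For
    [x = z + \sum_i c 0 i *: y i], the image [G x + F x] equals [f] plus a combination of the [a j],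
    whose coefficients vanish when [c *m (1%:M + M)] is minus the row of the [b j z]. Injectivity of
    [1 + T] makes [1%:M + M] invertible, so [c] exists and is bounded linearly by the [b j z]. *)
Let fredholm_solve_aux : exists2 K, 0 <= K & forall f, D f ->
  exists x, [/\ D x, eqn (x + T x) f & q x <= K * q f].
Proof.
have [y Hy] := choice (fun j => G_solve (Da j)).
have Dy j : D (y j) by have [] := Hy j.
have Gy j : eqn (G (y j)) (a j) by have [] := Hy j.
pose M : 'M[C]_n := \matrix_(i, j) b j (y i).
have coef (c : 'rV[C]_n) j :
    c 0 j + \sum_i c 0 i * b j (y i) = (c *m (1%:M + M)) 0 j.
  rewrite mulmxDr mulmx1 !mxE; congr (_ + _); apply: eq_bigr => i _.
  by rewrite mxE.
have key z f (c : 'rV[C]_n) : D z -> eqn (G z) f ->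
    (forall j, b j z + (c *m (1%:M + M)) 0 j = 0) ->
    eqn (z + \sum_i c 0 i *: y i + T (z + \sum_i c 0 i *: y i)) f.
  move=> Dz Gz Hc; set w := \sum_i _.
  have Dw : D w by exact: Dsum.
  apply: (eqn_trans (TE (DD Dz Dw))).
  have Gzw : eqn (G (z + w)) (f + \sum_i c 0 i *: a i).
    have := G_lin 1 Dz Dw; rewrite !scale1r => h; apply: (eqn_trans h).
    apply: eqnD => //; apply: (eqn_trans (G_sum _ Dy)).
    by apply: eqn_sum => i; exact: eqnZ.
  rewrite -[X in eqn _ X](addrK (\sum_i c 0 i *: a i)).
  apply: eqnD => //; rewrite (_ : F _ = - (\sum_i c 0 i *: a i))//.
  rewrite -sumrN; apply: eq_bigr => j _; rewrite -scaleNr; congr (_ *: _).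
  have := b_lin j 1 Dz Dw; rewrite scale1r mul1r => ->.
  by rewrite b_sum//; apply/eqP; rewrite -addr_eq0 -addrA [_ + c 0 j]addrC coef Hc.
(* A row [c] in the kernel produces [w = \sum_i c 0 i *: y i] with [w + T w] null. By [T_inj] the
   vector [w] is null, hence every [b j w] is 0, and [coef] then reads [c 0 j = 0]. *)
have uM : (1%:M + M) \in unitmx.
  rewrite unitmxE unitfE; apply/negP => /det0P[c c0 cM].
  have Hc : forall j, b j 0 + (c *m (1%:M + M)) 0 j = 0.
    by move=> j; rewrite b0 cM mxE addr0.
  have := key 0 0 c D0 G0 Hc; rewrite add0r => -[_].
  rewrite subr0 => /(T_inj (Dsum _ Dy)) qw.
  move/negP : c0; apply; apply/eqP/rowP => j; rewrite [RHS]mxE.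
  have := coef c j; rewrite cM mxE -b_sum// b_null// ?addr0//.
  exact: Dsum.
have [K K0 HK] := q_sum Dy.
pose V := invmx (1%:M + M).
(* The 12 is 2 times the 6 of [G_solve], for [z]. The rest bounds the combination of the [y i]: two
   factors [nm V] from the inverse matrix, one [n] from squaring a sum of [n] terms and one from
   summing the bounds on the [b j z]. *)
exists (12 + 2 * K * (nm V * nm V * (n%:R * (n%:R * (`|Kb| * 6))))).
  by rewrite addr_ge0 ?mulr_ge0 ?exprn_ge0 ?nm_ge0.
move=> f Df; have [z [Dz Gz qz]] := G_solve Df.
pose bz : 'rV[C]_n := \row_j b j z.
pose c := - (bz *m V).
have Hc j : b j z + (c *m (1%:M + M)) 0 j = 0.
  by rewrite /c mulNmx -mulmxA mulVmx// mulmx1 !mxE subrr.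
have Dw : D (\sum_i c 0 i *: y i) by exact: Dsum.
exists (z + \sum_i c 0 i *: y i); split; first exact: DD.
  exact: key.
rewrite (le_trans (qD Dz Dw))// [leRHS]mulrDl.
rewrite [12](_ : _ = 2 * 6); last by ring.
rewrite -!mulrA lerD// ?ler_pM2l//.
rewrite (le_trans (HK c))// ler_wpM2l//.
apply: (@le_trans _ _ (nm V * (nm V * nm bz ^+ 2))).
  rewrite mulrA -expr2 -exprMn ler_pXn2r ?nnegrE ?mulr_ge0 ?nm_ge0// /c nmN mulrC.
  exact: nmM.
rewrite ler_wpM2l ?nm_ge0// ler_wpM2l ?nm_ge0// {1}/nm big_ord1 (le_trans (sqr_sum_le _))//.
rewrite ler_wpM2l//.
apply: (@le_trans _ _ (\sum_(i < n) (`|Kb| * (6 * q f)))).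
  apply: ler_sum => i _; rewrite mxE (le_trans (b_le i Dz))//.
  rewrite (le_trans (ler_wpM2r (q_ge0 _) (ler_norm _)))// ler_wpM2l//.
by rewrite sumr_const card_ord -[leLHS]mulr_natl.
Qed.

Lemma fredholm_solve f : D f -> exists x, D x /\ q (x + T x - f) = 0.
Proof.
have [K _ H] := fredholm_solve_aux.
by move=> /H[x [Dx [_ fx] _]]; exists x.
Qed.

(** [fredholm_solve_aux] bounds some solution of the equation with right-hand side [x + T x]; by
    injectivity it differs from [x] by a null element, at the cost of a factor 2. *)
Lemma fredholm_bound :
  exists2 K, 0 <= K & forall x, D x -> q x <= K * q (x + T x).
Proof.
have [K K0 H] := fredholm_solve_aux.
exists (2 * K); first by rewrite mulr_ge0.
move=> x Dx; have [x' [Dx' ex' qx']] := H _ (DD Dx (DT Dx)).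
have Db : D (x' - x) by exact: DB.
have FB : F (x' - x) = F x' - F x.
  rewrite /F -sumrB; apply: eq_bigr => j _; rewrite -scalerBl; congr (_ *: _).
  have := b_lin j 1 Db Dx; rewrite scale1r subrK mul1r => ->.
  by rewrite addrK.
have GB : eqn (G (x' - x)) (G x' - G x).
  have := G_lin 1 Db Dx; rewrite !scale1r subrK => h.
  rewrite -[X in eqn X _](addrK (G x)); apply: eqnD => //.
  exact: eqn_sym.
have : eqn (x' - x + T (x' - x)) 0.
  apply: (eqn_trans (TE Db)); rewrite FB.
  apply: (eqn_trans (eqnD GB (eqn_refl _))).
  rewrite addrACA -opprD -[X in eqn _ X](subrr (G x + F x)).
  apply: eqnD => //; apply: (eqn_trans (eqn_sym (TE Dx'))).
  exact: (eqn_trans ex' (TE Dx)).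
rewrite /eqn subr0 => -[_ /(T_inj Db) qB].
have : eqn x x' by apply: eqn_sym.
move/(q_eqn Dx') => /le_trans; apply.
by rewrite -mulrA ler_pM2l.
Qed.

End Fredholm.

(** * Integrals depending measurably on a parameter *)

Section Parametric.
Context d1 d2 (X : measurableType d1) (Y : measurableType d2) (R : realType).
Variable mu : {sigma_finite_measure set Y -> \bar R}.
Local Notation C := R[i].

(** Tonelli applies to the positive and negative parts separately; [fine] of the difference is
    measurable, including the parameters where the integral diverges and takes a default value. *)
Lemma measurable_fun_Rintegral (f : X -> Y -> R) :
  measurable_fun setT (fun z : X * Y => f z.1 z.2) ->
  measurable_fun setT (fun x => \int[mu]_y f x y).
Proof.
move=> mf.
have mf' : measurable_fun setT (fun z : X * Y => (f z.1 z.2)%:E).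
  exact/measurable_EFinP.
have := measurable_funepos mf' => /measurable_fun_fubini_tonelli_F.
move=> /(_ mu (fun _ => funepos_ge0 _ _)) mp.
have := measurable_funeneg mf' => /measurable_fun_fubini_tonelli_F.
move=> /(_ mu (fun _ => funeneg_ge0 _ _)) mn.
rewrite (_ : (fun x => _) = fine \o
    ((fubini_F mu (fun z : X * Y => (f z.1 z.2)%:E)^\+) \-
     (fubini_F mu (fun z : X * Y => (f z.1 z.2)%:E)^\-))%E); last first.
  apply/funext => x/=; rewrite /Rintegral /fubini_F integralE.
  congr (fine (_ - _)%E); apply: eq_integral => y _.
    by rewrite !funeposE.
  by rewrite !funenegE.
by apply: measurableT_comp; [exact: fine_measurable|exact: emeasurable_funB].
Qed.

Lemma mx_measurable_integral p q (F : X -> Y -> 'M[C]_(p, q)) :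
  mx_measurable setT (fun z : X * Y => F z.1 z.2) ->
  mx_measurable setT (fun x => mx_integral mu setT (F x)).
Proof.
move=> mF i j; have [m1 m2] := mF i j; split.
  apply: (eq_measurable_fun (fun x => \int[mu]_y complex.Re (F x y i j))).
    by move=> x _; rewrite mxE.
  exact: (@measurable_fun_Rintegral (fun x y => complex.Re (F x y i j))).
apply: (eq_measurable_fun (fun x => \int[mu]_y complex.Im (F x y i j))).
  by move=> x _; rewrite mxE.
exact: (@measurable_fun_Rintegral (fun x y => complex.Im (F x y i j))).
Qed.

Lemma mx_measurable_section p q (F : X -> Y -> 'M[C]_(p, q)) x :
  mx_measurable setT (fun z : X * Y => F z.1 z.2) -> mx_measurable setT (F x).
Proof.
move=> mF.
exact: (@mx_measurable_comp _ _ _ _ _ _ _ (fun z : X * Y => F z.1 z.2)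
  (pair x) mF (pair1_measurable x)).
Qed.

Lemma mx_measurable_snd p q (f : Y -> 'M[C]_(p, q)) :
  mx_measurable setT f -> mx_measurable setT (fun z : X * Y => f z.2).
Proof. by move=> mf; exact: mx_measurable_comp mf measurable_snd. Qed.

Lemma mx_measurable_fst p q (f : X -> 'M[C]_(p, q)) :
  mx_measurable setT f -> mx_measurable setT (fun z : X * Y => f z.1).
Proof. by move=> mf; exact: mx_measurable_comp mf measurable_fst. Qed.

End Parametric.

Lemma sqre_leD (R : realType) (x y z : \bar R) :
  (0 <= x)%E -> (0 <= y)%E -> (0 <= z)%E -> (x <= y + z)%E ->
  (x ^+ 2 <= 2%:E * y ^+ 2 + 2%:E * z ^+ 2)%E.
Proof.
rewrite !expe2; case: y => [b||]//; last first.
  move=> _ _ z0 _; rewrite mulyy gt0_muley ?lte_fin//.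
  by rewrite (@le_trans _ _ +oo%E) ?leey// leeDl// !mule_ge0.
case: z => [c||]//; last first.
  move=> _ _ _ _; rewrite mulyy [X in (_ <= _ + X)%E]gt0_muley ?lte_fin//.
  by rewrite (@le_trans _ _ +oo%E) ?leey// leeDr// mule_ge0// -EFinM lee_fin -expr2 sqr_ge0.
case: x => [a||]// a0 b0 c0 abc.
rewrite !lee_fin in a0 b0 c0 abc *.
rewrite -mulrDr -!expr2.
by rewrite (le_trans _ (sqrD_le _ _))// ler_pXn2r// nnegrE addr_ge0.
Qed.

(** * Integral operators *)

Section IntegralOperator.
Context d (T : measurableType d) (R : realType).
Variable mu : {sigma_finite_measure set T -> \bar R}.
Variable n : nat.
Local Notation C := R[i].
Implicit Types (K : T -> T -> 'M[C]_n) (f g : T -> 'cV[C]_n).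

Definition iop K f r : 'cV[C]_n := mx_integral mu setT (fun s => K r s *m f s).

(* The positive operator with kernel [nm (K r s)] has squared L^2-norm at most
   [c]; it dominates [iop K]. *)
Definition kbounded K (c : R) : Prop :=
  [/\ mx_measurable setT (fun z : T * T => K z.1 z.2), 0 <= c &
   forall g : T -> R, measurable_fun setT g -> (forall s, 0 <= g s) ->
     (\int[mu]_s (g s ^+ 2)%:E < +oo)%E ->
     (\int[mu]_r (\int[mu]_s (nm (K r s) * g s)%:E) ^+ 2 <=
      c%:E * \int[mu]_s (g s ^+ 2)%:E)%E].

Lemma measurable_kernel_fun K (g : T -> R) :
  mx_measurable setT (fun z : T * T => K z.1 z.2) -> measurable_fun setT g ->
  (forall s, 0 <= g s) ->
  measurable_fun setT (fun r => \int[mu]_s (nm (K r s) * g s)%:E)%E.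
Proof.
move=> mK mg g0.
apply: (@measurable_fun_fubini_tonelli_F _ _ _ _ _ mu
  (fun z : T * T => (nm (K z.1 z.2) * g z.2)%:E)) => [|z].
  apply/measurable_EFinP; apply: measurable_funM; first exact: measurable_nm.
  exact: (measurableT_comp mg measurable_snd).
by rewrite lee_fin mulr_ge0// nm_ge0.
Qed.

Lemma measurable_kernel_fun_sqr K (g : T -> R) :
  mx_measurable setT (fun z : T * T => K z.1 z.2) -> measurable_fun setT g ->
  (forall s, 0 <= g s) ->
  measurable_fun setT (fun r => (\int[mu]_s (nm (K r s) * g s)%:E) ^+ 2)%E.
Proof.
move=> mK mg g0; under eq_fun do rewrite expe2.
by apply: emeasurable_funM; exact: measurable_kernel_fun.
Qed.

Lemma kernel_int_ge0 K (g : T -> R) r : (forall s, 0 <= g s) ->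
  (0 <= \int[mu]_s (nm (K r s) * g s)%:E)%E.
Proof.
by move=> g0; apply: integral_ge0 => s _; rewrite lee_fin mulr_ge0// nm_ge0.
Qed.

(** A function with finite integral is finite almost everywhere; this is what makes [iop K f r] a
    convergent integral for almost every [r], and all linearity statements below inherit the
    exceptional null set. *)
Lemma kbounded_ae K c (g : T -> R) : kbounded K c -> measurable_fun setT g ->
  (forall s, 0 <= g s) -> (\int[mu]_s (g s ^+ 2)%:E < +oo)%E ->
  {ae mu, forall r, (\int[mu]_s (nm (K r s) * g s)%:E < +oo)%E}.
Proof.
move=> [mK c0 Kc] mg g0 goo.
have : mu.-integrable setT (fun r => (\int[mu]_s (nm (K r s) * g s)%:E) ^+ 2)%E.
  apply/integrableP; split; first exact: measurable_kernel_fun_sqr.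
  under eq_integral do rewrite gee0_abs ?sqre_ge0//.
  by rewrite (le_lt_trans (Kc g mg g0 goo))// lte_mul_pinfty.
move/(integrable_ae measurableT); apply: filterS => r /(_ I).
have := kernel_int_ge0 K r g0.
by case: (\int[mu]_s _)%E => [a||]//; rewrite ?ltry// expe2 mulyy.
Qed.

Lemma kbounded_mx_integrable K c f : kbounded K c -> is_l2 mu f ->
  {ae mu, forall r, mx_integrable mu setT (fun s => K r s *m f s)}.
Proof.
move=> Kc [mf fl2]; have := kbounded_ae Kc (measurable_nm mf) (fun s => nm_ge0 _) fl2.
have [mK _ _] := Kc.
apply: filterS => r; apply: mx_integrable_le => //.
- by apply: mx_measurableM => //; exact: mx_measurable_section.
- apply: measurable_funM; last exact: measurable_nm.
  by apply: measurable_nm; exact: mx_measurable_section.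
- by move=> s _; exact: nmM.
Qed.

Lemma mx_measurable_kernel_fun K f :
  mx_measurable setT (fun z : T * T => K z.1 z.2) -> mx_measurable setT f ->
  mx_measurable setT (fun z : T * T => K z.1 z.2 *m f z.2).
Proof. by move=> mK mf; apply: mx_measurableM => //; exact: mx_measurable_snd. Qed.

Lemma mx_measurable_iop K f :
  mx_measurable setT (fun z : T * T => K z.1 z.2) -> mx_measurable setT f ->
  mx_measurable setT (iop K f).
Proof.
move=> mK mf; apply: (@mx_measurable_integral _ _ _ _ _ mu _ _
  (fun r s => K r s *m f s)).
exact: mx_measurable_kernel_fun.
Qed.

Lemma iop_l2n K c f : kbounded K c -> is_l2 mu f ->
  (l2n mu (iop K f) <= c%:E * l2n mu f)%E.
Proof.
move=> Kc fl2; have [mf _] := fl2; have [mK c0 Kb] := Kc.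
have mN := measurable_nm mf.
apply: le_trans (Kb _ mN (fun s => nm_ge0 _) fl2.2).
apply: ae_ge0_le_integral => //.
- by move=> r _; rewrite lee_fin sqr_ge0.
- by apply/measurable_EFinP; apply: measurable_nm_sqr; exact: mx_measurable_iop.
- by move=> r _; exact: sqre_ge0.
- by apply: measurable_kernel_fun_sqr => // s; exact: nm_ge0.
- apply: filterS (kbounded_mx_integrable Kc fl2) => r iKf _.
  have : ((nm (iop K f r))%:E <= \int[mu]_s (nm (K r s) * nm (f s))%:E)%E.
    apply: (le_trans (nm_mx_integral measurableT iKf)).
    apply: le_integral_fin => //.
    + exact: measurable_nm iKf.1.
    + by apply: measurable_funM => //; apply: measurable_nm;
        exact: mx_measurable_section.
    + by move=> s _; exact: nm_ge0.
    + by move=> s _; exact: nmM.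
  rewrite EFin_expe lee_sqr//; first by rewrite lee_fin nm_ge0.
  by apply: kernel_int_ge0 => s; exact: nm_ge0.
Qed.

Lemma is_l2_iop K c f : kbounded K c -> is_l2 mu f -> is_l2 mu (iop K f).
Proof.
move=> Kc fl2; have [mf foo] := fl2; have [mK c0 Kb] := Kc.
split; first exact: mx_measurable_iop.
by rewrite (le_lt_trans (iop_l2n Kc fl2))// lte_mul_pinfty.
Qed.

Lemma iop_lin_ae K c (a : C) f g : kbounded K c -> is_l2 mu f -> is_l2 mu g ->
  {ae mu, forall r, iop K (fun s => a *: f s + g s) r =
                    a *: iop K f r + iop K g r}.
Proof.
move=> Kc fl2 gl2.
apply: filterS2 (kbounded_mx_integrable Kc fl2) (kbounded_mx_integrable Kc gl2).
move=> r iF iG; rewrite /iop -mx_integralZ//.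
rewrite -mx_integralD//; last exact: mx_integrableZ.
by congr mx_integral; apply/funext => s; rewrite mulmxDr -scalemxAr.
Qed.

Lemma iopD_ae K1 K2 c1 c2 f : kbounded K1 c1 -> kbounded K2 c2 -> is_l2 mu f ->
  {ae mu, forall r, iop (fun r s => K1 r s + K2 r s) f r =
                    iop K1 f r + iop K2 f r}.
Proof.
move=> Kc1 Kc2 fl2.
apply: filterS2 (kbounded_mx_integrable Kc1 fl2) (kbounded_mx_integrable Kc2 fl2).
move=> r iF iG; rewrite /iop -mx_integralD//.
by congr mx_integral; apply/funext => s; rewrite mulmxDl.
Qed.

Lemma kboundedD K1 K2 c1 c2 : kbounded K1 c1 -> kbounded K2 c2 ->
  kbounded (fun r s => K1 r s + K2 r s) (2 * c1 + 2 * c2).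
Proof.
move=> Kc1 Kc2; have [m1 c10 k1] := Kc1; have [m2 c20 k2] := Kc2.
split; [exact: mx_measurableD|by rewrite addr_ge0 ?mulr_ge0|].
move=> g mg g0 goo.
have ms1 := measurable_kernel_fun_sqr m1 mg g0.
have ms2 := measurable_kernel_fun_sqr m2 mg g0.
apply: (@le_trans _ _ (\int[mu]_r (
    2%:E * (\int[mu]_s (nm (K1 r s) * g s)%:E) ^+ 2 +
    2%:E * (\int[mu]_s (nm (K2 r s) * g s)%:E) ^+ 2))%E).
  apply: ae_ge0_le_integral => //.
  - by move=> *; exact: sqre_ge0.
  - by apply: measurable_kernel_fun_sqr => //; exact: mx_measurableD.
  - by move=> *; rewrite adde_ge0// mule_ge0// sqre_ge0.
  - by apply: emeasurable_funD; exact: measurable_funeM.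
  - apply: nearW => r _.
    have mg' K : mx_measurable setT (fun z : T * T => K z.1 z.2) ->
        measurable_fun setT (fun s => nm (K r s) * g s).
      move=> mK; apply: measurable_funM => //; apply: measurable_nm.
      exact: mx_measurable_section.
    have pos K s : 0 <= nm (K r s) * g s by rewrite mulr_ge0// nm_ge0.
    have : (\int[mu]_s (nm (K1 r s + K2 r s) * g s)%:E <=
        \int[mu]_s (nm (K1 r s) * g s)%:E + \int[mu]_s (nm (K2 r s) * g s)%:E)%E.
      rewrite -integralD_fin//; try exact: mg'.
      apply: le_integral_fin => //.
      + exact: (mg' (fun r s => K1 r s + K2 r s) (mx_measurableD m1 m2)).
      + by apply: measurable_funD; exact: mg'.
      + by move=> s _; exact: (pos (fun r s => K1 r s + K2 r s)).
      + by move=> s _; rewrite -mulrDl ler_wpM2r// nmD.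
    have := kernel_int_ge0 K1 r g0; have := kernel_int_ge0 K2 r g0.
    have := kernel_int_ge0 (fun r s => K1 r s + K2 r s) r g0.
    by move=> c0 b0 a0; exact: sqre_leD.
rewrite ge0_integralD//; first last.
- exact: measurable_funeM.
- by move=> *; rewrite mule_ge0// sqre_ge0.
- exact: measurable_funeM.
- by move=> *; rewrite mule_ge0// sqre_ge0.
rewrite !ge0_integralZl//; try by move=> *; exact: sqre_ge0.
rewrite [(2 * c1 + 2 * c2)%:E]EFinD.
rewrite [(2 * c1)%:E]EFinM [(2 * c2)%:E]EFinM muleDl//.
rewrite -!muleA leeD// lee_pmul2l//.
- exact: k1.
- exact: k2.
rewrite ge0_fin_numE//; apply: integral_ge0 => s _.
by rewrite lee_fin sqr_ge0.
Qed.

(* Cauchy-Schwarz in the second variable: the Hilbert-Schmidt norm dominates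
   the operator norm. *)
Lemma kbounded_hs K c : mx_measurable setT (fun z : T * T => K z.1 z.2) ->
  0 <= c ->
  (\int[mu]_r \int[mu]_s (nm (K r s) ^+ 2)%:E <= c%:E)%E -> kbounded K c.
Proof.
move=> mK c0 Kc; split => // g mg g0 goo.
have mKr r : measurable_fun setT (fun s => nm (K r s)).
  by apply: measurable_nm; exact: mx_measurable_section.
have G0 : (0 <= \int[mu]_s (g s ^+ 2)%:E)%E.
  by apply: integral_ge0 => s _; rewrite lee_fin sqr_ge0.
have mK2 : measurable_fun setT (fun r => \int[mu]_s (nm (K r s) ^+ 2)%:E)%E.
  apply: (@measurable_fun_fubini_tonelli_F _ _ _ _ _ mu
    (fun z : T * T => (nm (K z.1 z.2) ^+ 2)%:E)) => [|z].
    exact/measurable_EFinP/measurable_nm_sqr.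
  by rewrite lee_fin sqr_ge0.
have K20 r : (0 <= \int[mu]_s (nm (K r s) ^+ 2)%:E)%E.
  by apply: integral_ge0 => s _; rewrite lee_fin sqr_ge0.
apply: (@le_trans _ _ (\int[mu]_r ((\int[mu]_s (g s ^+ 2)%:E) *
    \int[mu]_s (nm (K r s) ^+ 2)%:E))%E).
  apply: ge0_le_integral => //.
  - by move=> *; exact: sqre_ge0.
  - exact: measurable_kernel_fun_sqr.
  - exact: measurable_funeM.
  - move=> r _; rewrite [leRHS]muleC.
    by apply: cauchy_schwarz => // s; exact: nm_ge0.
rewrite ge0_integralZl// [leRHS]muleC; apply: lee_wpmul2l => //.
Qed.

End IntegralOperator.

(** * Separable approximation of kernels *)

Section SeparableApproximation.
Context d (T : measurableType d) (R : realType).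
Variable rho : {measure set (T * T) -> \bar R}.
Variable w : T * T -> R.
Hypotheses (mw : measurable_fun setT w) (w0 : forall z, 0 <= w z)
  (woo : (\int[rho]_z (w z)%:E < +oo)%E).

Definition bounded_measurable (u : T -> R) : Prop :=
  measurable_fun setT u /\ exists B, forall x, `|u x| <= B.

Definition separable_fun (G : T * T -> R) : Prop :=
  exists (I : finType) (u v : I -> T -> R),
    (forall i, bounded_measurable (u i) /\ bounded_measurable (v i)) /\
    forall z, G z = \sum_i u i z.1 * v i z.2.

Lemma separable_funZD a (G H : T * T -> R) : separable_fun G ->
  separable_fun H -> separable_fun (fun z => a * G z + H z).
Proof.
move=> [I [u [v [uv GE]]]] [J [u' [v' [uv' HE]]]].
exists (I + J)%type.
exists (fun i => match i with inl i => fun x => a * u i x | inr j => u' j end).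
exists (fun i => match i with inl i => v i | inr j => v' j end).
split=> [[i|j]//=|z].
  have [[mu [B uB]] vb] := uv i; split => //; split.
    exact: measurable_funM.
  by exists (`|a| * B) => x; rewrite normrM ler_wpM2l.
by rewrite big_sumType/= GE HE mulr_sumr; congr (_ + _); apply: eq_bigr => i _;
  rewrite mulrA.
Qed.

Lemma measurable_separable G : separable_fun G -> measurable_fun setT G.
Proof.
move=> [I [u [v [uv GE]]]].
apply: (eq_measurable_fun (fun z => \sum_i u i z.1 * v i z.2)) => [z _|].
  by rewrite GE.
apply: measurable_sum => i; have [[mu _] [mv _]] := uv i.
by apply: measurable_funM; [exact: (measurableT_comp mu measurable_fst)|
  exact: (measurableT_comp mv measurable_snd)].
Qed.

Lemma separable_rect (A B : set T) : measurable A -> measurable B ->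
  separable_fun (\1_(A `*` B)).
Proof.
move=> mA mB; exists unit, (fun=> \1_A), (fun=> \1_B); split => [_|z].
  have b (E : set T) : measurable E -> bounded_measurable (\1_E).
    move=> mE; split; first exact: measurable_indic.
    by exists 1 => x; rewrite indicE; case: (_ \in _); rewrite ?normr1 ?normr0.
  by split; exact: b.
rewrite (big_pred1 tt); last by case.
by rewrite !indicE in_setX; case: (_ \in A); case: (_ \in B);
  rewrite /= ?mulr0 ?mul0r ?mulr1.
Qed.

Definition separably_approx (F : T * T -> R) : Prop :=
  forall e, 0 < e -> exists G, separable_fun G /\
    (\int[rho]_z (w z * (F z - G z) ^+ 2)%:E <= e%:E)%E.

Let measurable_wsqr (F : T * T -> R) : measurable_fun setT F ->
  measurable_fun setT (fun z => w z * F z ^+ 2).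
Proof. by move=> mF; apply: measurable_funM => //; exact: measurable_funX. Qed.

Let wsqr_ge0 (F : T * T -> R) z : 0 <= w z * F z ^+ 2.
Proof. by rewrite mulr_ge0// sqr_ge0. Qed.

Let wsqrD (F G : T * T -> R) : measurable_fun setT F -> measurable_fun setT G ->
  (\int[rho]_z (w z * (F z + G z) ^+ 2)%:E <=
   2%:E * \int[rho]_z (w z * F z ^+ 2)%:E +
   2%:E * \int[rho]_z (w z * G z ^+ 2)%:E)%E.
Proof.
move=> mF mG; have m1 := measurable_wsqr mF; have m2 := measurable_wsqr mG.
rewrite -!integralZl_fin// -integralD_fin//; last 4 first.
- exact: measurable_funM.
- exact: measurable_funM.
- by move=> z _; rewrite mulr_ge0.
- by move=> z _; rewrite mulr_ge0.
apply: le_integral_fin => //.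
- exact: (measurable_wsqr (measurable_funD mF mG)).
- by apply: measurable_funD; exact: measurable_funM.
- by move=> z _; rewrite mulr_ge0// sqr_ge0.
- move=> z _; rewrite (le_trans (ler_wpM2l (w0 z) (sqrD_le _ _)))//.
  by rewrite le_eqVlt; apply/orP; left; apply/eqP; ring.
Qed.

Lemma separably_approx_lim (F : T * T -> R) : measurable_fun setT F ->
  (forall e, 0 < e -> exists F', [/\ measurable_fun setT F',
    separably_approx F' &
    (\int[rho]_z (w z * (F z - F' z) ^+ 2)%:E <= e%:E)%E]) ->
  separably_approx F.
Proof.
(* Squared distances add with a factor 2, hence [e / 4] for each of the two approximations. *)
move=> mF H e e0; have e4 : 0 < e / 4 by rewrite divr_gt0.
have [F' [mF' /(_ _ e4)[G [sG dG]] dF]] := H _ e4.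
exists G; split => //.
rewrite (eq_integral (fun z => (w z * ((F z - F' z) + (F' z - G z)) ^+ 2)%:E)).
  apply: (le_trans (wsqrD _ _)); [exact: measurable_funB| |].
    by apply: measurable_funB => //; exact: measurable_separable.
  apply: (@le_trans _ _ (2%:E * (e / 4)%:E + 2%:E * (e / 4)%:E)%E).
    by apply: leeD; apply: lee_wpmul2l.
  by rewrite -!EFinM -EFinD lee_fin; lra.
by move=> z _; rewrite subrKA.
Qed.

Lemma separably_approx_separable F : separable_fun F -> separably_approx F.
Proof.
move=> sF e e0; exists F; split => //.
under eq_integral do rewrite subrr expr0n mulr0.
by rewrite integral0 lee_fin ltW.
Qed.

Lemma separably_approxZD a (F G : T * T -> R) : measurable_fun setT F ->
  measurable_fun setT G ->
  separably_approx F -> separably_approx G ->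
  separably_approx (fun z => a * F z + G z).
Proof.
move=> mF mG aF aG e e0.
have e1 : 0 < e / (4 * (a ^+ 2 + 1)).
  by rewrite divr_gt0// mulr_gt0// ltr_wpDl// sqr_ge0.
have e4 : 0 < e / 4 by rewrite divr_gt0.
have [F' [sF dF]] := aF _ e1; have [G' [sG dG]] := aG _ e4.
exists (fun z => a * F' z + G' z); split; first exact: separable_funZD.
have mF' := measurable_separable sF; have mG' := measurable_separable sG.
rewrite (eq_integral (fun z =>
  (w z * (a * (F z - F' z) + (G z - G' z)) ^+ 2)%:E)); last first.
  by move=> z _; rewrite mulrBr opprD addrACA.
apply: (le_trans (wsqrD _ _)).
- by apply: measurable_funM => //; exact: measurable_funB.
- exact: measurable_funB.
rewrite (_ : (\int[rho]_z (w z * (a * (F z - F' z)) ^+ 2)%:E)%E =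
   ((a ^+ 2)%:E * \int[rho]_z (w z * (F z - F' z) ^+ 2)%:E)%E); last first.
  rewrite -integralZl_fin ?sqr_ge0//; last 2 first.
  - exact: (measurable_wsqr (measurable_funB mF mF')).
  - by move=> z _; rewrite mulr_ge0// sqr_ge0.
  by apply: eq_integral => z _; rewrite exprMn mulrCA.
apply: (@le_trans _ _ (2%:E * ((a ^+ 2)%:E * (e / (4 * (a ^+ 2 + 1)))%:E)
    + 2%:E * (e / 4)%:E)%E).
  apply: leeD; apply: lee_wpmul2l => //.
  by apply: lee_wpmul2l => //; rewrite lee_fin sqr_ge0.
rewrite -!EFinM -EFinD lee_fin.
have a0 : 0 <= a ^+ 2 by exact: sqr_ge0.
have : a ^+ 2 * (e / (4 * (a ^+ 2 + 1))) <= e / 4.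
  rewrite mulrA ler_pdivrMr ?mulr_gt0 ?ltr_wpDl//.
  by rewrite mulrA divfK// mulrC ler_pM2l// lerDl.
by lra.
Qed.

Let cvg_wsqr (F : T * T -> R) (F_ : nat -> T * T -> R) (B : R) :
  measurable_fun setT F -> (forall n, measurable_fun setT (F_ n)) ->
  (forall z, (fun n => F_ n z) @ \oo --> F z) ->
  (forall n z, `|F z - F_ n z| <= B) ->
  forall e, 0 < e -> exists n,
    (\int[rho]_z (w z * (F z - F_ n z) ^+ 2)%:E <= e%:E)%E.
Proof.
move=> mF mF_ cF bF e e0.
have [||||z|N /(_ N (leqnn N))] := @dominated_cvg0 _ _ _ rho
  (fun n z => w z * (F z - F_ n z) ^+ 2) (fun z => B ^+ 2 * w z) _ _ _ _ _ e e0.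
- by move=> n; exact: (measurable_wsqr (measurable_funB mF (mF_ n))).
- exact: measurable_funM.
- move=> n z; rewrite mulr_ge0 ?sqr_ge0//= mulrC ler_wpM2r//.
  by rewrite -[leLHS]real_normK ?num_real// ler_pXn2r// nnegrE (le_trans _ (bF n z)).
- by rewrite integralZl_fin ?sqr_ge0// lte_mul_pinfty// lee_fin sqr_ge0.
- rewrite -[X in _ --> X](_ : w z * (F z - F z) ^+ 2 = 0); last first.
    by rewrite subrr expr0n mulr0.
  apply: cvgMr; under eq_fun do rewrite expr2; rewrite expr2.
  by apply: cvgM; apply: cvgB => //; exact: cvg_cst.
- by move=> H; exists N.
Qed.

(** Dynkin's pi-lambda theorem: measurable rectangles are stable under intersection and their
    indicators are separable. Complements and finite disjoint unions are linear combinations of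
    indicators, and a countable disjoint union is a limit of finite ones in the weighted norm by
    dominated convergence, since [w] is integrable. *)
Lemma separably_approx_indic (S : set (T * T)) : measurable S ->
  separably_approx (\1_S).
Proof.
rewrite measurable_prod_measurableType => mS.
move: S mS; apply: dynkin_induction => /=.
- exact: measurable_prod_measurableType.
- move=> _ _ [A1 mA1 [A2 mA2 <-]] [B1 mB1 [B2 mB2 <-]].
  exists (A1 `&` B1); first exact: measurableI.
  by exists (A2 `&` B2); [exact: measurableI|rewrite setXI].
- rewrite -setXTT; apply: separably_approx_separable.
  exact: separable_rect.
- move=> _ [A mA [B mB <-]]; apply: separably_approx_separable.
  exact: separable_rect.
- move=> S mS aS.
  rewrite (_ : \1_(~` S) = fun z => -1 * \1_S z + \1_(setT `*` setT) z).
    apply: separably_approxZD => //.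
      by apply: measurable_indic; exact: measurableX.
    by apply: separably_approx_separable; exact: separable_rect.
  apply/funext => z; rewrite setXTT !indicE in_setC in_setT.
  by case: (_ \in _); rewrite /= ?mulr1 ?mulr0 ?add0r ?addNr.
- move=> F mF tF aF.
  pose U n := \big[setU/set0]_(k < n) F k.
  have mU n : measurable (U n) by exact: bigsetU_measurable.
  have aU n : separably_approx (\1_(U n)).
    elim: n => [|n ih].
      apply: separably_approx_separable; rewrite /U big_ord0 -(set0X setT).
      exact: separable_rect.
    rewrite (_ : \1_(U n.+1) = fun z => 1 * \1_(U n) z + \1_(F n) z).
      by apply: separably_approxZD => //; exact: measurable_indic.
    apply/funext => z; rewrite mul1r /U big_ord_recr/= !indicE in_setU -/(U n).
    have [zU|zU] := boolP (z \in U n); have [zF|zF] := boolP (z \in F n);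
      rewrite /= ?addr0 ?add0r//.
    exfalso; move: zU zF; rewrite !inE => zU zF.
    move: zU; rewrite /U -bigcup_mkord => -[k/= kn zk].
    move/trivIsetP : tF => /(_ k n I I (negbT (ltn_eqF kn)))/seteqP[+ _].
    by move=> /(_ z); apply.
  apply: separably_approx_lim.
    by apply: measurable_indic; exact: bigcup_measurable.
  move=> e e0.
  have [||z||n Hn] := @cvg_wsqr (\1_(\bigcup_k F k)) (fun n => \1_(U n)) 1 _ _ _ _ e e0.
  + by apply: measurable_indic; exact: bigcup_measurable.
  + by move=> n; exact: measurable_indic.
  + have [zF|zF] := boolP (z \in \bigcup_k F k); last first.
      rewrite [X in _ --> X]indicE (negbTE zF).
      rewrite (_ : (fun n => _) = cst 0); first exact: cvg_cst.
      apply/funext => n; rewrite indicE (_ : z \in U n = false)//.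
      apply/negP; rewrite inE /U -bigcup_mkord => -[k/= _ zk].
      by move/negP : zF; apply; rewrite inE; exists k.
    rewrite [X in _ --> X]indicE zF; apply: cvg_near_cst.
    move: zF; rewrite inE => -[k _ zk]; exists k.+1 => // n /= kn.
    by rewrite indicE mem_set// /U -bigcup_mkord; exists k.
  + by move=> m z; rewrite !indicE; do 2 case: (_ \in _);
      rewrite ?subrr ?subr0 ?sub0r ?normrN ?normr1 ?normr0.
  + by exists (\1_(U n)); split => //; exact: measurable_indic.
Qed.

Import HBNNSimple.

(** Adding [M] makes [F] nonnegative, so that simple functions increase to it; these are finite
    combinations of indicators, and the constant is itself separable and is subtracted again. The
    common bound [2 * M] allows dominated convergence. *)
Lemma separably_approx_bounded (F : T * T -> R) (M : R) :
  measurable_fun setT F -> (forall z, `|F z| <= M) -> separably_approx F.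
Proof.
move=> mF FM.
pose H z := F z + M.
have mH : measurable_fun setT (EFin \o H).
  by apply/measurable_EFinP; exact: measurable_funD.
have H0 z : 0 <= H z by have := FM z; rewrite ler_norml /H => /andP[]; lra.
have H2 z : H z <= 2 * M by have := FM z; rewrite ler_norml /H => /andP[]; lra.
pose h := nnsfun_approx measurableT mH.
have hc z : (fun n => h n z) @ \oo --> H z.
  have := @cvg_nnsfun_approx _ _ _ _ measurableT _ mH
    (fun z _ => ltac:(rewrite lee_fin; exact: H0)) z I.
  by move/fine_cvgP => [].
have hz n z : 0 <= h n z <= H z.
  rewrite fun_ge0/=; have nd : nondecreasing_seq (fun n => h n z).
    by move=> k l kl; exact/lefP/nd_nnsfun_approx.
  have := nondecreasing_cvgn_le nd (cvgP _ (hc z)) n.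
  by rewrite (cvg_lim _ (hc z)).
have mh n : measurable_fun setT (h n) by [].
have ah n : separably_approx (h n).
  rewrite (_ : (h n : T * T -> R) = fun z => \sum_(y <- finmap.enum_fset (fset_set (range (h n))))
      (y * \1_(h n @^-1` [set y]) z)); last first.
    by apply/funext => z; rewrite fimfunE fsbig_finite.
  elim: (finmap.enum_fset _) => [|y l ih].
    under eq_fun do rewrite big_nil.
    apply: separably_approx_separable.
    by exists void, (fun=> cst 0), (fun=> cst 0); split => [[]|z];
      rewrite big_pred0// => -[].
  under eq_fun do rewrite big_cons.
  apply: separably_approxZD => //.
  + by apply: measurable_sum => k; apply: measurable_funM => //; exact: measurable_indic.
  + by apply: separably_approx_indic.
have cM : separable_fun (cst (- M)).
  exists unit, (fun=> cst (- M)), (fun=> cst 1); split => [_|z].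
    by split; split => //; [exists `|M| => x; rewrite /= normrN|
      exists 1 => x; rewrite /= normr1].
  by rewrite (big_pred1 tt) ?mulr1//; case.
apply: separably_approx_lim => // e e0.
have [||z|n z|n Hn] := @cvg_wsqr F (fun n z => 1 * h n z + cst (- M) z) (2 * M)
  _ _ _ _ e e0 => //.
- by move=> n; apply: measurable_funD => //; exact: measurable_funM.
- rewrite -[X in _ --> X](_ : 1 * H z + cst (- M) z = F z); last first.
    by rewrite mul1r /H addrK.
  apply: cvgD; last exact: cvg_cst.
  by apply: cvgMr; exact: hc.
- rewrite mul1r /= (_ : F z - _ = H z - h n z); last by rewrite /H; lra.
  have /andP[h0 h1] := hz n z.
  by rewrite ger0_norm ?subr_ge0//; have := H2 z; lra.
exists (fun z => 1 * h n z + cst (- M) z); split => //.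
  by apply: measurable_funD => //; exact: measurable_funM.
apply: separably_approxZD => //.
exact: separably_approx_separable.
Qed.

End SeparableApproximation.

(** * Separable approximation of matrix kernels *)

Section MatrixSeparable.
Context d (T : measurableType d) (R : realType).
Variable rho : {measure set (T * T) -> \bar R}.
Variable w : T * T -> R.
Hypotheses (mw : measurable_fun setT w) (w0 : forall z, 0 <= w z)
  (woo : (\int[rho]_z (w z)%:E < +oo)%E).
Variable n : nat.
Local Notation C := R[i].

Definition separable_mx (S : T * T -> 'M[C]_n) : Prop :=
  exists (I : finType) (u v : I -> T -> R) (P : I -> 'M[C]_n),
    (forall i, bounded_measurable (u i) /\ bounded_measurable (v i)) /\
    forall z, S z = \sum_i (u i z.1 * v i z.2)%:C *: P i.

Lemma separable_mxD S S' : separable_mx S -> separable_mx S' ->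
  separable_mx (fun z => S z + S' z).
Proof.
move=> [I [u [v [P [uv SE]]]]] [J [u' [v' [P' [uv' SE']]]]].
exists (I + J)%type.
exists (fun i => match i with inl i => u i | inr j => u' j end).
exists (fun i => match i with inl i => v i | inr j => v' j end).
exists (fun i => match i with inl i => P i | inr j => P' j end).
split=> [[i|j]//|z].
by rewrite big_sumType/= SE SE'.
Qed.

Lemma separable_mxZ G P : separable_fun G ->
  separable_mx (fun z => (G z)%:C *: P).
Proof.
move=> [I [u [v [uv GE]]]]; exists I, u, v, (fun=> P); split => // z.
by rewrite GE rmorph_sum scaler_suml.
Qed.

Lemma mx_measurable_separable S : separable_mx S -> mx_measurable setT S.
Proof.
move=> [I [u [v [P [uv SE]]]]].
apply: (@eq_mx_measurable _ _ _ _ _ _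
    (fun z => \sum_i (u i z.1 * v i z.2)%:C *: P i)) => [z _|].
  by rewrite SE.
apply: mx_measurable_sum => i; apply: mx_measurableZ.
  apply: cmeasurable_real; have [[mu _] [mv _]] := uv i.
  by apply: measurable_funM; [exact: (measurableT_comp mu measurable_fst)|
    exact: (measurableT_comp mv measurable_snd)].
exact: mx_measurable_cst.
Qed.

Lemma separable_mx_bounded S : separable_mx S ->
  exists B, forall z, nm (S z) <= B.
Proof.
move=> [I [u [v [P [uv SE]]]]].
have H (i : I) : exists B, forall z : T * T, `|u i z.1 * v i z.2| <= B.
  have [[_ [b ub]] [_ [b' vb]]] := uv i.
  exists (b * b') => z; rewrite normrM; exact: ler_pM.
have [B HB] := choice H.
exists (\sum_i B i * nm (P i)) => z.
rewrite SE (le_trans (nm_sum _ _ _))// ler_sum// => i _.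
by rewrite nmZr ler_wpM2r// nm_ge0.
Qed.

Definition mx_separably_approx (M : T * T -> 'M[C]_n) : Prop :=
  forall e, 0 < e -> exists S, separable_mx S /\
    (\int[rho]_z (w z * nm (M z - S z) ^+ 2)%:E <= e%:E)%E.

Let mwn (M : T * T -> 'M[C]_n) : mx_measurable setT M ->
  measurable_fun setT (fun z => w z * nm (M z) ^+ 2).
Proof. by move=> mM; apply: measurable_funM => //; exact: measurable_nm_sqr. Qed.

Lemma mx_separably_approxD M M' : mx_measurable setT M ->
  mx_measurable setT M' -> mx_separably_approx M -> mx_separably_approx M' ->
  mx_separably_approx (fun z => M z + M' z).
Proof.
move=> mM mM' aM aM' e e0; have e4 : 0 < e / 4 by rewrite divr_gt0.
have [S [sS dS]] := aM _ e4; have [S' [sS' dS']] := aM' _ e4.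
have mS := mx_measurable_separable sS; have mS' := mx_measurable_separable sS'.
exists (fun z => S z + S' z); split; first exact: separable_mxD.
have m1 := mwn (mx_measurableB mM mS); have m2 := mwn (mx_measurableB mM' mS').
apply: (@le_trans _ _ (2%:E * (e / 4)%:E + 2%:E * (e / 4)%:E)%E); last first.
  by rewrite -!EFinM -EFinD lee_fin; lra.
apply: (@le_trans _ _ (2%:E * \int[rho]_z (w z * nm (M z - S z) ^+ 2)%:E +
    2%:E * \int[rho]_z (w z * nm (M' z - S' z) ^+ 2)%:E)%E); last first.
  by apply: leeD; apply: lee_wpmul2l.
rewrite -!integralZl_fin//; try by move=> z _; rewrite mulr_ge0 ?sqr_ge0.
rewrite -integralD_fin//; last 4 first.
- exact: measurable_funM.
- exact: measurable_funM.
- by move=> z _; rewrite mulr_ge0// mulr_ge0// sqr_ge0.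
- by move=> z _; rewrite mulr_ge0// mulr_ge0// sqr_ge0.
apply: le_integral_fin => //.
- exact: (mwn (mx_measurableB (mx_measurableD mM mM') (mx_measurableD mS mS'))).
- by apply: measurable_funD; exact: measurable_funM.
- by move=> z _; rewrite mulr_ge0 ?sqr_ge0.
- move=> z _; rewrite opprD addrACA.
  set x := M z - S z; set y := M' z - S' z.
  have H : nm (x + y) ^+ 2 <= 2 * (nm x ^+ 2 + nm y ^+ 2).
    by rewrite (le_trans _ (sqrD_le _ _))// ler_pXn2r ?nnegrE ?addr_ge0 ?nm_ge0// nmD.
  rewrite (le_trans (ler_wpM2l (w0 z) H))//.
  by rewrite le_eqVlt; apply/orP; left; apply/eqP; ring.
Qed.

Lemma mx_separably_approxZ F P : measurable_fun setT F ->
  separably_approx rho w F -> mx_separably_approx (fun z => (F z)%:C *: P).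
Proof.
move=> mF aF e e0.
have p0 : 0 < nm P ^+ 2 + 1 by rewrite ltr_wpDl// sqr_ge0.
have [G [sG dG]] := aF (e / (nm P ^+ 2 + 1)) ltac:(by rewrite divr_gt0).
exists (fun z => (G z)%:C *: P); split; first exact: separable_mxZ.
have mG := measurable_separable sG.
have m1 : measurable_fun setT (fun z => w z * (F z - G z) ^+ 2).
  by apply: measurable_funM => //; apply: measurable_funX; exact: measurable_funB.
rewrite (_ : (\int[rho]_z _)%E =
   ((nm P ^+ 2)%:E * \int[rho]_z (w z * (F z - G z) ^+ 2)%:E)%E); last first.
  rewrite -integralZl_fin ?sqr_ge0//; last first.
    by move=> z _; rewrite mulr_ge0 ?sqr_ge0.
  apply: eq_integral => z _; rewrite -scalerBl -rmorphB nmZr exprMn.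
  by rewrite real_normK ?num_real//; congr EFin; ring.
apply: (@le_trans _ _ ((nm P ^+ 2)%:E * (e / (nm P ^+ 2 + 1))%:E)%E).
  by apply: lee_wpmul2l => //; rewrite lee_fin sqr_ge0.
rewrite -EFinM lee_fin mulrA ler_pdivrMr// mulrC ler_pM2l// lerDl//.
Qed.

Lemma mx_separably_approx_bounded (M : T * T -> 'M[C]_n) (c : R) :
  mx_measurable setT M -> (forall z, nm (M z) <= c) -> mx_separably_approx M.
Proof.
move=> mM Mc.
have mre i j : measurable_fun setT (fun z => complex.Re (M z i j)) by case: (mM i j).
have mim i j : measurable_fun setT (fun z => complex.Im (M z i j)) by case: (mM i j).
pose D i j : 'M[C]_n := delta_mx i j.
pose N i j z := (complex.Re (M z i j))%:C *: D i j +
  (complex.Im (M z i j))%:C *: ((0 +i* 1) *: D i j).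
have mN i j : mx_measurable setT (N i j).
  by apply: mx_measurableD; apply: mx_measurableZ;
    (exact: cmeasurable_real || exact: mx_measurable_cst).
have aN i j : mx_separably_approx (N i j).
  apply: mx_separably_approxD.
  - by apply: mx_measurableZ;
      (exact: cmeasurable_real || exact: mx_measurable_cst).
  - by apply: mx_measurableZ;
      (exact: cmeasurable_real || exact: mx_measurable_cst).
  - apply: mx_separably_approxZ => //.
    apply: (@separably_approx_bounded _ _ _ _ _ mw w0 woo _ c) => // z.
    by rewrite (le_trans (normRe_l1 _))// (le_trans (l1_nm _ i j)).
  - apply: mx_separably_approxZ => //.
    apply: (@separably_approx_bounded _ _ _ _ _ mw w0 woo _ c) => // z.
    by rewrite (le_trans (normIm_l1 _))// (le_trans (l1_nm _ i j)).
have a0 : mx_separably_approx (fun=> 0).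
  move=> e e0; exists (fun=> 0); split.
    exists void, (fun=> cst 0), (fun=> cst 0), (fun=> 0).
    by split => [[]|z]; rewrite big_pred0// => -[].
  under eq_integral do rewrite subrr nm0 expr0n mulr0.
  by rewrite integral0 lee_fin ltW.
have asum I (r : seq I) (F : I -> T * T -> 'M[C]_n) :
    (forall i, mx_measurable setT (F i)) ->
    (forall i, mx_separably_approx (F i)) ->
    mx_separably_approx (fun z => \sum_(i <- r) F i z).
  move=> mF aF; elim: r => [|i r ih].
    by under eq_fun do rewrite big_nil.
  under eq_fun do rewrite big_cons.
  by apply: mx_separably_approxD => //; exact: mx_measurable_sum.
have -> : M = fun z => \sum_i \sum_j N i j z.
  apply/funext => z; rewrite [LHS]matrix_sum_delta.
  apply: eq_bigr => i _; apply: eq_bigr => j _.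
  rewrite /N scalerA -scalerDl; congr (_ *: _).
  by apply: eq_cReIm; rewrite ?cReD ?cImD ?cReM ?cImM/=; ring.
by apply: (asum) => i; [exact: mx_measurable_sum|exact: asum].
Qed.

End MatrixSeparable.

Lemma mx_lin_entry (F : comRingType) p q (c : F) (X Z : 'M[F]_(p, q)) i j :
  (c *: X + Z) i j = c * X i j + Z i j.
Proof. by rewrite !mxE. Qed.

(** * Finite-rank operators from separable kernels *)

Section FiniteRank.
Context d (T : measurableType d) (R : realType).
Variable mu : {sigma_finite_measure set T -> \bar R}.
Variable n : nat.
Local Notation C := R[i].
Implicit Types (f g : T -> 'cV[C]_n).
Variables (A W : T -> 'M[C]_n).
Hypotheses (Al2 : is_l2 mu A) (Wl2 : is_l2 mu W).
Variables (I : finType) (u v : I -> T -> R) (P : I -> 'M[C]_n).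
Hypothesis uv : forall i, bounded_measurable (u i) /\ bounded_measurable (v i).
Let S (z : T * T) := \sum_i (u i z.1 * v i z.2)%:C *: P i.

Let Y i (f : T -> 'cV[C]_n) : 'cV[C]_n :=
  mx_integral mu setT (fun s => (v i s)%:C *: (W s *m f s)).

Let Wf_int f : is_l2 mu f ->
  ((\int[mu]_s (nm (W s) * nm (f s))%:E) ^+ 2 <= l2n mu W * l2n mu f)%E.
Proof.
move=> [mf _]; have [mW _] := Wl2.
by apply: cauchy_schwarz; try exact: measurable_nm; move=> s; exact: nm_ge0.
Qed.

Let Wf_fin f : is_l2 mu f ->
  (\int[mu]_s (nm (W s) * nm (f s))%:E < +oo)%E.
Proof.
move=> fl2; have := Wf_int fl2.
have : (0 <= \int[mu]_s (nm (W s) * nm (f s))%:E)%E.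
  by apply: integral_ge0 => s _; rewrite lee_fin mulr_ge0// nm_ge0.
have : (l2n mu W * l2n mu f < +oo)%E.
  by rewrite lte_mul_pinfty ?l2n_ge0 ?ge0_fin_numE ?l2n_ge0 ?Wl2.2 ?fl2.2.
case: (\int[mu]_s _)%E => [a||]//; first by rewrite ltry.
by move=> h _; rewrite expe2 mulyy leye_eq => /eqP hh; rewrite hh in h.
Qed.

Let Y_int i f : is_l2 mu f ->
  mx_integrable mu setT (fun s => (v i s)%:C *: (W s *m f s)).
Proof.
move=> fl2; have [_ [mv [b vb]]] := uv i.
have mWf : measurable_fun setT (fun s => nm (W s) * nm (f s)).
  by apply: measurable_funM; apply: measurable_nm; [exact: Wl2.1|exact: fl2.1].
apply: (@mx_integrable_le _ _ _ _ _ _ _ _ _ (fun s => `|b| * (nm (W s) * nm (f s)))).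
- exact: measurableT.
- apply: mx_measurableZ; first exact: cmeasurable_real.
  by apply: mx_measurableM; [exact: Wl2.1|exact: fl2.1].
- exact: measurable_funM.
- move=> s _; rewrite nmZr ler_pM ?nm_ge0//; last exact: nmM.
  by rewrite (le_trans (vb s))// ler_norm.
- rewrite integralZl_fin//; last by move=> s _; rewrite mulr_ge0// nm_ge0.
  by rewrite lte_mul_pinfty// Wf_fin.
Qed.

(** The matrix [P i] acts on the vector [Y i f]; expanding that vector in the standard basis
    separates scalar functionals from fixed functions, and this is the reason for indexing by
    pairs. *)
Let a (k : I * 'I_n) (r : T) : 'cV[C]_n :=
  (u k.1 r)%:C *: (A r *m P k.1) *m delta_mx k.2 0.
Let b (k : I * 'I_n) (f : T -> 'cV[C]_n) : C := Y k.1 f k.2 0.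

Let iop_finite f r : is_l2 mu f ->
  iop mu (fun r s => A r *m S (r, s) *m W s) f r = \sum_k b k f *: a k r.
Proof.
move=> fl2; rewrite /iop.
have -> : (fun s => A r *m S (r, s) *m W s *m f s) = (fun s => \sum_i
    (u i r)%:C *: (A r *m P i) *m ((v i s)%:C *: (W s *m f s))).
  apply/funext => s; rewrite /S/= mulmx_sumr !mulmx_suml; apply: eq_bigr => i _.
  rewrite -scalemxAr -!scalemxAl -scalemxAr scalerA -rmorphM/= -!mulmxA.
  by [].
transitivity (\sum_i (u i r)%:C *: (A r *m P i) *m Y i f).
  (* [mx_integral_sum] is about sums over ordinals, so the index type is enumerated first. *)
  pose J := #|I|; pose F (j : 'I_J) s := (u (enum_val j) r)%:C *:
    (A r *m P (enum_val j)) *m ((v (enum_val j) s)%:C *: (W s *m f s)).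
  have -> : (fun s => \sum_i (u i r)%:C *: (A r *m P i) *m
     ((v i s)%:C *: (W s *m f s))) = (fun s => \sum_j F j s).
    by apply/funext => s; rewrite big_enum_val.
  rewrite mx_integral_sum//; last by move=> j; apply: mx_integrable_mull => //; exact: Y_int.
  rewrite [RHS]big_enum_val; apply: eq_bigr => j _.
  by rewrite mx_integral_mull//; exact: Y_int.
rewrite -(pair_bigA _ (fun i j => Y i f j 0 *: ((u i r)%:C *: (A r *m P i) *m delta_mx j 0))).
apply: eq_bigr => i _ /=.
rewrite [in LHS](matrix_sum_delta (Y i f)) mulmx_sumr; apply: eq_bigr => j _.
by rewrite big_ord1 -scalemxAr.
Qed.

Let a_l2 k : is_l2 mu (a k).
Proof.
have [[mu_ [c uc]] _] := uv k.1.
pose D := nm (P k.1) * nm (delta_mx k.2 0 : 'cV[C]_n).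
apply: (@is_l2_le _ _ _ _ _ _ _ (fun r => (`|c| * D) ^+ 2 * nm (A r) ^+ 2)).
- apply: mx_measurableM; last exact: mx_measurable_cst.
  apply: mx_measurableZ; first exact: cmeasurable_real.
  by apply: mx_measurableM; [exact: Al2.1|exact: mx_measurable_cst].
- by apply: measurable_funM => //; exact: measurable_nm_sqr Al2.1.
- move=> r; rewrite -exprMn ler_pXn2r ?nnegrE ?mulr_ge0 ?nm_ge0//.
  rewrite (le_trans (nmM _ _))// nmZr /D.
  rewrite (_ : `|c| * _ * _ =
    `|c| * (nm (A r) * nm (P k.1)) * nm (delta_mx k.2 0 : 'cV[C]_n)); last by ring.
  rewrite ler_wpM2r ?nm_ge0// ler_pM ?nm_ge0//; last exact: nmM.
  by rewrite (le_trans (uc r))// ler_norm.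
- rewrite integralZl_fin ?sqr_ge0//; last 2 first.
  + exact: measurable_nm_sqr Al2.1.
  + by move=> r _; exact: sqr_ge0.
  by rewrite lte_mul_pinfty ?lee_fin ?sqr_ge0// Al2.2.
Qed.

Let b_lin k (c : C) f g : is_l2 mu f -> is_l2 mu g ->
  b k (fun s => c *: f s + g s) = c * b k f + b k g.
Proof.
move=> fl2 gl2; rewrite /b /Y.
have -> : (fun s => (v k.1 s)%:C *: (W s *m (c *: f s + g s))) =
    (fun s => c *: ((v k.1 s)%:C *: (W s *m f s)) + (v k.1 s)%:C *: (W s *m g s)).
  apply/funext => s; rewrite mulmxDr scalerDr -scalemxAr !scalerA.
  by rewrite [c * _]mulrC.
rewrite mx_integralD//; last 2 first.
- by apply: mx_integrableZ => //; exact: Y_int.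
- exact: Y_int.
rewrite (mx_integralZ measurableT c (Y_int k.1 fl2)).
exact: mx_lin_entry.
Qed.

Let b_le k : exists2 c, 0 <= c & forall f, is_l2 mu f ->
  l1 (b k f) ^+ 2 <= c * fine (l2n mu f).
Proof.
have [_ [mv [B' vB]]] := uv k.1.
exists (B' ^+ 2 * fine (l2n mu W)).
  by rewrite mulr_ge0 ?sqr_ge0// fine_ge0// l2n_ge0.
move=> f fl2.
have H1 : ((nm (Y k.1 f))%:E <= `|B'|%:E * \int[mu]_s (nm (W s) * nm (f s))%:E)%E.
  apply: (le_trans (nm_mx_integral measurableT (Y_int k.1 fl2))).
  have mWf : measurable_fun setT (fun s => nm (W s) * nm (f s)).
    by apply: measurable_funM; apply: measurable_nm; [exact: Wl2.1|exact: fl2.1].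
  rewrite -integralZl_fin//; last by move=> s _; rewrite mulr_ge0// nm_ge0.
  apply: le_integral_fin => //.
  - by have [? _] := Y_int k.1 fl2; exact: measurable_nm.
  - exact: measurable_funM.
  - by move=> s _; exact: nm_ge0.
  - move=> s _; rewrite nmZr ler_pM ?nm_ge0//; last exact: nmM.
    by rewrite (le_trans (vB s))// ler_norm.
have Wfi := Wf_int fl2; move: H1 Wfi (Wf_fin fl2).
have : (0 <= \int[mu]_s (nm (W s) * nm (f s))%:E)%E.
  by apply: integral_ge0 => s _; rewrite lee_fin mulr_ge0// nm_ge0.
case: (\int[mu]_s _)%E => [x||]// x0 H1 H2 _.
rewrite -EFinM lee_fin in H1; rewrite lee_fin in x0.
have fW : l2n mu W \is a fin_num by rewrite ge0_fin_numE ?l2n_ge0 ?Wl2.2.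
have ff : l2n mu f \is a fin_num by rewrite ge0_fin_numE ?l2n_ge0 ?fl2.2.
rewrite -(fineK fW) -(fineK ff) expe2 -!EFinM lee_fin in H2.
rewrite -mulrA (@le_trans _ _ (B' ^+ 2 * (x * x)))//; last first.
  by rewrite ler_wpM2l// sqr_ge0.
rewrite -expr2 -[B' ^+ 2]real_normK ?num_real// -exprMn.
rewrite ler_pXn2r ?nnegrE ?l1_ge0 ?mulr_ge0//.
by rewrite (le_trans (l1_nm _ _ _)).
Qed.

Let J : finType := (I * 'I_n)%type.

Lemma finite_rank_aux : exists m (a : 'I_m -> T -> 'cV[C]_n)
    (b : 'I_m -> (T -> 'cV[C]_n) -> C) (c : R),
  [/\ forall j, is_l2 mu (a j),
      forall j (x : C) f g, is_l2 mu f -> is_l2 mu g ->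
        b j (fun s => x *: f s + g s) = x * b j f + b j g,
      forall j f, is_l2 mu f -> l1 (b j f) ^+ 2 <= c * fine (l2n mu f) &
      forall f r, is_l2 mu f ->
        iop mu (fun r s => A r *m S (r, s) *m W s) f r = \sum_j b j f *: a j r].
Proof.
have bl (k : J) : exists c, 0 <= c /\ forall f, is_l2 mu f ->
    l1 (b k f) ^+ 2 <= c * fine (l2n mu f).
  by have [c c0 H] := b_le k; exists c.
have [c Hc] := choice bl.
exists #|J|, (fun j => a (enum_val j)), (fun j => b (enum_val j)),
  (\sum_(k : J) c k); split.
- by move=> j; exact: a_l2.
- by move=> j x f g fl2 gl2; exact: b_lin.
- move=> j f fl2; have [_ H] := Hc (enum_val j).
  apply: (le_trans (H f fl2)); rewrite ler_wpM2r ?fine_ge0 ?l2n_ge0//.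
  rewrite (bigD1 (enum_val j))//= lerDl sumr_ge0// => k _.
  by have [] := Hc k.
- move=> f r fl2; rewrite iop_finite//.
  by rewrite (big_enum_val (fun k : J => b k f *: a k r)).
Qed.

End FiniteRank.

Lemma separable_finite_rank d (T : measurableType d) (R : realType)
    (mu : {sigma_finite_measure set T -> \bar R}) n (A W : T -> 'M[R[i]]_n)
    (S : T * T -> 'M[R[i]]_n) :
  is_l2 mu A -> is_l2 mu W -> separable_mx S ->
  exists m (a : 'I_m -> T -> 'cV[R[i]]_n)
    (b : 'I_m -> (T -> 'cV[R[i]]_n) -> R[i]) (c : R),
  [/\ forall j, is_l2 mu (a j),
      forall j (x : R[i]) f g, is_l2 mu f -> is_l2 mu g ->
        b j (fun s => x *: f s + g s) = x * b j f + b j g,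
      forall j f, is_l2 mu f -> l1 (b j f) ^+ 2 <= c * fine (l2n mu f) &
      forall f r, is_l2 mu f ->
        iop mu (fun r s => A r *m S (r, s) *m W s) f r = \sum_j b j f *: a j r].
Proof.
move=> Al2 Wl2 [I [u [v [P [uv SE]]]]].
rewrite (_ : S = fun z => \sum_i (u i z.1 * v i z.2)%:C *: P i).
  exact: finite_rank_aux.
exact/funext.
Qed.

(** * The Fredholm alternative for sandwiched kernels *)

Section OperatorFredholm.
Context d (T : measurableType d) (R : realType).
Variable mu : {sigma_finite_measure set T -> \bar R}.
Variable n : nat.
Local Notation C := R[i].
Implicit Types (f g : T -> 'cV[C]_n).
Variables (A W : T -> 'M[C]_n) (B : T -> T -> 'M[C]_n).
Hypotheses (Al2 : is_l2 mu A) (Wl2 : is_l2 mu W)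
  (mB : mx_measurable setT (fun z : T * T => B z.1 z.2)).

Definition truncate_below (M : R) (r s : T) : 'M[C]_n :=
  if nm (B r s) <= M then 0 else B r s.

Hypothesis near : forall e, 0 < e -> exists M,
  kbounded mu (fun r s => A r *m truncate_below M r s *m W s) e.

Let K r s := A r *m B r s *m W s.

Let far M r s := B r s - truncate_below M r s.

Let m_truncate M :
  mx_measurable setT (fun z : T * T => truncate_below M z.1 z.2).
Proof.
have mb : measurable_fun setT (fun z : T * T => nm (B z.1 z.2) <= M).
  apply: measurable_fun_ler; [exact: measurable_nm|exact: measurable_cst].
move=> i j; have [m1 m2] := mB i j; rewrite /truncate_below; split.
  apply: (eq_measurable_fun (fun z : T * T => if nm (B z.1 z.2) <= M then 0 else
      complex.Re (B z.1 z.2 i j))) => [z _|]; first by case: ifP => //; rewrite mxE.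
  exact: measurable_fun_ifT.
apply: (eq_measurable_fun (fun z : T * T => if nm (B z.1 z.2) <= M then 0 else
    complex.Im (B z.1 z.2 i j))) => [z _|]; first by case: ifP => //; rewrite mxE.
exact: measurable_fun_ifT.
Qed.

Let m_far M : mx_measurable setT (fun z : T * T => far M z.1 z.2).
Proof. exact: mx_measurableB. Qed.

Let far_le M r s : nm (far M r s) <= `|M|.
Proof.
rewrite /far /truncate_below; case: ifPn => H; last by rewrite subrr nm0.
by rewrite subr0 (le_trans H)// ler_norm.
Qed.

Let mAW (S : T * T -> 'M[C]_n) : mx_measurable setT S ->
  mx_measurable setT (fun z : T * T => A z.1 *m S z *m W z.2).
Proof.
move=> mS; apply: mx_measurableM; last exact: mx_measurable_snd Wl2.1.
by apply: mx_measurableM => //; exact: mx_measurable_fst Al2.1.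
Qed.

(** With this weight, the Hilbert-Schmidt norm of [A S W] is dominated by a weighted L^2 norm of
    [S]; it is integrable because [A] and [W] are both in L^2. *)
Let w (z : T * T) := nm (A z.1) ^+ 2 * nm (W z.2) ^+ 2.

Let w0 z : 0 <= w z. Proof. by rewrite mulr_ge0// sqr_ge0. Qed.

Let mA2 : measurable_fun setT (fun z : T * T => nm (A z.1) ^+ 2).
Proof. exact: (measurableT_comp (measurable_nm_sqr Al2.1) measurable_fst). Qed.

Let mW2 : measurable_fun setT (fun z : T * T => nm (W z.2) ^+ 2).
Proof. exact: (measurableT_comp (measurable_nm_sqr Wl2.1) measurable_snd). Qed.

Let mw : measurable_fun setT w. Proof. exact: measurable_funM. Qed.

Let w_fin : (\int[mu \x mu]_z (w z)%:E < +oo)%E.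
Proof.
rewrite fubini_tonelli1/=; last 2 first.
- exact/measurable_EFinP.
- by move=> z; rewrite lee_fin.
rewrite /fubini_F/= (eq_integral (fun r => (l2n mu W * (nm (A r) ^+ 2)%:E)%E)).
  rewrite ge0_integralZl//.
  - by rewrite lte_mul_pinfty// ?l2n_ge0// ?ge0_fin_numE ?l2n_ge0 ?Wl2.2 ?Al2.2//.
  - by apply/measurable_EFinP; exact: measurable_nm_sqr Al2.1.
  - by move=> r _; rewrite lee_fin sqr_ge0.
  - exact: l2n_ge0.
move=> r _; rewrite /w/= integralZl_fin ?sqr_ge0//; last 2 first.
- exact: measurable_nm_sqr Wl2.1.
- by move=> s _; exact: sqr_ge0.
by rewrite muleC.
Qed.

Let kb_hs (S : T * T -> 'M[C]_n) e : mx_measurable setT S -> 0 <= e ->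
  (\int[mu \x mu]_z (w z * nm (S z) ^+ 2)%:E <= e%:E)%E ->
  kbounded mu (fun r s => A r *m S (r, s) *m W s) e.
Proof.
move=> mS e0 Se.
have mS' : mx_measurable setT (fun z : T * T => S (z.1, z.2)).
  by rewrite (_ : (fun z => S (z.1, z.2)) = S)//; apply/funext => -[].
have mAS := mAW mS'.
apply: kbounded_hs => //; apply: le_trans Se.
have mwS : measurable_fun setT (fun z => w z * nm (S z) ^+ 2).
  by apply: measurable_funM => //; exact: measurable_nm_sqr.
rewrite fubini_tonelli1//=; last 2 first.
- exact/measurable_EFinP.
- by move=> z; rewrite lee_fin mulr_ge0// sqr_ge0.
have mas r : measurable_fun setT (fun s => nm (A r *m S (r, s) *m W s) ^+ 2).
  apply: measurable_nm_sqr.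
  exact: (@mx_measurable_section _ _ _ _ _ _ _
    (fun r s => A r *m S (r, s) *m W s) r mAS).
apply: ge0_le_integral => //.
- by move=> r _; apply: integral_ge0 => s _; rewrite lee_fin sqr_ge0.
- apply: (@measurable_fun_fubini_tonelli_F _ _ _ _ _ mu
    (fun z : T * T => (nm (A z.1 *m S (z.1, z.2) *m W z.2) ^+ 2)%:E)) => [|z].
    exact/measurable_EFinP/measurable_nm_sqr.
  by rewrite lee_fin sqr_ge0.
- apply: (@measurable_fun_fubini_tonelli_F _ _ _ _ _ mu
    (fun z : T * T => (w z * nm (S z) ^+ 2)%:E)) => [|z].
    exact/measurable_EFinP.
  by rewrite lee_fin mulr_ge0// sqr_ge0.
- move=> r _; apply: le_integral_fin => //.
  + exact: (measurable_fun_pair2 r mwS).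
  + by move=> s _; exact: sqr_ge0.
  + move=> s _; rewrite /w/= mulrAC -!exprMn ler_pXn2r ?nnegrE ?mulr_ge0 ?nm_ge0//.
    rewrite (le_trans (nmM _ _))// ler_wpM2r ?nm_ge0//.
    exact: nmM.
Qed.

(** The error of the separable approximation of the far part is put together with the near part.
    Each has constant [128^-1], and [kboundedD] gives [2 / 128 + 2 / 128 = 32^-1], the contraction
    required by the abstract Fredholm argument. *)
Lemma iop_decomposition : exists K1 K2 : T -> T -> 'M[C]_n,
  [/\ kbounded mu K1 32^-1, exists c, kbounded mu K2 c,
      K = (fun r s => K1 r s + K2 r s) &
      exists S, separable_mx S /\ K2 = (fun r s => A r *m S (r, s) *m W s)].
Proof.
have e0 : 0 < 128^-1 :> R by rewrite invr_gt0.
have [M HM] := near e0.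
have mfar : mx_measurable setT (fun z : T * T => far M z.1 z.2) by exact: m_far.
have [S [sS dS]] := @mx_separably_approx_bounded _ _ _ _ _ mw w0 w_fin _
  (fun z : T * T => far M z.1 z.2) `|M| mfar (fun z => far_le M z.1 z.2) _ e0.
have mS := mx_measurable_separable sS.
have kerr := kb_hs (mx_measurableB mfar mS) (ltW e0) dS.
have k1 := kboundedD HM kerr.
exists (fun r s => A r *m truncate_below M r s *m W s +
  A r *m (far M r s - S (r, s)) *m W s), (fun r s => A r *m S (r, s) *m W s).
split.
- by rewrite [32^-1](_ : _ = 2 * 128^-1 + 2 * 128^-1)//; lra.
- have [c Hc] := separable_mx_bounded sS.
  exists (c ^+ 2 * fine (\int[mu \x mu]_z (w z)%:E)).
  have wI : (0 <= \int[mu \x mu]_z (w z)%:E)%E.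
    by apply: integral_ge0 => z _; rewrite lee_fin.
  apply: kb_hs => //.
    by apply: mulr_ge0; [exact: sqr_ge0|exact: fine_ge0].
  rewrite EFinM fineK ?ge0_fin_numE// -integralZl_fin ?sqr_ge0//.
  apply: le_integral_fin => //.
  + by apply: measurable_funM => //; exact: measurable_nm_sqr.
  + exact: measurable_funM.
  + by move=> z _; rewrite mulr_ge0// sqr_ge0.
  + move=> z _; rewrite mulrC ler_wpM2r// ler_pXn2r ?nnegrE ?nm_ge0//.
    by rewrite (le_trans _ (Hc z))// nm_ge0.
- apply/funext => r; apply/funext => s; rewrite /K -!mulmxDl -!mulmxDr.
  by rewrite -addrA subrK /far subrKC.
- by exists S.
Qed.

Lemma kbounded_sandwich : exists c, kbounded mu K c.
Proof.
have [K1 [K2 [kb1 [c kb2] -> _]]] := iop_decomposition.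
by eexists; exact: (kboundedD kb1 kb2).
Qed.

Hypothesis inj : forall f, is_l2 mu f ->
  {ae mu, forall r, f r + iop mu K f r = 0} -> {ae mu, forall r, f r = 0}.

Let D : set (T -> 'cV[C]_n) := [set f | is_l2 mu f].
Let q (f : T -> 'cV[C]_n) : R := fine (l2n mu f).

Let DD f g : D f -> D g -> D (f + g).
Proof. move=> fl2 gl2; exact: (is_l2D (F := f) (G := g) fl2 gl2). Qed.

Let DB f g : D f -> D g -> D (f - g).
Proof. move=> fl2 gl2; exact: (is_l2B (F := f) (G := g) fl2 gl2). Qed.

Let DZ (x : C) f : D f -> D (x *: f).
Proof. move=> fl2; exact: (is_l2Z x (F := f) fl2). Qed.

Let D0 : D 0. Proof. exact: is_l2_0. Qed.

Let l2n_fin f : is_l2 mu f -> l2n mu f \is a fin_num.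
Proof. by move=> [_ ?]; rewrite ge0_fin_numE ?l2n_ge0. Qed.

Let qE f : is_l2 mu f -> (q f)%:E = l2n mu f.
Proof. by move=> fl2; rewrite /q fineK ?l2n_fin. Qed.

Let q_ge0 f : 0 <= q f. Proof. by rewrite fine_ge0 ?l2n_ge0. Qed.

Let q_ae f : is_l2 mu f -> q f = 0 <-> {ae mu, forall r, f r = 0}.
Proof.
move=> fl2; rewrite -(l2n_eq0P _ fl2.1) -qE//.
by split => [->//|[]].
Qed.

Let q0 : q 0 = 0.
Proof. by apply/q_ae; [exact: is_l2_0|exact: aeW]. Qed.

Let qD f g : D f -> D g -> q (f + g) <= 2 * q f + 2 * q g.
Proof.
move=> fl2 gl2; rewrite -lee_fin EFinD [(2 * q f)%:E]EFinM [(2 * q g)%:E]EFinM !qE//.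
  by apply: l2nD; [exact: fl2.1|exact: gl2.1].
exact: DD.
Qed.

Let qZ (c : C) f : D f -> q (c *: f) <= l1 c ^+ 2 * q f.
Proof.
move=> fl2; rewrite -lee_fin EFinM !qE//; first by apply: l2nZ; exact: fl2.1.
exact: DZ.
Qed.

Let q_complete (x : nat -> T -> 'cV[C]_n) (c : R) : (forall k, D (x k)) ->
  (forall k, q (x k.+1 - x k) <= c / 16 ^+ k) ->
  exists y, D y /\ forall e, 0 < e -> exists k, forall l, (k <= l)%N ->
    q (x l - y) <= e.
Proof.
move=> Dx xc; have [|y [Dy Hy]] := @l2_complete _ _ _ mu _ _ x c Dx.
  move=> k; have Dk : is_l2 mu (x k.+1 - x k) by exact: DB.
  by have := xc k; rewrite -lee_fin qE.
exists y; split => // e /Hy[k Hk]; exists k => l /Hk.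
have Dl : is_l2 mu (x l - y) by exact: DB.
by rewrite -lee_fin qE.
Qed.

(** The abstract result with [D] the square-integrable functions, [q] the squared norm, [N] the
    operator with the small kernel [K1], and the finite-rank part given by the separable kernel
    [K2]. *)
Lemma iop_fredholm :
  (forall f, is_l2 mu f -> exists x, is_l2 mu x /\
     {ae mu, forall r, x r + iop mu K x r = f r}) /\
  exists2 c, 0 <= c & forall x, is_l2 mu x ->
    (l2n mu x <= c%:E * l2n mu (fun r => x r + iop mu K x r)%R)%E.
Proof.
have [K1 [K2 [kb1 [c kb2] KE [S [sS K2E]]]]] := iop_decomposition.
have [m [a [b [Kb [al2 bl bb FE]]]]] := separable_finite_rank Al2 Wl2 sS.
have kb : kbounded mu K (2 * 32^-1 + 2 * c) by rewrite KE; exact: kboundedD.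
have DT f : D f -> D (iop mu K f) by move=> Df; exact: (is_l2_iop kb Df).
have DN f : D f -> D (iop mu K1 f) by move=> Df; exact: (is_l2_iop kb1 Df).
have N_lin (x : C) f g : D f -> D g ->
    q (iop mu K1 (x *: f + g) - (x *: iop mu K1 f + iop mu K1 g)) = 0.
  move=> Df Dg; apply/q_ae.
    apply: DB; first by apply: DN; apply: DD => //; exact: DZ.
    by apply: DD; [apply: DZ|]; exact: DN.
  apply: filterS (iop_lin_ae x kb1 Df Dg) => r H.
  by apply/eqP; rewrite subr_eq0; apply/eqP; exact: H.
have qN_le f : D f -> q (iop mu K1 f) <= q f / 32.
  move=> Df; rewrite mulrC -lee_fin EFinM !qE//; last exact: DN.
  exact: (iop_l2n kb1 Df).
have DF f : D (\sum_j b j f *: a j).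
  by elim/big_ind : _ => [|? ? ? ?|? ?]; [exact: D0|exact: DD|apply: DZ; exact: al2].
have T_dec f : D f ->
    q (iop mu K f - (iop mu K1 f + \sum_j b j f *: a j)) = 0.
  move=> Df; apply/q_ae.
    by apply: DB; [exact: DT|apply: DD; [exact: DN|exact: DF]].
  apply: filterS (iopD_ae kb1 kb2 Df) => r H.
  apply/eqP; rewrite subr_eq0; apply/eqP.
  rewrite {1}KE H; congr (_ + _); rewrite K2E FE//.
  by rewrite fct_sumE.
have T_inj f : D f -> q (f + iop mu K f) = 0 -> q f = 0.
  move=> Df /q_ae; move=> /(_ (DD Df (DT _ Df))) H.
  by apply/q_ae => //; exact: inj.
split.
  move=> f Df.
  have [x [Dx H]] := @fredholm_solve _ _ D q D0 DD DZ q_ge0 q0 qD qZ q_complete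
    _ DN N_lin qN_le _ a b Kb al2 bl bb _ DT T_dec T_inj f Df.
  exists x; split => //.
  move/q_ae: H => /(_ (DB (DD Dx (DT _ Dx)) Df)).
  by apply: filterS => r /eqP; rewrite subr_eq0 => /eqP.
have [k k0 Hk] := @fredholm_bound _ _ D q D0 DD DZ q_ge0 q0 qD qZ q_complete
    _ DN N_lin qN_le _ a b Kb al2 bl bb _ DT T_dec T_inj.
exists k => // x Dx; rewrite -!qE//; first by rewrite -EFinM lee_fin; exact: Hk.
by apply: DD => //; exact: DT.
Qed.

End OperatorFredholm.

Section ProductSigmaFinite.
Context d1 d2 (T1 : measurableType d1) (T2 : measurableType d2) (R : realType).
Variable m1 : {sigma_finite_measure set T1 -> \bar R}.
Variable m2 : {sigma_finite_measure set T2 -> \bar R}.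

Lemma product_sigma_finite : sigma_finite setT (m1 \x m2)%E.
Proof.
have /sigma_finiteP[F [TF ndF Foo]] := sigma_finiteT m1.
have /sigma_finiteP[G [TG ndG Goo]] := sigma_finiteT m2.
exists (fun n => F n `*` G n).
  rewrite -setXTT TF TG predeqE => -[x y]; split; last first.
    by move=> [n _ [/= Fx Gy]]; split; exists n.
  move=> [/= [n _ Fx] [k _ Gy]]; exists (maxn n k) => //; split.
    by move: x Fx; exact/subsetPset/ndF/leq_maxl.
  by move: y Gy; exact/subsetPset/ndG/leq_maxr.
move=> k; have [? ?] := Foo k; have [? ?] := Goo k.
split; first exact: measurableX.
by rewrite product_measure1E// lte_mul_pinfty// ge0_fin_numE.
Qed.

Definition product_sf : {sigma_finite_measure set (T1 * T2)%type -> \bar R} :=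
  HB.pack (m1 \x m2)%E
    (Measure_isSigmaFinite.Build _ _ _ (m1 \x m2)%E product_sigma_finite).

End ProductSigmaFinite.

(** * Convolution kernels on R^3 *)

Section Leb3.
Variable R : realType.
Local Notation leb := (@lebesgue_measure R).

(* The library's canonical sigma-finite structure on products only covers
   subprobabilities, so the one on [leb3] is packed by hand. *)
Definition leb3_sf : {sigma_finite_measure set (R3 R) -> \bar R} :=
  product_sf (product_sf leb leb) leb.

(** The image of Lebesgue measure under a reflection agrees with it on half-open intervals; the
    reflection moves the closed end to the other side, which does not change the length. *)
Lemma ge0_integral_lebesgue_sub (a : R) (f : measurableTypeR R -> \bar R) :
  measurable_fun setT f -> (forall x, 0 <= f x)%E ->
  (\int[@lebesgue_measure R]_x f (a - x)%R = \int[@lebesgue_measure R]_x f x)%E.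
Proof.
move=> mf f0.
have mphi : measurable_fun setT
    (fun x : measurableTypeR R => a - x : measurableTypeR R).
  by apply: measurable_funB; [exact: measurable_cst|exact: measurable_id].
pose nu : {measure set (measurableTypeR R) -> \bar R} :=
  measure_function_pushforward__canonical__measure_function_Measure
    (@lebesgue_measure R) mphi.
transitivity (\int[nu]_x f x)%E.
  by rewrite /nu/= ge0_integral_pushforward// preimage_setT.
apply: eq_measure_integral => A mA _.
apply/esym/lebesgue_measure_unique => // _ [[x y] _ <-].
rewrite /nu/= /pushforward.
have -> : (fun z : R => a - z) @^-1` `]x, y] = `[a - y, a - x[%classic.
  by apply/seteqP; split => z/=; rewrite !in_itv/=; lra.
rewrite !lebesgue_measure_itv/= !lte_fin.
have -> : (a - y < a - x) = (x < y) by rewrite ltrD2l ltrN2.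
by case: ifP => // _; congr EFin; ring.
Qed.

(** A translation is the product of two reflections, [x -> - x] and [x -> - a - x]. *)
Lemma ge0_integral_lebesgue_shift (a : R) (f : measurableTypeR R -> \bar R) :
  measurable_fun setT f -> (forall x, 0 <= f x)%E ->
  (\int[@lebesgue_measure R]_x f (x - a)%R = \int[@lebesgue_measure R]_x f x)%E.
Proof.
move=> mf f0.
rewrite -[LHS](ge0_integral_lebesgue_sub 0).
- rewrite -[RHS](ge0_integral_lebesgue_sub (- a))//.
  by apply: eq_integral => x _; rewrite sub0r addrC.
- apply: measurableT_comp mf _.
  by apply: measurable_funB; [exact: measurable_id|exact: measurable_cst].
- by move=> x; exact: f0.
Qed.

Lemma ge0_integral_leb3 (f : R3 R -> \bar R) :
  measurable_fun setT f -> (forall x, 0 <= f x)%E ->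
  (\int[leb3 R]_x f x = \int[leb]_x \int[leb]_y \int[leb]_z f (x, y, z))%E.
Proof.
move=> mf f0.
rewrite -[LHS]/(\int[(product_sf leb leb \x leb)%E]_x f x)%E.
rewrite fubini_tonelli1// fubini_tonelli1//.
- exact: measurable_fun_fubini_tonelli_F.
- by move=> x; exact: integral_ge0.
Qed.

Lemma measurable_sub3r (a : R3 R) : measurable_fun setT (fun x => sub3 a x).
Proof.
have m11 : measurable_fun setT (fun x : R3 R => x.1.1 : R).
  exact: (measurableT_comp measurable_fst measurable_fst).
have m12 : measurable_fun setT (fun x : R3 R => x.1.2 : R).
  exact: (measurableT_comp measurable_snd measurable_fst).
have m2 : measurable_fun setT (fun x : R3 R => x.2 : R).
  exact: measurable_snd.
by apply: measurable_fun_pair; first apply: measurable_fun_pair;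
  apply: measurable_funB => //; exact: measurable_cst.
Qed.

Lemma measurable_sub3l (a : R3 R) : measurable_fun setT (fun x => sub3 x a).
Proof.
have m11 : measurable_fun setT (fun x : R3 R => x.1.1 : R).
  exact: (measurableT_comp measurable_fst measurable_fst).
have m12 : measurable_fun setT (fun x : R3 R => x.1.2 : R).
  exact: (measurableT_comp measurable_snd measurable_fst).
have m2 : measurable_fun setT (fun x : R3 R => x.2 : R).
  exact: measurable_snd.
by apply: measurable_fun_pair; first apply: measurable_fun_pair;
  apply: measurable_funB => //; exact: measurable_cst.
Qed.

Lemma measurable_sub3 :
  measurable_fun setT (fun z : R3 R * R3 R => sub3 z.1 z.2).
Proof.
have m11 : measurable_fun setT (fun x : R3 R => x.1.1 : R).
  exact: (measurableT_comp measurable_fst measurable_fst).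
have m12 : measurable_fun setT (fun x : R3 R => x.1.2 : R).
  exact: (measurableT_comp measurable_snd measurable_fst).
have m2 : measurable_fun setT (fun x : R3 R => x.2 : R).
  exact: measurable_snd.
apply: measurable_fun_pair; first apply: measurable_fun_pair.
- apply: measurable_funB; first exact: (measurableT_comp m11 measurable_fst).
  exact: (measurableT_comp m11 measurable_snd).
- apply: measurable_funB; first exact: (measurableT_comp m12 measurable_fst).
  exact: (measurableT_comp m12 measurable_snd).
- apply: measurable_funB; first exact: (measurableT_comp m2 measurable_fst).
  exact: (measurableT_comp m2 measurable_snd).
Qed.

Let mF1 (f : R3 R -> \bar R) : measurable_fun setT f -> (forall x, 0 <= f x)%E ->
  measurable_fun setT (fun u => \int[leb]_z f (u, z))%E.
Proof. by move=> mf f0; exact: (@measurable_fun_fubini_tonelli_F _ _ _ _ _ leb f). Qed.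

Lemma ge0_integral_sub3r (a : R3 R) (f : R3 R -> \bar R) :
  measurable_fun setT f -> (forall x, 0 <= f x)%E ->
  (\int[leb3 R]_x f (sub3 a x) = \int[leb3 R]_x f x)%E.
Proof.
move=> mf f0.
have E := ge0_integral_leb3 (measurableT_comp mf (measurable_sub3r a))
  (fun x => f0 _).
apply: (etrans E); apply: (etrans _ (esym (ge0_integral_leb3 mf f0))).
have mg := mF1 mf f0.
have g0 u : (0 <= \int[leb]_z f (u, z))%E by exact: integral_ge0.
have mh := @measurable_fun_fubini_tonelli_F _ _ _ _ _ leb
  (fun u => \int[leb]_z f (u, z))%E mg g0.
have h3 x y : (\int[leb]_z f (x, y, (a.2 - z)%R) = \int[leb]_z f (x, y, z))%E.
  exact: (ge0_integral_lebesgue_sub a.2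
    (measurable_fun_pair2 (x, y) mf) (fun z => f0 _)).
have h2 x : (\int[leb]_y \int[leb]_z f (x, (a.1.2 - y)%R, z) =
    \int[leb]_y \int[leb]_z f (x, y, z))%E.
  exact: (ge0_integral_lebesgue_sub a.1.2
    (measurable_fun_pair2 x mg) (fun y => g0 _)).
transitivity (\int[leb]_x \int[leb]_y \int[leb]_z f (a.1.1 - x, a.1.2 - y, z)%R)%E.
  by apply: eq_integral => x _; apply: eq_integral => y _; exact: (h3 (a.1.1 - x) (a.1.2 - y)).
transitivity (\int[leb]_x \int[leb]_y \int[leb]_z f (a.1.1 - x, y, z)%R)%E.
  by apply: eq_integral => x _; exact: (h2 (a.1.1 - x)).
apply: (ge0_integral_lebesgue_sub a.1.1 mh) => x.
exact: integral_ge0.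
Qed.

Lemma ge0_integral_sub3l (a : R3 R) (f : R3 R -> \bar R) :
  measurable_fun setT f -> (forall x, 0 <= f x)%E ->
  (\int[leb3 R]_x f (sub3 x a) = \int[leb3 R]_x f x)%E.
Proof.
move=> mf f0.
have E := ge0_integral_leb3 (measurableT_comp mf (measurable_sub3l a))
  (fun x => f0 _).
apply: (etrans E); apply: (etrans _ (esym (ge0_integral_leb3 mf f0))).
have mg := mF1 mf f0.
have g0 u : (0 <= \int[leb]_z f (u, z))%E by exact: integral_ge0.
have mh := @measurable_fun_fubini_tonelli_F _ _ _ _ _ leb
  (fun u => \int[leb]_z f (u, z))%E mg g0.
have h3 x y : (\int[leb]_z f (x, y, (z - a.2)%R) = \int[leb]_z f (x, y, z))%E.
  exact: (ge0_integral_lebesgue_shift a.2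
    (measurable_fun_pair2 (x, y) mf) (fun z => f0 _)).
have h2 x : (\int[leb]_y \int[leb]_z f (x, (y - a.1.2)%R, z) =
    \int[leb]_y \int[leb]_z f (x, y, z))%E.
  exact: (ge0_integral_lebesgue_shift a.1.2
    (measurable_fun_pair2 x mg) (fun y => g0 _)).
transitivity (\int[leb]_x \int[leb]_y \int[leb]_z f (x - a.1.1, y - a.1.2, z)%R)%E.
  by apply: eq_integral => x _; apply: eq_integral => y _; exact: (h3 (x - a.1.1) (y - a.1.2)).
transitivity (\int[leb]_x \int[leb]_y \int[leb]_z f (x - a.1.1, y, z)%R)%E.
  by apply: eq_integral => x _; exact: (h2 (x - a.1.1)).
apply: (ge0_integral_lebesgue_shift a.1.1 mh) => x.
exact: integral_ge0.
Qed.

End Leb3.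

(** * Young's inequality and kernels in L^1 + L^infinity *)

Section Convolution.
Variable R : realType.
Local Notation C := R[i].
Local Notation mu := (leb3_sf R).
Variable n : nat.
Implicit Types (g : R3 R -> R) (k : R3 R -> R).

Lemma measurable_conv_kernel k : measurable_fun setT k ->
  measurable_fun setT (fun z : R3 R * R3 R => k (sub3 z.1 z.2)).
Proof. by move=> mk; exact: (measurableT_comp mk (@measurable_sub3 R)). Qed.

Lemma integral_conv k g : measurable_fun setT k -> measurable_fun setT g ->
  (forall x, 0 <= k x) -> (forall x, 0 <= g x) ->
  (\int[mu]_r \int[mu]_s (k (sub3 r s) * g s)%:E =
   \int[mu]_x (k x)%:E * \int[mu]_s (g s)%:E)%E.
Proof.
move=> mk mg k0 g0.
have mkg : measurable_fun setT
    (fun z : R3 R * R3 R => (k (sub3 z.1 z.2) * g z.2)%:E).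
  apply/measurable_EFinP; apply: measurable_funM; first exact: measurable_conv_kernel.
  exact: (measurableT_comp mg measurable_snd).
have kg0 (z : R3 R * R3 R) : (0 <= (k (sub3 z.1 z.2) * g z.2)%:E)%E.
  by rewrite lee_fin mulr_ge0.
have I0 : (0 <= \int[mu]_x (k x)%:E)%E.
  by apply: integral_ge0 => x _; rewrite lee_fin.
rewrite (fubini_tonelli (m1 := mu) (m2 := mu) _ mkg kg0)/=.
rewrite -[RHS](@ge0_integralZl _ _ _ mu _ measurableT (EFin \o g))//; last first.
- by move=> x _; rewrite lee_fin.
- exact/measurable_EFinP.
apply: eq_integral => s _.
have E : (\int[mu]_x (k (sub3 x s))%:E = \int[mu]_x (k x)%:E)%E.
  apply: (@ge0_integral_sub3l _ s (EFin \o k)).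
    exact/measurable_EFinP.
  by move=> x; rewrite lee_fin.
rewrite -E muleC -integralZl_fin//.
- by apply: eq_integral => r _; rewrite mulrC.
- exact: (measurableT_comp mk (measurable_sub3l s)).
Qed.

(** Cauchy-Schwarz with weight [k (sub3 r s)] bounds the square of the inner integral by [I] times
    the convolution of [k] with [g ^+ 2]; integrating in [r] yields a second factor [I]. *)
Lemma kbounded_young (K : R3 R -> R3 R -> 'M[C]_n) k (I : R) :
  mx_measurable setT (fun z : R3 R * R3 R => K z.1 z.2) ->
  measurable_fun setT k -> (forall x, 0 <= k x) ->
  (forall r s, nm (K r s) <= k (sub3 r s)) ->
  (\int[mu]_x (k x)%:E <= I%:E)%E -> kbounded mu K (I ^+ 2).
Proof.
move=> mK mk k0 Kk kI; split => //; first exact: sqr_ge0.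
move=> g mg g0 goo.
have mkr r : measurable_fun setT (fun s => k (sub3 r s)).
  exact: (measurableT_comp mk (measurable_sub3r r)).
have I0 : (0 <= \int[mu]_x (k x)%:E)%E.
  by apply: integral_ge0 => x _; rewrite lee_fin.
have I0' : (0 <= I%:E)%E by exact: le_trans kI.
have mg2 : measurable_fun setT (fun s => g s ^+ 2) by exact: measurable_funX.
have Ek r : (\int[mu]_s (k (sub3 r s))%:E = \int[mu]_x (k x)%:E)%E.
  apply: (@ge0_integral_sub3r _ r (EFin \o k)).
    exact/measurable_EFinP.
  by move=> x; rewrite lee_fin.
have mH : measurable_fun setT (fun r => \int[mu]_s (k (sub3 r s) * g s ^+ 2)%:E)%E.
  apply: (@measurable_fun_fubini_tonelli_F _ _ _ _ _ mu
    (fun z : R3 R * R3 R => (k (sub3 z.1 z.2) * g z.2 ^+ 2)%:E)) => [|z].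
    apply/measurable_EFinP; apply: measurable_funM; first exact: measurable_conv_kernel.
    exact: (measurableT_comp mg2 measurable_snd).
  by rewrite lee_fin mulr_ge0// sqr_ge0.
have H0 r : (0 <= \int[mu]_s (k (sub3 r s) * g s ^+ 2)%:E)%E.
  by apply: integral_ge0 => s _; rewrite lee_fin mulr_ge0// sqr_ge0.
apply: (@le_trans _ _ (\int[mu]_r (I%:E *
    \int[mu]_s (k (sub3 r s) * g s ^+ 2)%:E))%E).
  apply: ge0_le_integral => //.
  - by move=> *; exact: sqre_ge0.
  - exact: measurable_kernel_fun_sqr.
  - exact: measurable_funeM.
  - move=> r _; apply: (@le_trans _ _ ((\int[mu]_s (k (sub3 r s) * g s)%:E) ^+ 2)%E).
      rewrite lee_sqr ?kernel_int_ge0//; last first.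
        by apply: integral_ge0 => s _; rewrite lee_fin mulr_ge0.
      apply: le_integral_fin => //.
      + apply: measurable_funM => //; apply: measurable_nm.
        exact: mx_measurable_section.
      + exact: measurable_funM.
      + by move=> s _; rewrite mulr_ge0// nm_ge0.
      + by move=> s _; rewrite ler_wpM2r.
    apply: (le_trans (cauchy_schwarz_weight mu (mkr r) mg (fun s => k0 _) g0)).
    by rewrite Ek lee_wpmul2r.
rewrite ge0_integralZl// (integral_conv mk mg2 k0 (fun s => sqr_ge0 _)).
rewrite expr2 EFinM -!muleA lee_wpmul2l// lee_wpmul2r//.
by apply: integral_ge0 => s _; rewrite lee_fin sqr_ge0.
Qed.

Lemma kbounded_le_cst (K : R3 R -> R3 R -> 'M[C]_n) c c' :
  kbounded mu K c -> c <= c' -> kbounded mu K c'.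
Proof.
move=> [mK c0 H] cc'; split; [exact: mK|exact: le_trans cc'|move=> g mg g0 goo].
rewrite (le_trans (H g mg g0 goo))// lee_wpmul2r ?lee_fin//.
by apply: integral_ge0 => s _; rewrite lee_fin sqr_ge0.
Qed.

Variable B : R3 R -> 'M[C]_n.
Hypothesis mB : mx_measurable setT B.
Variable C0 : R.
Hypothesis B_split :
  (\int[mu]_x (if nm (B x) <= C0 then 0 else nm (B x))%:E < +oo)%E.

(** Integrability of [tail C0] says that [B] is the sum of an integrable and a bounded function. As
    the level grows, [tail] is eventually 0 at each point, so by dominated convergence its integral
    becomes arbitrarily small. *)
Let tail (M : R) x := if nm (B x) <= M then 0 else nm (B x).

Let m_tail M : measurable_fun setT (tail M).
Proof.
apply: measurable_fun_ifT; [|exact: measurable_cst|exact: measurable_nm].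
by apply: measurable_fun_ler; [exact: measurable_nm|exact: measurable_cst].
Qed.

Let tail_ge0 M x : 0 <= tail M x.
Proof. by rewrite /tail; case: ifP => // _; exact: nm_ge0. Qed.

Lemma mx_measurable_conv :
  mx_measurable setT (fun z : R3 R * R3 R => B (sub3 z.1 z.2)).
Proof. exact: (mx_measurable_comp mB (@measurable_sub3 R)). Qed.

Let tail_small e : 0 < e -> exists M, (\int[mu]_x (tail M x)%:E <= e%:E)%E.
Proof.
move=> e0; have [|||||N HN] := @dominated_cvg0 _ _ _ mu
  (fun l => tail (C0 + l%:R)) (tail C0) _ _ _ _ _ e e0.
- by move=> l; exact: m_tail.
- exact: m_tail.
- move=> l x; rewrite tail_ge0/= /tail; case: (leP (nm (B x)) C0) => H.
    by rewrite (le_trans H)// lerDl.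
  by case: ifP => // _; exact: nm_ge0.
- exact: B_split.
- move=> x; apply: cvg_near_cst.
  have [N HN] : exists N : nat, nm (B x) - C0 <= N%:R.
    by exists (Num.bound `|nm (B x) - C0|); rewrite ltW// (le_lt_trans (ler_norm _))// archi_boundP.
  exists N => // l /= Nl; rewrite /tail (_ : nm (B x) <= _)//.
  rewrite -lerBlDl (le_trans HN)// ler_nat//.
by exists (C0 + N%:R); exact: HN.
Qed.

Lemma near_conv (A W : R3 R -> 'M[C]_n) (a w : R) :
  mx_measurable setT A -> mx_measurable setT W ->
  (forall x, nm (A x) <= a) -> (forall x, nm (W x) <= w) ->
  forall e, 0 < e -> exists M, kbounded mu (fun r s =>
    A r *m truncate_below (fun r s => B (sub3 r s)) M r s *m W s) e.
Proof.
move=> mA mW Aa Ww e e0.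
have a0 : 0 <= a by exact: le_trans (nm_ge0 _) (Aa (0, 0, 0)).
have w0 : 0 <= w by exact: le_trans (nm_ge0 _) (Ww (0, 0, 0)).
(* Young's inequality produces the square of an L^1 norm; with [e'] at most 1 and at most [e], one
   has [e' ^+ 2 <= e]. The [+ 1] in [a * w + 1] only keeps the denominator positive. *)
pose e' := Num.min 1 e.
have e'0 : 0 < e' by rewrite lt_min ltr01 e0.
have aw : 0 < a * w + 1 by rewrite ltr_wpDl// mulr_ge0.
have [M HM] := tail_small (divr_gt0 e'0 aw).
exists M; apply: (@kbounded_le_cst _ (e' ^+ 2)); last first.
  by rewrite expr2 (@le_trans _ _ (e' * 1))// ?ler_pM2l// /e' ?mulr1 ge_min lexx ?orbT.
apply: (@kbounded_young _ (fun x => a * w * tail M x)).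
- apply: mx_measurableM; last exact: mx_measurable_snd.
  apply: mx_measurableM; first exact: mx_measurable_fst.
  have mb : measurable_fun setT (fun z : R3 R * R3 R => nm (B (sub3 z.1 z.2)) <= M).
    by apply: measurable_fun_ler; [apply: measurable_nm; exact: mx_measurable_conv|
      exact: measurable_cst].
  move=> i j; have [m1 m2] := mx_measurable_conv i j; rewrite /truncate_below; split.
    apply: (eq_measurable_fun (fun z : R3 R * R3 R =>
      if nm (B (sub3 z.1 z.2)) <= M then 0 else complex.Re (B (sub3 z.1 z.2) i j))).
      by move=> z _; case: ifP => //; rewrite mxE.
    exact: measurable_fun_ifT.
  apply: (eq_measurable_fun (fun z : R3 R * R3 R =>
    if nm (B (sub3 z.1 z.2)) <= M then 0 else complex.Im (B (sub3 z.1 z.2) i j))).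
    by move=> z _; case: ifP => //; rewrite mxE.
  exact: measurable_fun_ifT.
- exact: measurable_funM.
- by move=> x; rewrite mulr_ge0// mulr_ge0.
- move=> r s; rewrite /tail /truncate_below.
  case: ifP => _; first by rewrite mulmx0 mul0mx nm0 mulr0.
  rewrite (le_trans (nmM _ _))// mulrAC ler_pM ?nm_ge0//.
  by rewrite (le_trans (nmM _ _))// ler_wpM2r ?nm_ge0.
- rewrite integralZl_fin ?mulr_ge0//.
  apply: (@le_trans _ _ ((a * w)%:E * (e' / (a * w + 1))%:E)%E).
    by rewrite lee_wpmul2l// lee_fin mulr_ge0.
  rewrite -EFinM lee_fin mulrCA ler_piMr ?(ltW e'0)//.
  by rewrite ler_pdivrMr// mul1r lerDl.
Qed.

(** The integrable part of [B] convolved with the integrable [g] is finite almost everywhere, and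
    the bounded part gives a convergent integral at every point. [C1] replaces [C0] because the
    level may be negative. *)
Lemma conv_ae_integrable p (g : R3 R -> 'M[C]_(n, p)) : mx_integrable mu setT g ->
  {ae mu, forall r, mx_integrable mu setT (fun s => B (sub3 r s) *m g s)}.
Proof.
move=> [mg goo].
have mN := measurable_nm mg.
pose C1 := Num.max 0 C0.
have BC x : nm (B x) <= tail C0 x + C1.
  rewrite /tail /C1; case: (leP (nm (B x)) C0) => H.
    by rewrite add0r le_max H orbT.
  by rewrite lerDl le_max lexx.
have H : (\int[mu]_r \int[mu]_s (tail C0 (sub3 r s) * nm (g s))%:E < +oo)%E.
  rewrite integral_conv//; last by move=> s; exact: nm_ge0.
  by rewrite lte_mul_pinfty ?ge0_fin_numE//; apply: integral_ge0 => x _;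
    rewrite lee_fin.
have mT : measurable_fun setT
    (fun r => \int[mu]_s (tail C0 (sub3 r s) * nm (g s))%:E)%E.
  apply: (@measurable_fun_fubini_tonelli_F _ _ _ _ _ mu
    (fun z : R3 R * R3 R => (tail C0 (sub3 z.1 z.2) * nm (g z.2))%:E)) => [|z].
    apply/measurable_EFinP; apply: measurable_funM; first exact: measurable_conv_kernel.
    exact: (measurableT_comp mN measurable_snd).
  by rewrite lee_fin mulr_ge0// nm_ge0.
have T0 r : (0 <= \int[mu]_s (tail C0 (sub3 r s) * nm (g s))%:E)%E.
  by apply: integral_ge0 => s _; rewrite lee_fin mulr_ge0// nm_ge0.
have : mu.-integrable setT (fun r => \int[mu]_s (tail C0 (sub3 r s) * nm (g s))%:E)%E.
  apply/integrableP; split => //.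
  by under eq_integral do rewrite gee0_abs//.
move/(integrable_ae measurableT); apply: filterS => r /(_ I) Hr.
have mtr : measurable_fun setT (fun s => tail C0 (sub3 r s) * nm (g s)).
  by apply: measurable_funM => //; exact: (measurableT_comp (m_tail C0) (measurable_sub3r r)).
have mcr : measurable_fun setT (fun s => C1 * nm (g s)) by exact: measurable_funM.
have C10 : 0 <= C1 by rewrite le_max lexx.
apply: (@mx_integrable_le _ _ _ _ _ _ _ _ _
  (fun s => tail C0 (sub3 r s) * nm (g s) + C1 * nm (g s))) => //.
- apply: mx_measurableM => //.
  exact: (mx_measurable_comp mB (measurable_sub3r r)).
- exact: measurable_funD.
- move=> s _; rewrite (le_trans (nmM _ _))// -mulrDl ler_wpM2r ?nm_ge0//.
- rewrite integralD_fin//; last 2 first.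
  + by move=> s _; rewrite mulr_ge0// nm_ge0.
  + by move=> s _; rewrite mulr_ge0// nm_ge0.
  rewrite lte_add_pinfty//; first by rewrite -ge0_fin_numE.
  rewrite integralZl_fin//; last by move=> s _; exact: nm_ge0.
  by rewrite lte_mul_pinfty.
Qed.

End Convolution.

(** * Integrability of radial profiles *)

Section RadialIntegrability.
Variable R : realType.
Local Notation mu := (leb3_sf R).
Implicit Types x : R3 R.

Definition box (a : R) : set (R3 R) := `[- a, a] `*` `[- a, a] `*` `[- a, a].

Lemma measurable_box a : measurable (box a).
Proof.
by apply: measurableX; [apply: measurableX|]; exact: measurable_itv.
Qed.

Lemma leb3_box a : 0 <= a -> mu (box a) = ((2 * a) ^+ 3)%:E.
Proof.
move=> a0.
have mI : measurable (`[- a, a]%classic : set (measurableTypeR R)).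
  exact: measurable_itv.
have E : lebesgue_measure `[- a, a]%classic = (2 * a)%:E.
  rewrite lebesgue_measure_itv/= lte_fin; case: ifPn => [_|].
    by congr EFin; rewrite opprK mulr_natl mulr2n.
  rewrite -leNgt => H; rewrite (_ : a = 0) ?mulr0//; lra.
have H2 := product_measure1E (@lebesgue_measure R) (@lebesgue_measure R) mI mI.
have H3 := product_measure1E (product_sf (@lebesgue_measure R) (@lebesgue_measure R))
  (@lebesgue_measure R) (measurableX mI mI) mI.
transitivity ((2 * a)%:E * (2 * a)%:E * (2 * a)%:E)%E; last first.
  by rewrite -!EFinM; congr EFin; rewrite !exprS expr0 mulr1 mulrA.
apply: (etrans H3); congr (_ * _)%E; last exact: E.
by apply: (etrans H2); congr (_ * _)%E; exact: E.
Qed.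

Lemma norm3_ge0 x : 0 <= norm3 x. Proof. exact: sqrtr_ge0. Qed.

Lemma norm3_sqr x : norm3 x ^+ 2 = x.1.1 ^+ 2 + x.1.2 ^+ 2 + x.2 ^+ 2.
Proof. by rewrite sqr_sqrtr /dot3 -!expr2 // !addr_ge0// sqr_ge0. Qed.

Lemma coord_le_norm3 x :
  [/\ `|x.1.1 : R| <= norm3 x, `|x.1.2 : R| <= norm3 x & `|x.2 : R| <= norm3 x].
Proof.
have P (a : R) : a ^+ 2 <= norm3 x ^+ 2 -> `|a| <= norm3 x.
  by rewrite -[a ^+ 2]real_normK ?num_real// ler_pXn2r ?nnegrE ?norm3_ge0.
have h1 := sqr_ge0 (x.1.1 : R); have h2 := sqr_ge0 (x.1.2 : R).
have h3 := sqr_ge0 (x.2 : R).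
by split; apply: P; rewrite norm3_sqr; lra.
Qed.

Lemma box_norm3 x a : norm3 x <= a -> box a x.
Proof.
move=> xa; have [h1 h2 h3] := coord_le_norm3 x.
have P (b : R) : `|b| <= norm3 x -> `[- a, a]%classic b.
  by move=> hb; rewrite /= in_itv/= -ler_norml (le_trans hb).
by split; [split|]; apply: P.
Qed.

(** [g] is dominated by the sum of the [c n] times the indicators of cubes of half-side [rho n],
    whose integrals form a geometric series. Cubes stand in for balls because their volume is a
    product of lengths; the alternative [g x = 0] disposes of the origin and of the region outside
    the shells. *)
Lemma integral_lty_shells (g : R3 R -> R) (c rho : nat -> R) (K : R) :
  measurable_fun setT g -> (forall x, 0 <= g x) ->
  (forall n, 0 <= c n) -> (forall n, 0 <= rho n) ->
  (forall x, g x = 0 \/ exists2 n, norm3 x <= rho n & g x <= c n) ->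
  (forall n, c n * (2 * rho n) ^+ 3 <= K / 2 ^+ n) ->
  (\int[mu]_x (g x)%:E < +oo)%E.
Proof.
move=> mg g0 c0 r0 gc cK.
pose u n x := c n * \1_(box (rho n)) x.
have mu_ n : measurable_fun setT (u n).
  by apply: measurable_funM => //; apply: measurable_indic; exact: measurable_box.
have u0 n x : 0 <= u n x by rewrite mulr_ge0// indicE.
have gS x : ((g x)%:E <= \sum_(n <oo) (u n x)%:E)%E.
  have [->|[n xn gn]] := gc x.
    by apply: nneseries_ge0 => n _ _; rewrite lee_fin.
  apply: (@le_trans _ _ (u n x)%:E).
    by rewrite lee_fin /u indicE mem_set ?mulr1//; exact: box_norm3.
  rewrite (@le_trans _ _ (\sum_(0 <= k < n.+1) (u k x)%:E)%E)//.
    by rewrite big_nat_recr//= leeDr// sume_ge0// => k _; rewrite lee_fin.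
  by apply: nneseries_lim_ge => k _ _; rewrite lee_fin.
apply: (@le_lt_trans _ _ (\int[mu]_x (\sum_(n <oo) (u n x)%:E))%E).
  apply: ge0_le_integral => //.
  - by move=> x _; rewrite lee_fin.
  - exact/measurable_EFinP.
  - apply: ge0_emeasurable_sum => [n x _ _|n _]; first by rewrite lee_fin.
    exact/measurable_EFinP.
rewrite integral_nneseries//; last 2 first.
- by move=> n; exact/measurable_EFinP.
- by move=> n x _; rewrite lee_fin.
apply: (@le_lt_trans _ _ (\sum_(n <oo) (K / 2 ^+ n)%:E)%E).
  apply: lee_nneseries => n *.
    by apply: integral_ge0 => x _; rewrite lee_fin.
  have mi : measurable_fun setT (\1_(box (rho n)) : R3 R -> R).
    by apply: measurable_indic; exact: measurable_box.
  rewrite (@integralZl_fin _ _ _ mu _ measurableT (c n) _ mi (c0 n)); last first.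
    by move=> x _; rewrite indicE.
  have -> : (\int[mu]_x (\1_(box (rho n)) x)%:E)%E = ((2 * rho n) ^+ 3)%:E.
    rewrite (@integral_indic _ _ _ mu _ measurableT _ (measurable_box _)) setIT.
    exact: leb3_box.
  by rewrite -EFinM lee_fin.
rewrite (_ : (fun N => \sum_(0 <= n < N) _)%E = EFin \o series (geometric K 2^-1)).
  2: by apply/funext => N; rewrite /series/= -sumEFin; apply: eq_bigr => n _;
    rewrite /geometric/= exprVn.
rewrite EFin_lim ?ltry//.
by apply: is_cvg_geometric_series; rewrite ger0_norm// invf_lt1// ltr1n.
Qed.

Lemma dyadic_shell_le1 (t : R) : 0 < t -> t <= 1 ->
  exists2 n, t <= (2 ^+ n)^-1 & (2 ^+ n.+1)^-1 < t.
Proof.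
move=> t0 t1.
have ex : exists n, (2 ^+ n.+1)^-1 < t.
  exists (Num.bound t^-1); rewrite invf_plt ?posrE ?exprn_gt0//.
  rewrite (@lt_trans _ _ (Num.bound t^-1)%:R) ?archi_boundP ?invr_ge0 ?ltW//.
  by rewrite -natrX ltr_nat (ltn_trans (ltn_expl _ (isT : (1 < 2)%N)))// ltn_exp2l.
case: (ex_minnP ex) => [[|n]] Hn Hmin; first by exists 0%N; rewrite ?expr0 ?invr1.
exists n.+1 => //; rewrite leNgt; apply/negP => /Hmin.
by rewrite ltnn.
Qed.

Lemma dyadic_shell_gt1 (t : R) : 1 < t ->
  exists2 n, t <= 2 ^+ n.+1 & 2 ^+ n < t.
Proof.
move=> t1.
have ex : exists n, t <= 2 ^+ n.+1.
  exists (Num.bound t); rewrite ltW//.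
  rewrite (@lt_trans _ _ (Num.bound t)%:R) ?archi_boundP//; last first.
    by rewrite -natrX ltr_nat (ltn_trans (ltn_expl _ (isT : (1 < 2)%N)))// ltn_exp2l.
  by rewrite ltW// (lt_trans _ t1).
case: (ex_minnP ex) => [[|n]] Hn Hmin; first by exists 0%N; rewrite ?expr0.
exists n.+1 => //; rewrite ltNge; apply/negP => /Hmin.
by rewrite ltnn.
Qed.

Lemma measurable_norm3V : measurable_fun setT (fun x => (norm3 x)^-1).
Proof.
rewrite (_ : (fun x => _) = (@powR R ^~ (-1)) \o @norm3 R); last first.
  by apply/funext => x /=; rewrite powR_inv1// sqrtr_ge0.
exact: measurableT_comp (@measurable_norm3 R).
Qed.

(* Dominates the free resolvent kernel: [r^-2] near the origin (with value [0]
   at the origin itself) and [r^-4] at infinity. *)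
Definition hprofile x : R :=
  if norm3 x <= 1 then (norm3 x)^-1 ^+ 2 else (norm3 x)^-1 ^+ 4.

Lemma measurable_hprofile : measurable_fun setT hprofile.
Proof.
apply: measurable_fun_ifT.
- by apply: measurable_fun_ler; [exact: measurable_norm3|exact: measurable_cst].
- by apply: measurable_funX; exact: measurable_norm3V.
- by apply: measurable_funX; exact: measurable_norm3V.
Qed.

Lemma hprofile_ge0 x : 0 <= hprofile x.
Proof. by rewrite /hprofile; case: ifP => _; rewrite exprn_ge0// invr_ge0 norm3_ge0. Qed.

(** Dyadic shells. Where [2^-(n+1) < |x| <= 2^-n], the value is at most [4 * 4^n] and the cube has
    volume [8 / 8^n], in total [32 / 2^n]. Where [2^n < |x| <= 2^(n+1)], the value is at most
    [16^-n] and the volume is [64 * 8^n], in total [64 / 2^n]. *)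
Lemma hprofile_integrable : (\int[mu]_x (hprofile x)%:E < +oo)%E.
Proof.
have mle : measurable_fun setT (fun x => norm3 x <= 1 : bool).
  by apply: measurable_fun_ler; [exact: measurable_norm3|exact: measurable_cst].
pose h1 x := if norm3 x <= 1 then (norm3 x)^-1 ^+ 2 else 0.
pose h2 x := if norm3 x <= 1 then 0 else (norm3 x)^-1 ^+ 4.
have m1 : measurable_fun setT h1.
  apply: measurable_fun_ifT => //; apply: measurable_funX.
  exact: measurable_norm3V.
have m2 : measurable_fun setT h2.
  apply: measurable_fun_ifT => //; apply: measurable_funX.
  exact: measurable_norm3V.
have h10 x : 0 <= h1 x by rewrite /h1; case: ifP => // _; exact: sqr_ge0.
have h20 x : 0 <= h2 x.
  by rewrite /h2; case: ifP => // _; rewrite exprn_ge0// invr_ge0 norm3_ge0.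
rewrite (eq_integral (fun x => (h1 x + h2 x)%:E)); last first.
  by move=> x _; rewrite /hprofile /h1 /h2; case: ifP; rewrite ?addr0 ?add0r.
rewrite integralD_fin// lte_add_pinfty//.
  apply: (@integral_lty_shells h1 (fun n => 4 * 4 ^+ n) (fun n => (2 ^+ n)^-1) 32
    m1 h10 (fun n => mulr_ge0 (ler0n _ 4) (exprn_ge0 n (ler0n _ 4)))
    (fun n => etrans (invr_ge0 _) (exprn_ge0 n (ler0n _ 2)))).
  - move=> x; rewrite /h1; case: ifPn => x1; last by left.
    have [->|x0] := eqVneq (norm3 x) 0; first by left; rewrite invr0 expr0n.
    have {}x0 : 0 < norm3 x by rewrite lt_def x0 norm3_ge0.
    have [n xn nx] := dyadic_shell_le1 x0 x1; right; exists n => //.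
    rewrite (_ : 4 * 4 ^+ n = (2 ^+ n.+1) ^+ 2); last first.
      by rewrite -exprS -!natrX -expnM mulnC expnM.
    rewrite ler_pXn2r ?nnegrE ?invr_ge0 ?norm3_ge0 ?exprn_ge0//.
    by rewrite invf_ple ?posrE ?exprn_gt0// ltW.
  - move=> n; have n2 : 2 ^+ n != 0 :> R by rewrite expf_neq0.
    rewrite (_ : 4 ^+ n = 2 ^+ n * 2 ^+ n); last by rewrite -exprMn; congr (_ ^+ n); ring.
    by move: (2 ^+ n) n2 => z z0; rewrite le_eqVlt; apply/orP; left; apply/eqP; field.
apply: (@integral_lty_shells h2 (fun n => (16 ^+ n)^-1) (fun n => 2 * 2 ^+ n) 64
  m2 h20 (fun n => etrans (invr_ge0 _) (exprn_ge0 n (ler0n _ 16)))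
  (fun n => mulr_ge0 (ler0n _ 2) (exprn_ge0 n (ler0n _ 2)))).
- move=> x; rewrite /h2; case: ifPn => x1; first by left.
  rewrite -ltNge in x1; have [n xn nx] := dyadic_shell_gt1 x1; right; exists n.
    by rewrite -exprS.
  rewrite (_ : 16 ^+ n = (2 ^+ n) ^+ 4); last first.
    by rewrite -!natrX -expnM mulnC expnM.
  rewrite exprVn lef_pV2 ?posrE ?exprn_gt0//; last exact: lt_trans x1.
  by rewrite ler_pXn2r ?nnegrE ?norm3_ge0 ?exprn_ge0// ltW.
- move=> n; have n2 : 2 ^+ n != 0 :> R by rewrite expf_neq0.
  rewrite (_ : 16 ^+ n = 2 ^+ n * 2 ^+ n * (2 ^+ n * 2 ^+ n)); last first.
    by rewrite -!exprMn; congr (_ ^+ n); ring.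
  by move: (2 ^+ n) n2 => z z0; rewrite le_eqVlt; apply/orP; left; apply/eqP; field.
Qed.

End RadialIntegrability.

(** * The free resolvent kernel *)

Section ResolventKernel.
Variable R : realType.
Local Notation mu := (leb3_sf R).
Local Notation C := R[i].
Variable m : R.
Hypothesis m0 : 0 < m.
Implicit Types x : R3 R.

Lemma measurable_coord3 s : measurable_fun setT (fun x : R3 R => coord3 x s).
Proof.
have m11 : measurable_fun setT (fun x : R3 R => x.1.1 : R).
  exact: (measurableT_comp measurable_fst measurable_fst).
have m12 : measurable_fun setT (fun x : R3 R => x.1.2 : R).
  exact: (measurableT_comp measurable_snd measurable_fst).
have m2 : measurable_fun setT (fun x : R3 R => x.2 : R).
  exact: measurable_snd.
by case: s => [[|[|[|//]]]] hs.
Qed.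

Lemma mx_measurable_Q : mx_measurable setT (Q m).
Proof.
have mn := @measurable_norm3 R; have mnV := @measurable_norm3V R.
apply: mx_measurableZ.
  apply: cmeasurable_real; apply: measurable_funM => //.
  apply: measurable_funM => //; apply: measurableT_comp => //.
  exact: measurable_funM.
apply: mx_measurableD; first exact: mx_measurable_cst.
apply: mx_measurableZ.
  split => /=; first exact: measurable_cst.
  by apply: measurable_funM => //; exact: measurable_funD.
apply: mx_measurable_sum => s; apply: mx_measurableZ.
  by apply: cmeasurable_real; exact: measurable_coord3.
exact: mx_measurable_cst.
Qed.

Lemma nm_alpha_dot x :
  nm (alpha_dot x) <= norm3 x * \sum_s nm (alpha R s).
Proof.
rewrite mulr_sumr (le_trans (nm_sum _ _ _))// ler_sum// => s _.
rewrite nmZr ler_wpM2r ?nm_ge0//.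
by have [] := coord_le_norm3 x; case: s => [[|[|[|//]]]] hs.
Qed.

(** The fourth power of [y / 4 <= expR (y / 4)]. Exponential decay is only used through this, as the
    source of the exponent 4 in [hprofile]. *)
Lemma expRN_le (y : R) : 0 < y -> expR (- y) <= (4 / y) ^+ 4.
Proof.
move=> y0.
have H : (y / 4) ^+ 4 <= expR y.
  rewrite [X in expR X](_ : y = 4%:R * (y / 4)); last by rewrite mulrC divfK.
  rewrite expRM_natl ler_pXn2r ?nnegrE ?expR_ge0 ?divr_ge0 ?ltW//.
  by rewrite (lt_le_trans _ (expR_ge1Dx _))// ltrDr.
have y4 : 0 < (y / 4) ^+ 4 by rewrite exprn_gt0// divr_gt0.
rewrite expRN -(invf_div y 4) exprVn lef_pV2 ?posrE//.
exact: expR_gt0.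
Qed.

(** With [u] the inverse radius, [Q] is of order [expR (- m * norm3 x) * u * (1 + u)]: for [u >= 1]
    the exponential is bounded by 1 and [u ^+ 2] remains; for [u <= 1] the exponential supplies
    [u ^+ 4] and everything else is bounded. *)
Lemma nm_Q_le : exists2 c, 0 <= c & forall x, nm (Q m x) <= c * hprofile x.
Proof.
pose s : R := Num.sqrt (pi / 2); have s0 : 0 <= s by exact: sqrtr_ge0.
pose b := nm (beta R); pose a := \sum_s nm (alpha R s).
have b0 : 0 <= b by exact: nm_ge0.
have a0 : 0 <= a by rewrite sumr_ge0// => i _; exact: nm_ge0.
pose D := s * (m * b + m * a + a).
have D0 : 0 <= D by rewrite mulr_ge0// !addr_ge0// mulr_ge0// ltW.
have mV0 : 0 <= m^-1 by rewrite invr_ge0 ltW.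
pose k := (4 / m) ^+ 4.
have k0 : 0 <= k by rewrite exprn_ge0// mulr_ge0.
have k1 : 0 <= 1 + k by rewrite addr_ge0.
exists (D * (1 + k)); first exact: mulr_ge0.
move=> x; have t0 := norm3_ge0 x.
(* At the origin the inverse of 0 is 0, so [Q] takes the value 0 there. *)
have [tz|tz] := eqVneq (norm3 x) 0.
  have -> : Q m x = 0 by rewrite /Q tz invr0 mulr0 scale0r.
  by rewrite nm0 mulr_ge0 ?hprofile_ge0// mulr_ge0.
have {}t0 : 0 < norm3 x by rewrite lt_def tz.
pose u := (norm3 x)^-1; have u0 : 0 < u by rewrite invr_gt0.
have E0 : 0 <= expR (- m * norm3 x) by exact: expR_ge0.
(* [alpha_dot x] is of order [norm3 x], which cancels one of the two inverse radii in front of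
   it. *)
have H : nm (Q m x) <= s * expR (- m * norm3 x) * u * (m * b + (m + u) * a).
  rewrite /Q nmZr ger0_norm; last by rewrite !mulr_ge0 ?(ltW u0).
  rewrite ler_wpM2l//; first by rewrite !mulr_ge0 ?(ltW u0).
  rewrite (le_trans (nmD _ _))// lerD//.
    by rewrite nmZr gtr0_norm.
  rewrite (le_trans (nmZ _ _))//.
  have -> : l1 (0 +i* ((m + (norm3 x)^-1) / norm3 x)) = (m + u) * u.
    by rewrite /l1/= normr0 add0r ger0_norm// mulr_ge0 ?addr_ge0 ?(ltW u0) ?(ltW m0).
  rewrite -mulrA ler_wpM2l//; first by rewrite addr_ge0 ?(ltW u0) ?(ltW m0).
  rewrite (le_trans (ler_wpM2l (ltW u0) (nm_alpha_dot x)))//.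
  by rewrite mulrA mulVf// mul1r.
apply: (le_trans H).
have mb : 0 <= m * b by rewrite mulr_ge0 ?(ltW m0).
have ma : 0 <= m * a by rewrite mulr_ge0 ?(ltW m0).
have G0 : 0 <= m * b + (m + u) * a.
  by rewrite addr_ge0// mulr_ge0// addr_ge0 ?(ltW u0) ?(ltW m0).
pose S := m * b + m * a + a; have S0 : 0 <= S by rewrite !addr_ge0.
rewrite /D -/S -!mulrA ler_wpM2l// /hprofile -/u; case: ifPn => t1.
  have u1 : 1 <= u by rewrite -invr1 lef_pV2 ?posrE.
  have e1 : expR (- m * norm3 x) <= 1.
    by rewrite mulNr -expR0 ler_expR oppr_le0 mulr_ge0 ?(ltW m0) ?(ltW t0).
  have PS : m * b + (m + u) * a <= u * S.
    have h1 : m * b <= u * (m * b) by rewrite ler_peMl.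
    have h2 : m * a <= u * (m * a) by rewrite ler_peMl.
    by rewrite /S !mulrDr mulrDl; lra.
  apply: (@le_trans _ _ (1 * (u * (u * S)))).
    by apply: ler_pM => //; [rewrite mulr_ge0 ?(ltW u0)|rewrite ler_pM2l].
  rewrite mul1r [leRHS](_ : _ = u * (u * S) * (1 + k)); last by ring.
  by rewrite ler_peMr ?lerDl// !mulr_ge0 ?(ltW u0).
rewrite -ltNge in t1.
have u1 : u <= 1 by rewrite invf_le1// ltW.
have mt : 0 < m * norm3 x by rewrite mulr_gt0.
have e1 : expR (- m * norm3 x) <= k * u ^+ 4.
  by rewrite /k -exprMn -mulrA -invfM mulNr; exact: expRN_le.
have PS : u * (m * b + (m + u) * a) <= S.
  apply: (@le_trans _ _ (1 * (m * b + (m + u) * a))); first by rewrite ler_wpM2r.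
  have : u * a <= 1 * a by rewrite ler_wpM2r.
  by rewrite /S mulrDl !mul1r; lra.
apply: (@le_trans _ _ ((k * u ^+ 4) * S)).
  by apply: ler_pM => //; exact: mulr_ge0 (ltW u0) G0.
have u4 : 0 <= u ^+ 4 by rewrite exprn_ge0// ltW.
by rewrite mulrC ler_wpM2l// ler_wpM2r// lerDr.
Qed.

(** The inverse radius is below its square near the origin and below 1 elsewhere. The bound splits
    [J_plus] into an integrable and a bounded part; the factor 2 is [l1_cis]. *)
Lemma l1_J_plus_le lambda x :
  l1 (J_plus m lambda x) <= 2 * Num.sqrt (pi / 2) * (hprofile x + 1).
Proof.
have s0 : 0 <= Num.sqrt (pi / 2) :> R by exact: sqrtr_ge0.
have t0 := norm3_ge0 x; have u0 : 0 <= (norm3 x)^-1 by rewrite invr_ge0.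
have uh : (norm3 x)^-1 <= hprofile x + 1.
  rewrite /hprofile; case: ifPn => t1; last first.
    rewrite -ltNge in t1; rewrite (@le_trans _ _ 1)//.
      by rewrite invf_le1 ?ltW// (lt_trans _ t1).
    by rewrite lerDr exprn_ge0.
  have [tz|tz] := eqVneq (norm3 x) 0.
    by rewrite tz invr0 addr_ge0// sqr_ge0.
  have u1 : 1 <= (norm3 x)^-1.
    by rewrite -[leLHS]invr1 lef_pV2 ?posrE// lt_def tz.
  by rewrite expr2 (@le_trans _ _ ((norm3 x)^-1 * (norm3 x)^-1)) ?lerDl// ler_peMl.
rewrite /J_plus l1_realM ger0_norm; last by rewrite mulr_ge0.
rewrite [2 * _]mulrC -!mulrA ler_wpM2l// mulrC.
by rewrite ler_pM// ?l1_ge0// l1_cis.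
Qed.

Lemma mx_measurable_J lambda : cmeasurable setT (J_plus (R := R) m lambda).
Proof.
have mn := @measurable_norm3 R; have mnV := @measurable_norm3V R.
apply: cmeasurableM.
  by apply: cmeasurable_real; exact: measurable_funM.
apply: cmeasurable_cis; case: (0 < lambda); first exact: measurable_funM.
by apply: measurableT_comp => //; exact: measurable_funM.
Qed.

Let mconvF lambda : mx_measurable setT (fun z : R3 R * R3 R =>
  J_plus m lambda z.2 *: Q m (sub3 z.1 z.2)).
Proof.
apply: mx_measurableZ.
  have [m1 m2] := mx_measurable_J lambda.
  by split; [exact: (measurableT_comp m1 measurable_snd)|
             exact: (measurableT_comp m2 measurable_snd)].
exact: (mx_measurable_comp mx_measurable_Q (@measurable_sub3 R)).
Qed.

Let conv lambda x :=
  mx_integral mu setT (fun v => J_plus m lambda v *: Q m (sub3 x v)).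

Lemma mx_measurable_B lambda : mx_measurable setT (B_kernel m lambda).
Proof.
apply: mx_measurableD; last first.
  apply: mx_measurableZ; last exact: mx_measurable_cst.
  by apply: cmeasurableM; [exact: cmeasurable_cst|exact: mx_measurable_J].
apply: mx_measurableD; first exact: mx_measurable_Q.
apply: mx_measurableZc.
exact: (@mx_measurable_integral _ _ _ _ _ mu _ _
  (fun r v => J_plus m lambda v *: Q m (sub3 r v)) (mconvF lambda)).
Qed.

(** The convolution of [hprofile] with itself. Each factor has an [r^-2] singularity and no
    pointwise bound on [G] is derived, only the finiteness of its integral. *)
Let G x : \bar R := (\int[mu]_v (hprofile (sub3 x v) * hprofile v)%:E)%E.

Let mG : measurable_fun setT G.
Proof.
apply: (@measurable_fun_fubini_tonelli_F _ _ _ _ _ mu (fun z : R3 R * R3 R =>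
  (hprofile (sub3 z.1 z.2) * hprofile z.2)%:E)) => [|z].
  apply/measurable_EFinP; apply: measurable_funM.
    exact: (measurable_conv_kernel (@measurable_hprofile R)).
  exact: (measurableT_comp (@measurable_hprofile R) measurable_snd).
by rewrite lee_fin mulr_ge0// hprofile_ge0.
Qed.

Let G0 x : (0 <= G x)%E.
Proof.
by apply: integral_ge0 => v _; rewrite lee_fin mulr_ge0// hprofile_ge0.
Qed.

Let G_fin : (\int[mu]_x G x < +oo)%E.
Proof.
have H0 : (0 <= \int[mu]_x (hprofile x)%:E)%E.
  by apply: integral_ge0 => x _; rewrite lee_fin hprofile_ge0.
have H := integral_conv (@measurable_hprofile R) (@measurable_hprofile R)
  (@hprofile_ge0 R) (@hprofile_ge0 R).
apply: (@le_lt_trans _ _ (\int[mu]_x (hprofile x)%:E *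
  \int[mu]_x (hprofile x)%:E)%E); first by rewrite -H.
by rewrite lte_mul_pinfty ?ge0_fin_numE// hprofile_integrable.
Qed.

(** [J_plus] is at most a multiple of [hprofile + 1]: the first summand contributes [G], and the
    second the total integral of [hprofile], which is a constant by translation invariance. *)
Let conv_le lambda : exists a b : R, [/\ 0 <= a, 0 <= b & forall x,
  ((nm (conv lambda x))%:E <= a%:E * G x + b%:E)%E].
Proof.
have [c c0 Qc] := nm_Q_le.
pose s : R := 2 * Num.sqrt (pi / 2).
have s0 : 0 <= s by rewrite mulr_ge0// sqrtr_ge0.
have mh := @measurable_hprofile R; have h0 := @hprofile_ge0 R.
pose I := fine (\int[mu]_x (hprofile x)%:E).
have If : (\int[mu]_x (hprofile x)%:E)%E \is a fin_num.
  rewrite ge0_fin_numE; first exact: hprofile_integrable.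
  by apply: integral_ge0 => x _; rewrite lee_fin.
have I0 : 0 <= I by rewrite fine_ge0// integral_ge0// => x _; rewrite lee_fin.
exists (s * c), (s * c * I); split; rewrite ?mulr_ge0// => x.
pose F v := J_plus m lambda v *: Q m (sub3 x v).
have mF : mx_measurable setT F.
  exact: (@mx_measurable_section _ _ _ _ _ _ _
    (fun r v => J_plus m lambda v *: Q m (sub3 r v)) x (mconvF lambda)).
have mhx : measurable_fun setT (fun v => hprofile (sub3 x v)).
  exact: (measurableT_comp mh (measurable_sub3r x)).
have mhh : measurable_fun setT (fun v => hprofile (sub3 x v) * hprofile v).
  exact: measurable_funM.
have sc0 : 0 <= s * c by rewrite mulr_ge0.
have H : (\int[mu]_v (nm (F v))%:E <= (s * c)%:E * G x + (s * c * I)%:E)%E.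
  apply: (@le_trans _ _ (\int[mu]_v (s * c *
      (hprofile (sub3 x v) * hprofile v + hprofile (sub3 x v)))%:E)%E).
    apply: le_integral_fin => //.
    - exact: measurable_nm.
    - by apply: measurable_funM => //; exact: measurable_funD.
    - by move=> v _; exact: nm_ge0.
    - move=> v _; rewrite (le_trans (nmZ _ _))//.
      rewrite (le_trans (ler_pM (l1_ge0 _) (nm_ge0 _) (l1_J_plus_le lambda v)
        (Qc (sub3 x v))))//.
      by rewrite -/s le_eqVlt; apply/orP; left; apply/eqP; ring.
  rewrite integralZl_fin//; last 2 first.
  - exact: measurable_funD.
  - by move=> v _; rewrite addr_ge0// mulr_ge0.
  rewrite integralD_fin//; last by move=> v _; rewrite mulr_ge0.
  rewrite ge0_muleDr//; last 2 first.
  - exact: G0.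
  - by apply: integral_ge0 => v _; rewrite lee_fin.
  rewrite leeD2l// [(s * c * I)%:E]EFinM /I fineK// lee_wpmul2l ?lee_fin//.
  have E := @ge0_integral_sub3r R x (EFin \o @hprofile R).
  have {}E := E (proj2 (measurable_EFinP _ _) mh) (fun x => h0 x).
  by rewrite le_eqVlt; apply/orP; left; apply/eqP; exact: E.
(* If the integrand has infinite norm integral, then [H] makes the right-hand side infinite, and the
   default value of [mx_integral] satisfies the bound trivially. *)
have [Foo|Foo] := ltP (\int[mu]_v (nm (F v))%:E)%E +oo%E.
  by apply: le_trans H; apply: nm_mx_integral.
by apply: le_trans H; rewrite (le_trans _ Foo)// leey.
Qed.

(** The kernel is bounded by [A1 * hprofile + A2 * G + B0]. At points where its norm exceeds
    [2 * B0] the constant accounts for at most half of it, so there the norm is at most twice the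
    integrable part. *)
Lemma B_kernel_split lambda : exists C0 : R,
  (\int[mu]_x (if (nm (B_kernel m lambda x) <= C0)%R then 0%R else
     nm (B_kernel m lambda x))%:E < +oo)%E.
Proof.
have [c c0 Qc] := nm_Q_le; have [a [b [a0 b0 Hc]]] := conv_le lambda.
pose s : R := 2 * Num.sqrt (pi / 2).
have s0 : 0 <= s by rewrite mulr_ge0// sqrtr_ge0.
have mh := @measurable_hprofile R; have h0 := @hprofile_ge0 R.
pose L := `|c32 R * lambda ^+ 2|; have L0 : 0 <= L by exact: normr_ge0.
pose n1 := nm (1%:M : 'M[C]_4); have n10 : 0 <= n1 by exact: nm_ge0.
pose A1 := c + `|lambda| * s * n1; pose A2 := L * a.
pose B0 := L * b + `|lambda| * s * n1.
have A10 : 0 <= A1 by rewrite addr_ge0// !mulr_ge0.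
have A20 : 0 <= A2 by rewrite mulr_ge0.
have B00 : 0 <= B0 by rewrite addr_ge0 ?mulr_ge0.
have BE x : ((nm (B_kernel m lambda x))%:E <=
    (A1 * hprofile x)%:E + A2%:E * G x + B0%:E)%E.
  have H1 : nm (B_kernel m lambda x) <= c * hprofile x + L * nm (conv lambda x) +
      `|lambda| * (s * (hprofile x + 1)) * n1.
    rewrite (le_trans (nmD _ _))// lerD//.
      by rewrite (le_trans (nmD _ _))// lerD// nmZr.
    rewrite (le_trans (nmZ _ _))// ler_wpM2r// l1_realM ler_wpM2l//.
    exact: l1_J_plus_le.
  apply: (@le_trans _ _ ((c * hprofile x)%:E + L%:E * (a%:E * G x + b%:E) +
      (`|lambda| * (s * (hprofile x + 1)) * n1)%:E)%E).
    rewrite (le_trans (_ : _ <= (c * hprofile x + L * nm (conv lambda x) +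
      `|lambda| * (s * (hprofile x + 1)) * n1)%:E)%E) ?lee_fin//.
    rewrite 2!EFinD leeD2r// leeD2l// EFinM lee_wpmul2l ?lee_fin//.
  rewrite ge0_muleDr ?mule_ge0// muleA -!EFinM -/A2.
  rewrite [X in (_ <= X + _ + _)%E](_ : _ = (c * hprofile x)%:E +
      (`|lambda| * s * n1 * hprofile x)%:E)%E; last first.
    by rewrite -EFinD mulrDl.
  rewrite /B0 EFinD.
  rewrite [X in (_ + X <= _)%E](_ : _ = (`|lambda| * s * n1 * hprofile x)%:E +
     (`|lambda| * s * n1)%:E)%E; last by rewrite -EFinD; congr EFin; ring.
  rewrite le_eqVlt; apply/orP; left; apply/eqP.
  rewrite -!addeA; congr (_ + _)%E.
  by rewrite [RHS]addeCA; congr (_ + _)%E; rewrite addeCA.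
exists (2 * B0).
have mB := mx_measurable_B lambda.
apply: (@le_lt_trans _ _ (\int[mu]_x (2%:E *
   ((A1 * hprofile x)%:E + A2%:E * G x)))%E).
  apply: ge0_le_integral => //.
  - by move=> x _; rewrite lee_fin; case: ifP => // _; exact: nm_ge0.
  - apply/measurable_EFinP; apply: measurable_fun_ifT.
    + by apply: measurable_fun_ler; [exact: measurable_nm|exact: measurable_cst].
    + exact: measurable_cst.
    + exact: measurable_nm.
  - apply: measurable_funeM; apply: emeasurable_funD.
      by apply/measurable_EFinP; exact: measurable_funM.
    exact: measurable_funeM.
  - move=> x _; case: ifPn => H.
      by rewrite mule_ge0// adde_ge0 ?mule_ge0// lee_fin mulr_ge0.
    rewrite -ltNge in H; have := BE x; have := G0 x.
    (* [G x] can be infinite; the estimate is then trivial unless [A2] is 0, when the term drops out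
       because 0 times infinity is 0. *)
    case: (G x) => [g||]//; last first.
      have [->|A2n] := eqVneq A2 0.
        rewrite !mul0e !adde0 -EFinD => _; rewrite lee_fin => H'.
        by rewrite -EFinM lee_fin; lra.
      have A2p : 0 < A2 by rewrite lt_def A2n.
      by rewrite gt0_muley ?lte_fin// addey// gt0_muley ?lte_fin// leey.
    rewrite -!EFinM -!EFinD => _; rewrite lee_fin => H'.
    by rewrite lee_fin; lra.
rewrite ge0_integralZl//; last 2 first.
- apply: emeasurable_funD; last exact: measurable_funeM.
  by apply/measurable_EFinP; exact: measurable_funM.
- by move=> x _; rewrite adde_ge0 ?mule_ge0// lee_fin mulr_ge0.
rewrite ge0_integralD//; last 4 first.
- by move=> x _; rewrite lee_fin mulr_ge0.
- by apply/measurable_EFinP; exact: measurable_funM.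
- by move=> x _; rewrite mule_ge0.
- exact: measurable_funeM.
rewrite integralZl_fin// ge0_integralZl//.
have h1 := @hprofile_integrable R.
have h2 : (0 <= \int[mu]_x (hprofile x)%:E)%E.
  by apply: integral_ge0 => x _; rewrite lee_fin.
have h3 : (0 <= \int[mu]_x G x)%E by exact: integral_ge0.
rewrite lte_mul_pinfty ?adde_ge0 ?mule_ge0//.
by rewrite lte_add_pinfty// lte_mul_pinfty.
Qed.

End ResolventKernel.

Lemma cRe_realM (R : realType) (a : R) (z : R[i]) :
  complex.Re (a%:C * z) = a * complex.Re z.
Proof. by case: z => x y; rewrite -[LHS]/(a * x - 0 * y) mul0r subr0. Qed.

Lemma cIm_realM (R : realType) (a : R) (z : R[i]) :
  complex.Im (a%:C * z) = a * complex.Im z.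
Proof. by case: z => x y; rewrite -[LHS]/(a * y + 0 * x) mul0r addr0. Qed.

Lemma cvg_ord_sum (R : realType) n (F : 'I_n -> nat -> R) (l : 'I_n -> R) :
  (forall i, F i @ \oo --> l i) ->
  (fun k => \sum_i F i k) @ \oo --> \sum_i l i.
Proof.
elim: n F l => [|n ih] F l Fl.
  by under eq_fun do rewrite big_ord0; rewrite big_ord0; exact: cvg_cst.
under eq_fun do rewrite big_ord_recl; rewrite big_ord_recl.
by apply: cvgD => //; exact: ih.
Qed.

(** * Functional calculus of the potential *)

Section HermitianCalculus.
Context dd (X : measurableType dd) (R : realType).
Local Notation C := R[i].
Variables (V U : X -> 'M[C]_4) (d : X -> 'rV[R]_4).
Hypothesis Uu : forall r, U r \is unitarymx.
Hypothesis VE : forall r,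
  V r = U r *m diag_mx (map_mx (real_complex R) (d r)) *m (U r)^t*.
Hypothesis mV : mx_measurable setT V.

Definition herm_calc (f : R -> R) (r : X) : 'M[C]_4 :=
  U r *m diag_mx (map_mx (fun x : R => (f x)%:C) (d r)) *m (U r)^t*.

Lemma herm_calcE f r i j : herm_calc f r i j =
  \sum_k (f (d r 0 k))%:C * (U r i k * (U r j k)^*)%R.
Proof.
rewrite /herm_calc mul_mx_diag mxE; apply: eq_bigr => k _.
by rewrite !mxE mulrAC mulrC.
Qed.

Lemma unitary_mulVmx r : (U r)^t* *m U r = 1%:M.
Proof. by apply: mulmx1C; apply/unitarymxP. Qed.

Lemma unitary_mulmxV r : U r *m (U r)^t* = 1%:M.
Proof. exact/unitarymxP. Qed.

Lemma herm_calcD f g r :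
  herm_calc (fun x => f x + g x) r = herm_calc f r + herm_calc g r.
Proof.
apply/matrixP => i j; rewrite herm_calcE [RHS]mxE !herm_calcE -big_split; apply: eq_bigr => k _.
by rewrite rmorphD mulrDl.
Qed.

Lemma herm_calcM f g r :
  herm_calc (fun x => f x * g x) r = herm_calc f r *m herm_calc g r.
Proof.
rewrite /herm_calc !mulmxA -(mulmxA _ ((U r)^t*) (U r)) unitary_mulVmx mulmx1.
rewrite -(mulmxA (U r) (diag_mx _) (diag_mx _)); congr (_ *m _ *m _).
rewrite mulmx_diag; congr diag_mx; apply/rowP => k; rewrite !mxE.
by rewrite rmorphM.
Qed.

Lemma herm_calc_cst c r : herm_calc (fun=> c) r = (c%:C)%:M.
Proof.
rewrite /herm_calc (_ : diag_mx _ = (c%:C)%:M).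
  by rewrite mul_mx_scalar -scalemxAl unitary_mulmxV scalemx1.
by apply/matrixP => i j; rewrite !mxE.
Qed.

Lemma herm_calc_id r : herm_calc id r = V r.
Proof. by rewrite VE. Qed.

Lemma eq_herm_calc f g r :
  (forall k, f (d r 0 k) = g (d r 0 k)) -> herm_calc f r = herm_calc g r.
Proof.
move=> fg; apply/matrixP => i j; rewrite !herm_calcE; apply: eq_bigr => k _.
by rewrite fg.
Qed.

(** Measurability of [f(V)]. The class of such [f] contains constants and the identity, and is
    closed under sums, products and limits at the eigenvalues; the square root and the sign are
    reached from there by polynomial iterations. *)
Let good f := mx_measurable setT (herm_calc f).

Let goodD f g : good f -> good g -> good (fun x => f x + g x).
Proof.
move=> gf gg; rewrite /good.
rewrite (_ : herm_calc _ = fun r => herm_calc f r + herm_calc g r).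
  exact: (mx_measurableD gf gg).
by apply/funext => r; exact: herm_calcD.
Qed.

Let goodM f g : good f -> good g -> good (fun x => f x * g x).
Proof.
move=> gf gg; rewrite /good.
rewrite (_ : herm_calc _ = fun r => herm_calc f r *m herm_calc g r).
  exact: (mx_measurableM gf gg).
by apply/funext => r; exact: herm_calcM.
Qed.

Let good_cst c : good (fun=> c).
Proof.
rewrite /good (_ : herm_calc _ = fun r => (c%:C)%:M).
  exact: mx_measurable_cst.
by apply/funext => r; exact: herm_calc_cst.
Qed.

Let good_id : good id.
Proof.
rewrite /good (_ : herm_calc _ = V)//.
by apply/funext => r; exact: herm_calc_id.
Qed.

(** Each entry of [herm_calc f r] is a combination of the values of [f] at the eigenvalues with
    coefficients independent of [f], so convergence at the eigenvalues gives pointwise convergence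
    of the entries. *)
Let good_lim (f_ : nat -> R -> R) f : (forall n, good (f_ n)) ->
  (forall r k, (fun n => f_ n (d r 0 k)) @ \oo --> f (d r 0 k)) -> good f.
Proof.
move=> gf cf i j.
have E g r : complex.Re (herm_calc g r i j) =
    \sum_k g (d r 0 k) * complex.Re (U r i k * (U r j k)^*)%R.
  by rewrite herm_calcE cRe_sum; apply: eq_bigr => k _; exact: cRe_realM.
have E' g r : complex.Im (herm_calc g r i j) =
    \sum_k g (d r 0 k) * complex.Im (U r i k * (U r j k)^*)%R.
  by rewrite herm_calcE cIm_sum; apply: eq_bigr => k _; exact: cIm_realM.
split.
  apply: (measurable_fun_cvg (h := fun n r => complex.Re (herm_calc (f_ n) r i j))).
    by move=> n; have [] := gf n i j.
  move=> r _; rewrite E; under eq_fun do rewrite E.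
  by apply: cvg_ord_sum => k; apply: cvgMl; exact: cf.
apply: (measurable_fun_cvg (h := fun n r => complex.Im (herm_calc (f_ n) r i j))).
  by move=> n; have [] := gf n i j.
move=> r _; rewrite E'; under eq_fun do rewrite E'.
by apply: cvg_ord_sum => k; apply: cvgMl; exact: cf.
Qed.

(* Newton-type iteration: polynomials in [y] that increase to [sqrt y]. *)
Fixpoint sqrt_iter (n : nat) (y : R) : R :=
  if n is n'.+1 then sqrt_iter n' y + 2^-1 * (y + -1 * (sqrt_iter n' y * sqrt_iter n' y))
  else 0.

(** With [a] the root and [s] the current iterate, one step multiplies the error by
    [1 - (a + s) / 2], which lies between 0 and [1 - a / 2]. For [a = 0] the error bound is
    identically 0, so this case is separated before the geometric limit. *)
Lemma cvg_sqrt_iter y : 0 <= y <= 1 ->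
  (fun n => sqrt_iter n y) @ \oo --> Num.sqrt y.
Proof.
move=> /andP[y0 y1]; set a := Num.sqrt y.
have a0 : 0 <= a by exact: sqrtr_ge0.
have a1 : a <= 1 by rewrite -sqrtr1 ler_sqrt.
have ya : y = a * a by rewrite -expr2 sqr_sqrtr.
have H n : 0 <= sqrt_iter n y <= a /\ a - sqrt_iter n y <= a * (1 - a / 2) ^+ n.
  elim: n => [|n [/andP[s0 sa] ih]] /=.
    by rewrite lexx a0 expr0 mulr1 subr0.
  set s := sqrt_iter n y in s0 sa ih *.
  have E : a - (s + 2^-1 * (y + -1 * (s * s))) = (a - s) * (1 - (a + s) / 2).
    by rewrite ya; field.
  have t0 : 0 <= (a - s) * (1 - (a + s) / 2) by apply: mulr_ge0; lra.
  have t1 : (a - s) * (1 - (a + s) / 2) <= (a - s) * (1 - a / 2).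
    by apply: ler_wpM2l; lra.
  have t2 : (a - s) * (1 - a / 2) <= a * (1 - a / 2) ^+ n * (1 - a / 2).
    by apply: ler_wpM2r => //; lra.
  split; last by rewrite E exprSr mulrA; exact: le_trans t2.
  apply/andP; split; last by rewrite -subr_ge0 E.
  have : s * s <= a * a by exact: ler_pM.
  by rewrite ya; lra.
have cv : (fun n => a * (1 - a / 2) ^+ n) @ \oo --> 0.
  have [->|an] := eqVneq a 0.
    by under eq_fun do rewrite mul0r; exact: cvg_cst.
  have ap : 0 < a by rewrite lt_def an.
  rewrite -[X in _ --> X](mulr0 a); apply: cvgMr; apply: (@cvg_expr R).
  by rewrite ger0_norm; lra.
apply/cvgrPdist_le => e e0.
move/cvgrPdist_le : cv => /(_ e e0); apply: filterS => n.
rewrite sub0r normrN => Hn; have [/andP[_ sa] H2] := H n.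
rewrite ger0_norm ?subr_ge0// (le_trans H2)// (le_trans _ Hn)//.
exact: ler_norm.
Qed.

Let good_sqrt f : good f -> (forall r k, 0 <= f (d r 0 k) <= 1) ->
  good (fun x => Num.sqrt (f x)).
Proof.
move=> gf f01; apply: (@good_lim (fun n x => sqrt_iter n (f x))).
  elim=> [|n ih]; first exact: good_cst.
  exact: (goodD ih (goodM (good_cst _)
    (goodD gf (goodM (good_cst _) (goodM ih ih))))).
by move=> r k; exact: cvg_sqrt_iter.
Qed.

Variable K : R.
Hypotheses (K0 : 0 < K) (dK : forall r k, `|d r 0 k| <= K).

Let good_scale f (c : R) : good f -> good (fun x => c * f x).
Proof. by move=> gf; exact: (goodM (good_cst c) gf). Qed.

Let abs01 r k : 0 <= `|K^-1 * d r 0 k| <= 1.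
Proof.
rewrite normr_ge0/= normrM gtr0_norm ?invr_gt0// mulrC ler_pdivrMr// mul1r.
exact: dK.
Qed.

(** Absolute value as the square root of a square; division by [K] brings the eigenvalues into the
    range where [sqrt_iter] converges. *)
Let good_abs : good (fun x => `|K^-1 * x|).
Proof.
rewrite (_ : (fun x => _) =
    (fun x => Num.sqrt ((K^-1 * x) * (K^-1 * x)))); last first.
  by apply/funext => x; rewrite -expr2 sqrtr_sqr.
apply: good_sqrt; first exact: (goodM (good_scale _ good_id) (good_scale _ good_id)).
move=> r k; rewrite -expr2 sqr_ge0/= -[leLHS]real_normK ?num_real//.
by have /andP[h0 h1] := abs01 r k; rewrite expr_le1.
Qed.

Lemma mx_measurable_sqrt_abs : mx_measurable setT (fun r => sqrt_abs (U r) (d r)).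
Proof.
have : good (fun x => Num.sqrt K * Num.sqrt `|K^-1 * x|).
  exact: (good_scale _ (good_sqrt good_abs abs01)).
rewrite /good (_ : herm_calc _ = fun r => sqrt_abs (U r) (d r))//.
apply/funext => r; rewrite -[RHS]/(herm_calc (fun x => Num.sqrt `|x|) r).
apply: eq_herm_calc => k; rewrite -sqrtrM ?ltW// normrM gtr0_norm ?invr_gt0//.
by rewrite mulrA divff ?mul1r// gt_eqF.
Qed.

(** Partial sums of a geometric series with first term [K^-1 * x] and ratio [1 - |K^-1 * x|]. Since
    [K^-1 * x] is [Num.sg x] times its absolute value, the sum tends to the sign, and stays 0 at
    [x = 0]. *)
Fixpoint sgn_iter (n : nat) (x : R) : R :=
  if n is n'.+1 then sgn_iter n' x * (1 + -1 * `|K^-1 * x|) + K^-1 * x else 0.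

Lemma sgn_iterE n x : sgn_iter n x = Num.sg x * (1 - (1 - `|K^-1 * x|) ^+ n).
Proof.
have E : K^-1 * x = Num.sg x * `|K^-1 * x|.
  rewrite normrM gtr0_norm ?invr_gt0// mulrCA; congr (_ * _).
  exact: numEsg.
elim: n => [|n ih] /=; first by rewrite expr0 subrr mulr0.
by rewrite ih [X in _ + X = _]E exprSr; ring.
Qed.

Lemma mx_measurable_sign_mx : mx_measurable setT (fun r => sign_mx (U r) (d r)).
Proof.
apply: (@good_lim sgn_iter).
  elim=> [|n ih]; first exact: good_cst.
  exact: (goodD (goodM ih (goodD (good_cst _) (good_scale (-1) good_abs)))
    (good_scale _ good_id)).
move=> r k; under eq_fun do rewrite sgn_iterE.
have [->|dn] := eqVneq (d r 0 k) 0.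
  by rewrite sgr0; under eq_fun do rewrite mul0r; exact: cvg_cst.
have cv : (fun n => (1 - `|K^-1 * d r 0 k|) ^+ n) @ \oo --> 0.
  apply: (@cvg_expr R); have /andP[h0 h1] := abs01 r k.
  have : 0 < `|K^-1 * d r 0 k|.
    by rewrite normr_gt0 mulf_neq0// invr_neq0// gt_eqF.
  by move=> h; rewrite ger0_norm; lra.
have cv1 : (fun n => 1 - (1 - `|K^-1 * d r 0 k|) ^+ n) @ \oo --> (1 - 0 : R).
  by apply: cvgB => //; exact: cvg_cst.
have : (fun n => Num.sg (d r 0 k) * (1 - (1 - `|K^-1 * d r 0 k|) ^+ n)) @ \oo -->
    (Num.sg (d r 0 k) * (1 - 0) : R) by apply: cvgMr.
by rewrite subr0 mulr1.
Qed.

(** Rows of a unitary matrix have norm 1, so its entries have [l1] at most 2; each of the 16 entries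
    of [herm_calc] is then at most 4 times the sum, whence 64. *)
Lemma nm_herm_calc f r : nm (herm_calc f r) <= 64 * \sum_k `|f (d r 0 k)|.
Proof.
have lU i k : l1 (U r i k) <= 2.
  have : (U r *m (U r)^t*) i i = 1 by rewrite unitary_mulmxV mxE eqxx.
  rewrite mxE => /(congr1 (fun z : C => complex.Re z)); rewrite cRe_sum/= => H.
  have P k' : complex.Re (U r i k' * (U r)^t* k' i) =
      complex.Re (U r i k') ^+ 2 + complex.Im (U r i k') ^+ 2.
    by rewrite !mxE cReM cReJ cImJ mulrN opprK !expr2.
  have S0 k' : 0 <= complex.Re (U r i k') ^+ 2 + complex.Im (U r i k') ^+ 2.
    by rewrite addr_ge0// sqr_ge0.
  have H1 : complex.Re (U r i k) ^+ 2 + complex.Im (U r i k) ^+ 2 <= 1.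
    rewrite -H (bigD1 k)//= P lerDl sumr_ge0// => k' _.
    by rewrite P.
  have := l1_sqr_ge (U r i k) => H2.
  have : l1 (U r i k) ^+ 2 <= 2 ^+ 2 by rewrite (le_trans H2)//; lra.
  by rewrite ler_pXn2r ?nnegrE ?l1_ge0.
have E i j : l1 (herm_calc f r i j) <= 4 * \sum_k `|f (d r 0 k)|.
  rewrite herm_calcE (le_trans (l1_sum _ _ _))// mulr_sumr ler_sum// => k _.
  rewrite l1_realM mulrC ler_wpM2r// (le_trans (l1M _ _))// l1J.
  rewrite (_ : 4 = 2 * 2); last by ring.
  by rewrite ler_pM ?l1_ge0.
rewrite /nm (@le_trans _ _ (\sum_(i < 4) \sum_(j < 4) (4 * \sum_k `|f (d r 0 k)|)))//.
  by rewrite ler_sum// => i _; rewrite ler_sum.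
rewrite !sumr_const !card_ord -mulrnA -[leLHS]mulr_natl mulrA.
by rewrite ler_wpM2r ?sumr_ge0// -natrM ler_nat.
Qed.

(** The [k]-th column of [U r] is a unit eigenvector for [d r 0 k], hence a competitor in the
    supremum. *)
Lemma eigenvalue_le_opnorm r k : `|d r 0 k| <= opnorm (V r).
Proof.
pose v : 'cV[C]_4 := U r *m delta_mx k 0.
have vE i : v i 0 = U r i k.
  rewrite /v mxE (bigD1 k)//= mxE !eqxx mulr1 big1 ?addr0// => j jk.
  by rewrite mxE (negbTE jk) mulr0.
have v1 : vnormsq v = 1.
  have : ((U r)^t* *m U r) k k = 1 by rewrite unitary_mulVmx mxE eqxx.
  rewrite mxE => /(congr1 (fun z : C => complex.Re z)); rewrite cRe_sum/= => H.
  rewrite /vnormsq -[RHS]H; apply: eq_bigr => i _; rewrite vE !mxE.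
  by rewrite cReM cReJ cImJ mulNr opprK !expr2.
have Vv : V r *m v = (d r 0 k)%:C *: v.
  rewrite VE /v -!mulmxA (mulmxA _ (U r)) unitary_mulVmx mul1mx scalemxAr.
  congr (_ *m _); apply/matrixP => i j; rewrite mul_diag_mx !mxE ord1 eqxx andbT.
  by have [->|] := eqVneq i k; rewrite ?mulr0.
have e : Num.sqrt (vnormsq (V r *m v)) = `|d r 0 k|.
  rewrite Vv (_ : vnormsq _ = (d r 0 k) ^+ 2 * vnormsq v).
    by rewrite v1 mulr1 sqrtr_sqr.
  rewrite /vnormsq mulr_sumr; apply: eq_bigr => i _; rewrite mxE.
  by rewrite cRe_realM cIm_realM !exprMn mulrDr.
rewrite -e /opnorm; apply: ub_le_sup; last by exists v.
(* [sup] is meaningful only for a bounded set; the factor 8 is the [2 * n] of [nm_le_vnormsq] with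
   [n = 4]. *)
exists (Num.sqrt ((nm (V r) ^+ 2) * 8)) => _ [w /= w1 <-].
rewrite ler_sqrt; last by rewrite mulr_ge0// sqr_ge0.
rewrite (le_trans (vnormsq_le_nm _))//.
apply: (@le_trans _ _ ((nm (V r) * nm w) ^+ 2)).
  by rewrite ler_pXn2r ?nnegrE ?mulr_ge0 ?nm_ge0// nmM.
rewrite exprMn ler_wpM2l ?sqr_ge0//.
by have := nm_le_vnormsq w; rewrite w1 mulr1.
Qed.

Lemma opnorm_ge0 r : 0 <= opnorm (V r).
Proof. exact: le_trans (normr_ge0 _) (eigenvalue_le_opnorm r 0). Qed.

(** The eigenvalues of [V1] are square roots of those of [|V|]. Thus boundedness of the potential
    makes [V1] bounded, and its integrability puts [V1] in L^2; the 4 counts the eigenvalues. *)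
Lemma nm_sqrt_abs_sqr r :
  nm (sqrt_abs (U r) (d r)) ^+ 2 <= (64 * 4) ^+ 2 * opnorm (V r).
Proof.
have o0 := opnorm_ge0 r.
have H : nm (sqrt_abs (U r) (d r)) <= 64 * 4 * Num.sqrt (opnorm (V r)).
  rewrite (le_trans (nm_herm_calc (fun x => Num.sqrt `|x|) r))//.
  rewrite (@le_trans _ _ (64 * \sum_(k < 4) Num.sqrt (opnorm (V r))))//.
    rewrite ler_wpM2l// ler_sum// => k _.
    by rewrite ger0_norm ?sqrtr_ge0// ler_sqrt// eigenvalue_le_opnorm.
  by rewrite sumr_const card_ord -[X in 64 * X]mulr_natl mulrA.
have s0 : 0 <= Num.sqrt (opnorm (V r)) by exact: sqrtr_ge0.
apply: (@le_trans _ _ ((64 * 4 * Num.sqrt (opnorm (V r))) ^+ 2)).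
  by rewrite ler_pXn2r ?nnegrE ?nm_ge0// mulr_ge0// mulr_ge0.
by rewrite exprMn sqr_sqrtr.
Qed.

Lemma nm_sign_mx r : nm (sign_mx (U r) (d r)) <= 64 * 4.
Proof.
rewrite (le_trans (nm_herm_calc (@Num.sg R) r))//.
rewrite ler_wpM2l// (@le_trans _ _ (\sum_(k < 4) 1))//.
  rewrite ler_sum// => k _.
  by case: sgrP => _; rewrite ?normr0 ?normrN ?normr1.
by rewrite sumr_const card_ord.
Qed.

Lemma sqrt_abs_sign_sqrt_abs r :
  sqrt_abs (U r) (d r) *m sign_mx (U r) (d r) *m sqrt_abs (U r) (d r) = V r.
Proof.
rewrite -[sqrt_abs _ _]/(herm_calc (fun x => Num.sqrt `|x|) r).
rewrite -[sign_mx _ _]/(herm_calc (@Num.sg R) r) -!herm_calcM -[RHS]herm_calc_id.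
apply: eq_herm_calc => k; rewrite mulrAC -expr2 sqr_sqrtr// mulrC.
by rewrite -numEsg.
Qed.

End HermitianCalculus.

(** * Comparison of the two forms of L^2, products and columns *)

Section L2Defs.
Context d (T : measurableType d) (R : realType).
Variables (mu : {measure set T -> \bar R}) (n : nat).
Local Notation C := R[i].

Lemma l2_is_l2 (f : T -> 'cV[C]_n) : L2 mu setT f <-> is_l2 mu f.
Proof.
split=> -[mf foo]; split => //.
  apply: (@le_lt_trans _ _ ((2 * n)%:R%:E * L2normsq mu setT f)%E); last first.
    by rewrite lte_mul_pinfty.
  rewrite -integralZl_fin//; last 2 first.
  - exact: measurable_vnormsq.
  - by move=> x _; exact: vnormsq_ge0.
  apply: le_integral_fin => //.
  - exact: measurable_nm_sqr.
  - by apply: measurable_funM => //; exact: measurable_vnormsq.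
  - by move=> x _; exact: sqr_ge0.
  - by move=> x _; exact: nm_le_vnormsq.
apply: le_lt_trans foo; apply: le_integral_fin => //.
- exact: measurable_vnormsq.
- exact: measurable_nm_sqr.
- by move=> x _; exact: vnormsq_ge0.
- by move=> x _; exact: vnormsq_le_nm.
Qed.

Lemma mx_integrable_l2M p q (F : T -> 'M[C]_(p, n)) (G : T -> 'M[C]_(n, q)) :
  is_l2 mu F -> is_l2 mu G -> mx_integrable mu setT (fun x => F x *m G x).
Proof.
move=> [mF Foo] [mG Goo].
have mN := measurable_nm mF; have mN' := measurable_nm mG.
apply: (@mx_integrable_le _ _ _ _ _ _ _ _ _ (fun x => nm (F x) ^+ 2 + nm (G x) ^+ 2)) => //.
- exact: mx_measurableM.
- by apply: measurable_funD; exact: measurable_nm_sqr.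
- move=> x _; rewrite (le_trans (nmM _ _))//.
  have := sqr_ge0 (nm (F x) - nm (G x)); rewrite sqrrB.
  have := mulr_ge0 (nm_ge0 (F x)) (nm_ge0 (G x)).
  by move: (nm (F x)) (nm (G x)) => a b; rewrite mulr2n; lra.
- rewrite integralD_fin//; try exact: measurable_nm_sqr;
    try by move=> x _; exact: sqr_ge0.
  exact: lte_add_pinfty.
Qed.

End L2Defs.

Lemma is_l2_Mbounded d (T : measurableType d) (R : realType)
    (mu : {measure set T -> \bar R}) p q r (F : T -> 'M[R[i]]_(p, q))
    (G : T -> 'M[R[i]]_(q, r)) (c : R) :
  is_l2 mu F -> mx_measurable setT G -> (forall x, nm (G x) <= c) ->
  is_l2 mu (fun x => F x *m G x).
Proof.
move=> [mF Foo] mG Gc.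
apply: (@is_l2_le _ _ _ _ _ _ _ (fun x => c ^+ 2 * nm (F x) ^+ 2)).
- exact: mx_measurableM.
- by apply: measurable_funM => //; exact: measurable_nm_sqr.
- move=> x; have c0 : 0 <= c by exact: le_trans (nm_ge0 _) (Gc x).
  rewrite -exprMn ler_pXn2r ?nnegrE ?nm_ge0// ?mulr_ge0 ?nm_ge0//.
  by rewrite (le_trans (nmM _ _))// mulrC ler_wpM2r ?nm_ge0.
- rewrite integralZl_fin ?sqr_ge0//; last 2 first.
  + exact: measurable_nm_sqr.
  + by move=> x _; exact: sqr_ge0.
  by rewrite lte_mul_pinfty// lee_fin sqr_ge0.
Qed.

Lemma l2n_le_columns d (T : measurableType d) (R : realType)
    (mu : {measure set T -> \bar R}) p q (X : T -> 'M[R[i]]_(p, q)) :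
  mx_measurable setT X ->
  (l2n mu X <= q%:R%:E * \sum_(i < q) l2n mu (fun r => col i (X r)))%E.
Proof.
move=> mX.
have mcol i : mx_measurable setT (fun r => col i (X r)).
  under eq_fun do rewrite colE; apply: (mx_measurableM mX).
  exact: mx_measurable_cst.
rewrite /l2n -ge0_integral_sum//; last 2 first.
- by move=> i; apply/measurable_EFinP; exact: measurable_nm_sqr.
- by move=> i r _; rewrite lee_fin sqr_ge0.
under [X in (_ <= _ * X)%E]eq_integral do rewrite sumEFin.
rewrite -integralZl_fin//; last 2 first.
- by apply: measurable_sum => i; exact: measurable_nm_sqr.
- by move=> r _; apply: sumr_ge0 => i _; exact: sqr_ge0.
apply: le_integral_fin => //.
- exact: measurable_nm_sqr mX.
- by apply: measurable_funM => //; apply: measurable_sum => i; exact: measurable_nm_sqr.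
- by move=> r _; exact: sqr_ge0.
- move=> r _; rewrite (le_trans _ (sqr_sum_le _))// /nm exchange_big/=.
  rewrite ler_pXn2r// ?nnegrE; last 2 first.
  + by apply: sumr_ge0 => i _; apply: sumr_ge0 => j _; exact: l1_ge0.
  + by apply: sumr_ge0 => i _; exact: nm_ge0.
  apply: ler_sum => i _; rewrite ler_sum// => a _.
  by rewrite big_ord1 mxE.
Qed.

(** * The Lippmann-Schwinger equation *)

Section FixedEnergy.
Variables (R : realType) (m l : R).
Local Notation mu := (leb3_sf R).
Local Notation C := R[i].
Variables (V V1 W1 : R3 R -> 'M[C]_4) (v1 w1 : R).
Hypotheses (m0 : 0 < m) (V1l2 : is_l2 mu V1) (mW1 : mx_measurable setT W1)
  (V1b : forall r, nm (V1 r) <= v1) (W1b : forall r, nm (W1 r) <= w1)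
  (VE : forall r, V1 r *m W1 r *m V1 r = V r).
Hypothesis nexc : ~ exceptional m V1 W1 l.

Let mV1 : mx_measurable setT V1. Proof. exact: V1l2.1. Qed.
Let B := B_kernel m l.
Let mB : mx_measurable setT B. Proof. exact: mx_measurable_B. Qed.
(** The factor [(2 pi)^(3/2)] is absorbed in the left weight, so that the identity plus [iop mu K]
    is the operator in the definition of exceptional energies. *)
Let A r := (c32 R)%:C *: V1 r.
Let W r := V1 r *m W1 r.
Let K r s := A r *m B (sub3 r s) *m W s.

Let Al2 : is_l2 mu A. Proof. exact: is_l2Z. Qed.
Let Wl2 : is_l2 mu W. Proof. exact: (is_l2_Mbounded V1l2 mW1 W1b). Qed.

Let Ab r : nm (A r) <= `|c32 R| * v1.
Proof. by rewrite /A nmZr ler_wpM2l. Qed.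

Let Wb r : nm (W r) <= v1 * w1.
Proof. by rewrite (le_trans (nmM _ _))// ler_pM ?nm_ge0. Qed.

Let near e : 0 < e -> exists M, kbounded mu (fun r s =>
  A r *m truncate_below (fun r s => B (sub3 r s)) M r s *m W s) e.
Proof.
have [C0 HC0] := B_kernel_split m0 l.
exact: (near_conv mB HC0 Al2.1 Wl2.1 Ab Wb).
Qed.

(** The potential term before multiplication by [V1 r], needed because [phi] itself is not square
    integrable. For [f] in L^2 the product [W f] is in L^1, so the integral converges for almost
    every [r]. *)
Let BG p (f : R3 R -> 'M[C]_(4, p)) r : 'M[C]_(4, p) :=
  mx_integral mu setT (fun s => B (sub3 r s) *m (W s *m f s)).

Let mBG_fun p (f : R3 R -> 'M[C]_(4, p)) : mx_measurable setT f ->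
  mx_measurable setT (fun z : R3 R * R3 R => B (sub3 z.1 z.2) *m (W z.2 *m f z.2)).
Proof.
move=> mf; apply: mx_measurableM; first exact: (mx_measurable_conv mB).
by apply: (@mx_measurable_snd _ _ _ _ _ _ _ (fun s => W s *m f s)); exact: mx_measurableM Wl2.1 mf.
Qed.

Let mBG p (f : R3 R -> 'M[C]_(4, p)) : mx_measurable setT f ->
  mx_measurable setT (BG f).
Proof.
move=> mf.
exact: (@mx_measurable_integral _ _ _ _ _ mu _ _
  (fun r s => B (sub3 r s) *m (W s *m f s)) (mBG_fun mf)).
Qed.

Let BG_int p (f : R3 R -> 'M[C]_(4, p)) : is_l2 mu f -> {ae mu, forall r,
  mx_integrable mu setT (fun s => B (sub3 r s) *m (W s *m f s))}.
Proof.
move=> fl2; have [C0 HC0] := B_kernel_split m0 l.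
exact: (conv_ae_integrable mB HC0 (mx_integrable_l2M Wl2 fl2)).
Qed.

Let iopE (f : R3 R -> 'cV[C]_4) : is_l2 mu f -> {ae mu, forall r,
  iop mu K f r = (c32 R)%:C *: (V1 r *m BG f r)}.
Proof.
move=> fl2; apply: filterS (BG_int fl2) => r H.
rewrite /iop /BG scalemxAl -/(A r) -(mx_integral_mull measurableT _ H).
by congr mx_integral; apply/funext => s; rewrite /K !mulmxA.
Qed.

Let B_opE (f : R3 R -> 'cV[C]_4) : is_l2 mu f -> {ae mu, forall r,
  B_op m V1 W1 l f r = V1 r *m BG f r}.
Proof.
move=> fl2; apply: filterS (BG_int fl2) => r H.
rewrite /BG -(mx_integral_mull measurableT _ H).
by congr mx_integral; apply/funext => s; rewrite /W !mulmxA.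
Qed.

Let inj (f : R3 R -> 'cV[C]_4) : is_l2 mu f ->
  {ae mu, forall r, f r + iop mu K f r = 0} -> {ae mu, forall r, f r = 0}.
Proof.
move=> fl2 H; apply: contrapT => nf; apply: nexc; exists f.
split; [exact: (l2_is_l2 mu f).2 | exact: nf |].
have [E1 E2] := (iopE fl2, B_opE fl2).
by apply: filterS3 H E1 E2 => r H1 H2 ->; rewrite -H2.
Qed.

Let sandwich := kbounded_sandwich Al2 Wl2 (mx_measurable_conv mB) near.
Let fredholm := iop_fredholm Al2 Wl2 (mx_measurable_conv mB) near inj.

(* The columns of [X] solve the Lippmann-Schwinger equations whose inhomogeneous
   terms are the columns of [g V_1]; for [g r = e^(ik.r)] they are combined into
   the [V_1 phi_n] by [X *m eigvec_hat n k]. *)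
Definition resolves (g : R3 R -> C) (X : R3 R -> 'M[C]_4) : Prop :=
  is_l2 mu X /\ {ae mu, forall r, X r + (c32 R)%:C *: (V1 r *m
    mx_integral mu setT (fun s =>
      B_kernel m l (sub3 r s) *m (V1 s *m W1 s *m X s))) = g r *: V1 r}.

Let is_l2_gV1 p g (P : 'M[C]_(4, p)) (c : R) : cmeasurable setT g ->
  (forall r, l1 (g r) <= c) -> is_l2 mu (fun r => g r *: (V1 r *m P)).
Proof.
move=> mg gc.
under eq_fun do rewrite scalemxAr.
apply: (@is_l2_Mbounded _ _ _ _ _ _ _ _ _ (c * nm P)) => //.
  by apply: mx_measurableZ => //; exact: mx_measurable_cst.
by move=> r; rewrite (le_trans (nmZ _ _))// ler_wpM2r ?nm_ge0.
Qed.

Let col_BG (X : R3 R -> 'M[C]_4) i r : BG (fun s => col i (X s)) r = col i (BG X r).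
Proof.
have colv (M : 'M[C]_4) a b : col i M a b = M a i by rewrite mxE.
apply/matrixP => a b; rewrite colv ![mx_integral _ _ _ _ _]mxE.
by congr (_ +i* _); apply: eq_Rintegral => s _;
  rewrite colE !mulmxA -colE colv.
Qed.

(** The Fredholm alternative is about vector functions, so the matrix solution is assembled from its
    columns, one for each standard basis vector. *)
Lemma resolves_exists g (c : R) : cmeasurable setT g ->
  (forall r, l1 (g r) <= c) -> exists X, resolves g X.
Proof.
move=> mg gc; have [ex _] := fredholm.
have /choice[x Hx] i := ex _ (is_l2_gV1 (delta_mx i 0 : 'cV_4) mg gc).
pose X r : 'M[C]_4 := \matrix_(a, i) x i r a 0.
have colX i : (fun r => col i (X r)) = x i.
  by apply/funext => r; apply/matrixP => a b; rewrite !mxE ord1.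
have Xl2 : is_l2 mu X.
  have mX : mx_measurable setT X.
    by apply: mx_measurable_mx => i j; apply: mx_measurable_entry; exact: (Hx j).1.1.
  split => //; apply: (le_lt_trans (l2n_le_columns mu mX)).
  rewrite lte_mul_pinfty//; apply/lte_sum_pinfty => i _.
  by rewrite colX; exact: (Hx i).1.2.
exists X; split => //.
have /filter_forall : forall i, {ae mu, forall r,
    x i r + (c32 R)%:C *: (V1 r *m BG (x i) r) = g r *: (V1 r *m delta_mx i 0)}.
  by move=> i; apply: filterS2 (iopE (Hx i).1) (Hx i).2 => r ->.
apply: filterS => r H; apply/matrixP => a i.
have /(congr1 (fun v : 'cV_4 => v a 0)) := H i.
rewrite -[x i]colX col_BG !colE !mulmxA !scalemxAl -mulmxDl -!colE.
have colv (M : 'M[C]_4) : col i M a 0 = M a i by rewrite mxE.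
by rewrite !colv -!scalemxAl.
Qed.

(** Bounded invertibility, with a constant independent of [g]. The right-hand side is a weighted
    integral of [g] and not its supremum, so that it tends to 0 for differences of plane waves,
    which converge only pointwise. The 16 is 4 columns times the 4 of [l2n_le_columns]. *)
Lemma resolves_bound : exists2 c : R, 0 <= c & forall g X,
  cmeasurable setT g -> (exists b, forall r, l1 (g r) <= b) -> resolves g X ->
  (l2n mu X <= c%:E * \int[mu]_r (l1 (g r) ^+ 2 * nm (V1 r) ^+ 2)%:E)%E.
Proof.
have [_ [c c0 bd]] := fredholm.
exists (16%:R * c); first by rewrite mulr_ge0.
move=> g X mg [b gb] [Xl2 XE].
have Ig : measurable_fun setT (fun r => l1 (g r) ^+ 2 * nm (V1 r) ^+ 2).
  apply: measurable_funM; last exact: measurable_nm_sqr.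
  by apply: measurable_funX; exact: measurable_l1.
have mcol i : mx_measurable setT (fun r => col i (X r)).
  by under eq_fun do rewrite colE; apply: mx_measurableM Xl2.1 _;
    exact: mx_measurable_cst.
have col_l2 i : is_l2 mu (fun r => col i (X r)).
  under eq_fun do rewrite colE.
  apply: (is_l2_Mbounded Xl2 (mx_measurable_cst _ _)) => r; exact: lexx.
have colb i : (l2n mu (fun r => col i (X r)) <=
    c%:E * \int[mu]_r (l1 (g r) ^+ 2 * nm (V1 r) ^+ 2)%:E)%E.
  apply: (le_trans (bd _ (col_l2 i))); rewrite lee_wpmul2l// /l2n.
  have E : {ae mu, forall r, col i (X r) + iop mu K (fun s => col i (X s)) r =
      g r *: (V1 r *m delta_mx i 0)}.
    apply: filterS2 (iopE (col_l2 i)) XE => r -> /(congr1 (col i)).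
    by rewrite col_BG !colE !mulmxA !scalemxAl -mulmxDl.
  have mI : mx_measurable setT
      (fun r => col i (X r) + iop mu K (fun s => col i (X s)) r).
    have [k kK] := sandwich.
    by apply: (mx_measurableD (mcol i)); exact: (is_l2_iop kK (col_l2 i)).1.
  rewrite -/(l2n mu _) (eq_ae_l2n mI _ E); last first.
    exact: (is_l2_gV1 (delta_mx i 0 : 'cV_4) mg gb).1.
  apply: le_integral_fin => //.
  - apply: measurable_nm_sqr.
    exact: (is_l2_gV1 (delta_mx i 0 : 'cV_4) mg gb).1.
  - by move=> r _; exact: sqr_ge0.
  - move=> r _; rewrite -exprMn ler_pXn2r ?nnegrE ?mulr_ge0 ?nm_ge0 ?l1_ge0//.
    rewrite (le_trans (nmZ _ _))// ler_wpM2l ?l1_ge0// -colE.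
    rewrite nm_cv ler_sum// => a _; rewrite mxE (bigD1 i)//= lerDl.
    by apply: sumr_ge0 => j _; exact: l1_ge0.
apply: (@le_trans _ _ (4%:E * \sum_(i < 4) l2n mu (fun r => col i (X r)))%E).
  exact: l2n_le_columns Xl2.1.
set I := (\int[mu]_r _)%E in colb *.
apply: (@le_trans _ _ (4%:E * \sum_(i < 4) (c%:E * I))%E).
  by rewrite lee_wpmul2l//; apply: lee_sum => i _; exact: colb.
have I0 : (0 <= I)%E.
  by apply: integral_ge0 => r _; rewrite lee_fin mulr_ge0// sqr_ge0.
rewrite [(16%:R * c)%:E]EFinM -muleA.
have : (0 <= c%:E * I)%E by rewrite mule_ge0.
case: (c%:E * I)%E => [y|_|//]; last by rewrite gt0_muley ?leey.
by rewrite sumEFin -!EFinM !lee_fin sumr_const card_ord => y0; lra.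
Qed.

Let BGB p (X Y : R3 R -> 'M[C]_(4, p)) : is_l2 mu X -> is_l2 mu Y ->
  {ae mu, forall r, BG (fun s => X s - Y s) r = BG X r - BG Y r}.
Proof.
move=> Xl2 Yl2.
apply: filterS2 (BG_int Xl2) (BG_int Yl2) => r iX iY.
rewrite /BG -scaleN1r -(mx_integralZ measurableT _ iY) -mx_integralD//; last first.
  exact: mx_integrableZ.
by congr mx_integral; apply/funext => s; rewrite scaleN1r !mulmxBr.
Qed.

(** Linearity turns [resolves_bound] into a continuity estimate: the difference of two solutions is
    controlled by the difference of the plane waves. *)
Lemma resolvesB g g' X X' : resolves g X -> resolves g' X' ->
  resolves (fun r => g r - g' r) (fun r => X r - X' r).
Proof.
move=> [Xl2 XE] [X'l2 X'E]; split; first exact: is_l2B.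
apply: filterS3 (BGB Xl2 X'l2) XE X'E => r E E1 E2.
rewrite -/(BG (fun s => X s - X' s) r) E scalerBl -E1 -E2.
by rewrite mulmxBr scalerBr opprD addrACA.
Qed.

(* The generalized eigenfunction is recovered from [V_1 phi = X v] through the
   right-hand side of its own equation. *)
Lemma resolves_eigenfunction g X (v : 'cV[C]_4) (c : R) : cmeasurable setT g ->
  (forall r, l1 (g r) <= c) -> resolves g X -> exists phi : R3 R -> 'cV[C]_4,
  L2 mu setT (fun r => V1 r *m phi r) /\
  {ae mu, forall r, phi r = g r *: v - (c32 R)%:C *: mx_integral mu setT
    (fun s => B_kernel m l (sub3 r s) *m V s *m phi s)}.
Proof.
move=> mg gc [Xl2 XE].
pose chi r : 'cV[C]_4 := X r *m v.
have chil2 : is_l2 mu chi.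
  by apply: (is_l2_Mbounded Xl2 (mx_measurable_cst _ _)) => r; exact: lexx.
pose phi r : 'cV[C]_4 := g r *: v - (c32 R)%:C *: BG chi r.
have mphi : mx_measurable setT phi.
  apply: mx_measurableB; last by apply: mx_measurableZc; exact: mBG chil2.1.
  by apply: mx_measurableZ => //; exact: mx_measurable_cst.
have phiE : {ae mu, forall r, V1 r *m phi r = chi r}.
  apply: filterS2 (BG_int Xl2) XE => r iX E.
  have -> : phi r = g r *: v - (c32 R)%:C *: (BG X r *m v).
    rewrite /phi /BG -(mx_integral_mulr measurableT _ iX).
    by congr (_ - _ *: mx_integral _ _ _); apply/funext => s; rewrite /chi !mulmxA.
  rewrite mulmxBr -!scalemxAr mulmxA scalemxAl -E mulmxDl -/(BG X r).
  by rewrite -!scalemxAl addrK.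
have V1phi : mx_measurable setT (fun r => V1 r *m phi r) by exact: mx_measurableM.
exists phi; split.
  apply/l2_is_l2; split => //.
  by rewrite (eq_ae_l2n V1phi chil2.1 phiE); exact: chil2.2.
have mV : mx_measurable setT V.
  rewrite (_ : V = fun r => W r *m V1 r); last by apply/funext => r; rewrite VE.
  exact: (mx_measurableM Wl2.1 mV1).
(* The two integrands agree for almost every [s], so the integrals agree for every [r], including
   points where they diverge. *)
suff H r : BG chi r = mx_integral mu setT
    (fun s => B_kernel m l (sub3 r s) *m V s *m phi s).
  by apply: aeW => r; rewrite -H.
apply: (ae_eq_mx_integral measurableT).
- apply: mx_measurableM; last by apply: mx_measurableM Wl2.1 chil2.1.
  exact: mx_measurable_comp mB (measurable_sub3r r).
- apply: (mx_measurableM _ mphi); apply: (mx_measurableM _ mV).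
  exact: mx_measurable_comp mB (measurable_sub3r r).
- apply: filterS phiE => s E _.
  by rewrite -E /W !mulmxA -[in RHS]VE !mulmxA.
Qed.

(** Multiplying the equation of [phi] by [V1] shows that [V1 phi] and [X v] satisfy the same
    equation in L^2, so they agree by injectivity; then [V = V1 W1 V1] gives [V phi]. Any choice of
    the generalized eigenfunction is thus described by [X]. *)
Lemma resolves_unique g X (v : 'cV[C]_4) (phi : R3 R -> 'cV[C]_4) :
  resolves g X -> L2 mu setT (fun r => V1 r *m phi r) ->
  {ae mu, forall r, phi r = g r *: v - (c32 R)%:C *: mx_integral mu setT
    (fun s => B_kernel m l (sub3 r s) *m V s *m phi s)} ->
  {ae mu, forall r, V r *m phi r = V1 r *m W1 r *m X r *m v}.
Proof.
move=> [Xl2 XE] /l2_is_l2; set chi := fun r => _; move=> chil2 phiE.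
pose Xv r : 'cV[C]_4 := X r *m v.
have Xvl2 : is_l2 mu Xv.
  by apply: (is_l2_Mbounded Xl2 (mx_measurable_cst _ _)) => r; exact: lexx.
have Dl2 := is_l2B chil2 Xvl2.
have : {ae mu, forall r, chi r - Xv r = 0}.
  apply: (inj Dl2).
  have phiE' : {ae mu, forall r,
      chi r + (c32 R)%:C *: (V1 r *m BG chi r) = g r *: (V1 r *m v)}.
    apply: filterS phiE => r E.
    have -> : BG chi r =
        mx_integral mu setT (fun s => B_kernel m l (sub3 r s) *m V s *m phi s).
      by congr mx_integral; apply/funext => s; rewrite /W /chi !mulmxA -VE !mulmxA.
    by rewrite /chi {1}E mulmxBr -!scalemxAr subrK.
  have XvE : {ae mu, forall r,
      Xv r + (c32 R)%:C *: (V1 r *m BG Xv r) = g r *: (V1 r *m v)}.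
    apply: filterS2 (BG_int Xl2) XE => r iX E.
    have -> : BG Xv r = BG X r *m v.
      rewrite /BG -(mx_integral_mulr measurableT _ iX).
      by congr mx_integral; apply/funext => s; rewrite /Xv !mulmxA.
    by rewrite [RHS]scalemxAl -E mulmxDl -scalemxAl mulmxA.
  have E := iopE Dl2; have E' := BGB chil2 Xvl2.
  have D : {ae mu, forall r, (chi r - Xv r) +
      (c32 R)%:C *: (V1 r *m (BG chi r - BG Xv r)) = 0}.
    apply: filterS2 phiE' XvE => r P1 P2.
    by rewrite mulmxBr scalerBr addrACA -opprD P1 P2 subrr.
  by apply: filterS3 E E' D => r -> ->.
apply: filterS => r /eqP; rewrite subr_eq0 => /eqP E.
by rewrite -VE -mulmxA -/(chi r) E /Xv !mulmxA.
Qed.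

End FixedEnergy.

Lemma nm_mx_integralM_sqr d (T : measurableType d) (R : realType)
    (mu : {measure set T -> \bar R}) p q n (F : T -> 'M[R[i]]_(p, n))
    (G : T -> 'M[R[i]]_(n, q)) (a b : R) :
  is_l2 mu F -> is_l2 mu G -> (l2n mu F <= a%:E)%E -> (l2n mu G <= b%:E)%E ->
  nm (mx_integral mu setT (fun x => F x *m G x)) ^+ 2 <= a * b.
Proof.
move=> Fl2 Gl2 Fa Gb.
have mF := measurable_nm Fl2.1; have mG := measurable_nm Gl2.1.
have FG := mx_integrable_l2M Fl2 Gl2.
rewrite -lee_fin expr2 EFinM.
have I0 : (0 <= \int[mu]_x (nm (F x) * nm (G x))%:E)%E.
  by apply: integral_ge0 => x _; rewrite lee_fin mulr_ge0// nm_ge0.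
apply: (@le_trans _ _ ((\int[mu]_x (nm (F x) * nm (G x))%:E) ^+ 2)%E).
  have N0 : (0 <= (nm (mx_integral mu setT (fun x => F x *m G x)))%:E)%E.
    by rewrite lee_fin nm_ge0.
  rewrite expe2; suff H : ((nm (mx_integral mu setT (fun x => F x *m G x)))%:E <=
    \int[mu]_x (nm (F x) * nm (G x))%:E)%E by exact: lee_pmul.
  apply: (le_trans (nm_mx_integral measurableT FG)).
  apply: le_integral_fin => //; first exact: measurable_nm FG.1.
  - exact: measurable_funM.
  - by move=> x _; exact: nm_ge0.
  - by move=> x _; exact: nmM.
apply: (le_trans (cauchy_schwarz mu mF mG (fun x => nm_ge0 _) (fun x => nm_ge0 _))).
by rewrite EFinM lee_pmul ?l2n_ge0.
Qed.

Lemma cmeasurableB d (T : measurableType d) (R : realType) (D : set T)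
    (f g : T -> R[i]) : cmeasurable D f -> cmeasurable D g ->
  cmeasurable D (fun x => f x - g x).
Proof.
move=> mf mg; under eq_fun do rewrite -mulN1r.
by apply: cmeasurableD => //; apply: cmeasurableM => //; exact: cmeasurable_cst.
Qed.

(** * Scattering amplitudes *)

Section Amplitude.
Variables (R : realType) (m : R).
Local Notation mu := (leb3_sf R).
Local Notation C := R[i].
Variables (V V1 W1 : R3 R -> 'M[C]_4) (v1 w1 : R).
Hypotheses (m0 : 0 < m) (V1l2 : is_l2 mu V1) (mW1 : mx_measurable setT W1)
  (V1b : forall r, nm (V1 r) <= v1) (W1b : forall r, nm (W1 r) <= w1)
  (VE : forall r, V1 r *m W1 r *m V1 r = V r).

Let W r := V1 r *m W1 r.
Let Wl2 : is_l2 mu W. Proof. exact: (is_l2_Mbounded V1l2 mW1 W1b). Qed.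

Lemma measurable_dot3 (k : R3 R) : measurable_fun setT (fun r : R3 R => dot3 k r).
Proof.
have m11 : measurable_fun setT (fun x : R3 R => x.1.1 : R).
  exact: (measurableT_comp measurable_fst measurable_fst).
have m12 : measurable_fun setT (fun x : R3 R => x.1.2 : R).
  exact: (measurableT_comp measurable_snd measurable_fst).
have m2 : measurable_fun setT (fun x : R3 R => x.2 : R).
  exact: measurable_snd.
by apply: measurable_funD; [apply: measurable_funD|]; apply: measurable_funM.
Qed.

Let mcis k : cmeasurable setT (fun r : R3 R => cis (dot3 k r)).
Proof. by apply: cmeasurable_cis; exact: measurable_dot3. Qed.

(** All dependence on [k] is moved to the solutions [X k] at the fixed energy [l], where bounds and
    continuity are available; [phi] enters only through an equality for almost every [r], at each
    [k] on the shell of energy [l]. The [X k] are defined for all [k], also off that shell. *)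
Lemma phi_density (l : R) : exists (X : R3 R -> R3 R -> 'M[C]_4) (c : R),
  [/\ forall k, is_l2 mu (X k),
      forall k, (l2n mu (X k) <= c%:E)%E,
      0 <= c,
      forall k k', (l2n mu (fun r => X k r - X k' r)%R <= c%:E *
        \int[mu]_r (l1 (cis (dot3 k r) - cis (dot3 k' r)) ^+ 2 *
          nm (V1 r) ^+ 2)%:E)%E &
      forall n k, eigval m n k = l ->
        mx_measurable setT (fun r => V r *m phi m V V1 W1 n k r) /\
        {ae mu, forall r, V r *m phi m V V1 W1 n k r =
           V1 r *m W1 r *m X k r *m eigvec_hat m n k}].
Proof.
(* Outside [E_plus] the convention [phi = 0] matches [X = 0], so the statement holds at every
   energy. This is needed because [T_mx] involves two energies. *)
have [lE|lE] := pselect (E_plus m V1 W1 l); last first.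
  exists (fun _ _ => 0), 0; split => //.
  - by move=> k; exact: is_l2_0.
  - move=> k; rewrite /l2n (eq_integral (fun=> 0%E)) ?integral0// => r _.
    by rewrite nm0 expr0n.
  - move=> k k'; rewrite mul0e /l2n (eq_integral (fun=> 0%E)) ?integral0// => r _.
    by rewrite subrr nm0 expr0n.
  - move=> n k El; rewrite /phi El; case: asboolP => // _.
    under eq_fun do rewrite mulmx0; split; first exact: mx_measurable_cst.
    by apply: aeW => r; rewrite !mulmx0 mul0mx.
have nexc := lE.2.
have c2 (k r : R3 R) : l1 (cis (dot3 k r)) <= 2 by exact: l1_cis.
have /choice[X HX] k :=
  resolves_exists m0 V1l2 mW1 V1b W1b nexc (mcis k) (c2 k).
have [c c0 Hc] := resolves_bound m0 V1l2 mW1 V1b W1b nexc.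
pose I k := (\int[mu]_r (l1 (cis (dot3 k r)) ^+ 2 * nm (V1 r) ^+ 2)%:E)%E.
have V1fin : l2n mu V1 \is a fin_num by rewrite ge0_fin_numE ?l2n_ge0//; exact: V1l2.2.
pose L := fine (l2n mu V1).
have L0 : 0 <= L by exact: fine_ge0 (l2n_ge0 _ _).
have IL k : (I k <= (4%:R * L)%:E)%E.
  rewrite EFinM /L fineK// -integralZl_fin//; last 2 first.
  - exact: measurable_nm_sqr V1l2.1.
  - by move=> r _; exact: sqr_ge0.
  apply: le_integral_fin => //.
  - apply: measurable_funM; last exact: measurable_nm_sqr V1l2.1.
    by apply: measurable_funX; exact: measurable_l1.
  - by apply: measurable_funM => //; exact: measurable_nm_sqr V1l2.1.
  - by move=> r _; rewrite mulr_ge0// sqr_ge0.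
  - move=> r _; rewrite ler_wpM2r ?sqr_ge0//.
    have := c2 k r; have := l1_ge0 (cis (dot3 k r)).
    by move: (l1 _) => t t0 t2; nra.
(* One constant serves both estimates: [c * (4 * L)] bounds the solutions, as plane waves have [l1]
   at most 2, and [c] bounds the differences. *)
exists X, (c + c * (4%:R * L)); split.
- by move=> k; exact: (HX k).1.
- move=> k; apply: (le_trans (Hc _ _ (mcis k) _ (HX k))); first by exists 2.
  apply: (le_trans (lee_wpmul2l _ (IL k))); first by rewrite lee_fin.
  by rewrite -EFinM lee_fin lerDr.
- by rewrite addr_ge0 ?mulr_ge0.
- move=> k k'.
  have mI := cmeasurableB (mcis k) (mcis k').
  apply: (le_trans (Hc _ _ mI _ (resolvesB m0 V1l2 mW1 W1b (HX k) (HX k')))).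
    exists 4%:R => r; rewrite (le_trans (l1D _ _))// l1N.
    by have := c2 k r; have := c2 k' r; lra.
  apply: lee_wpmul2r; last by rewrite lee_fin lerDl !mulr_ge0.
  by apply: integral_ge0 => r _; rewrite lee_fin mulr_ge0// sqr_ge0.
- move=> n k El.
  have [f [fl2 fE]] := resolves_eigenfunction m0 V1l2 mW1 W1b VE
    (eigvec_hat m n k) (mcis k) (c2 k) (HX k).
  have [Pl2 PE] : gen_eigenfunction m V V1 n k (phi m V V1 W1 n k).
    rewrite /phi; case: asboolP => [_|]; last by rewrite El.
    apply: xgetPex; exists f; split; first exact: fl2.
    by rewrite El; exact: fE.
  split.
    rewrite (_ : (fun r => _) = fun r => W r *m (V1 r *m phi m V V1 W1 n k r)).
      exact: mx_measurableM Wl2.1 Pl2.1.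
    by apply/funext => r; rewrite -VE !mulmxA.
  rewrite El in PE.
  exact: (resolves_unique m0 V1l2 mW1 W1b VE nexc (HX k) Pl2 PE).
Qed.

Lemma cvg_l1_cis (a : nat -> R) (b : R) : a @ \oo --> b ->
  (fun j => l1 (cis (a j) - cis b) ^+ 2) @ \oo --> (0 : R).
Proof.
move=> ab.
have c1 : (fun j => cos (a j)) @ \oo --> cos b.
  by apply: cvg_comp ab _; exact: continuous_cos.
have c2 : (fun j => sin (a j)) @ \oo --> sin b.
  by apply: cvg_comp ab _; exact: continuous_sin.
have l0 : (fun j => l1 (cis (a j) - cis b)) @ \oo --> (0 : R).
  rewrite (_ : 0 = `|cos b - cos b| + `|sin b - sin b|); last first.
    by rewrite !subrr normr0 addr0.
  by apply: cvgD; apply: cvg_norm; apply: cvgB => //; exact: cvg_cst.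
rewrite (_ : 0 = 0 * 0 :> R); last by rewrite mulr0.
exact: cvgM.
Qed.

(** Dominated convergence with majorant [16 * nm (F r) ^+ 2]. The sign [s] is 1 for the incoming
    waves and -1 for the waves of the Fourier transform, so one lemma yields continuity in either
    momentum. *)
Let gap_small p q (F : R3 R -> 'M[C]_(p, q)) (s : R) (k_ : nat -> R3 R) k e :
  is_l2 mu F -> (forall r, dot3 (k_ j) r @[j --> \oo] --> dot3 k r) -> 0 < e ->
  exists N, forall j, (N <= j)%N ->
    (\int[mu]_r (l1 (cis (s * dot3 (k_ j) r) - cis (s * dot3 k r)) ^+ 2 *
       nm (F r) ^+ 2)%:E <= e%:E)%E.
Proof.
move=> Fl2 kk e0.
have mN := measurable_nm_sqr Fl2.1.
have mc x : cmeasurable setT (fun r : R3 R => cis (s * dot3 x r)).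
  by apply: cmeasurable_cis; apply: measurable_funM => //; exact: measurable_dot3.
apply: (@dominated_cvg0 _ _ _ mu _ (fun r => 16%:R * nm (F r) ^+ 2)) => //.
- move=> j; apply: measurable_funM => //; apply: measurable_funX.
  by apply: measurable_l1; exact: cmeasurableB.
- exact: measurable_funM.
- move=> j r; rewrite mulr_ge0 ?sqr_ge0//= ler_wpM2r ?sqr_ge0//.
  have := l1D (cis (s * dot3 (k_ j) r)) (- cis (s * dot3 k r)); rewrite l1N.
  have := l1_cis (s * dot3 (k_ j) r); have := l1_cis (s * dot3 k r).
  have := l1_ge0 (cis (s * dot3 (k_ j) r) - cis (s * dot3 k r)).
  move: (l1 _) (l1 _) (l1 _) => a b c a0 b2 c2 abc.
  have a4 : a <= 4%:R by lra.
  by rewrite expr2; nra.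
- rewrite integralZl_fin//; last by move=> r _; exact: sqr_ge0.
  by rewrite lte_mul_pinfty//; exact: Fl2.2.
- move=> r; rewrite -[0](mul0r (nm (F r) ^+ 2)); apply: cvgM; last exact: cvg_cst.
  apply: cvg_l1_cis; apply: cvgM; [exact: cvg_cst|exact: kk].
Qed.

(* Entries of [T_mx q k] are amplitudes [tau q k] at the energies of the shell
   [k] lies on. *)
Lemma amplitude (l : R) : exists (tau : R3 R -> R3 R -> 'M[C]_4) (c : R),
  [/\ forall q k, nm (tau q k) <= c,
      forall k_ k e, (forall r, dot3 (k_ j) r @[j --> \oo] --> dot3 k r) -> 0 < e ->
        exists N, forall j q, (N <= j)%N -> nm (tau q (k_ j) - tau q k) <= e,
      forall q_ q e, (forall r, dot3 (q_ j) r @[j --> \oo] --> dot3 q r) -> 0 < e ->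
        exists N, forall j k, (N <= j)%N -> nm (tau (q_ j) k - tau q k) <= e &
      forall n k, eigval m n k = l -> forall q,
        let F r := cis (- dot3 q r) *: (V r *m phi m V V1 W1 n k r) in
        mx_integrable mu setT F /\
        mx_integral mu setT F = tau q k *m eigvec_hat m n k].
Proof.
have [X [c [Xl2 Xc c0 Xd XE]]] := phi_density l.
pose Fq q r := cis (- dot3 q r) *: W r.
have mcN q : cmeasurable setT (fun r : R3 R => cis (- dot3 q r)).
  by apply: cmeasurable_cis; apply: measurableT_comp => //; exact: measurable_dot3.
have Wfin : l2n mu W \is a fin_num by rewrite ge0_fin_numE ?l2n_ge0//; exact: Wl2.2.
pose L := fine (l2n mu W).
have L0 : 0 <= L by exact: fine_ge0 (l2n_ge0 _ _).
have gW_l2 g (b : R) : cmeasurable setT g -> (forall r, l1 (g r) <= b) ->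
    is_l2 mu (fun r => g r *: W r) /\
    (l2n mu (fun r => g r *: W r) <= \int[mu]_r (l1 (g r) ^+ 2 * nm (W r) ^+ 2)%:E)%E /\
    (\int[mu]_r (l1 (g r) ^+ 2 * nm (W r) ^+ 2)%:E <= (b ^+ 2 * L)%:E)%E.
  move=> mg gb.
  have mW2 := measurable_nm_sqr Wl2.1.
  have b0 : 0 <= b by exact: le_trans (l1_ge0 _) (gb point).
  have mgW : measurable_fun setT (fun r => l1 (g r) ^+ 2 * nm (W r) ^+ 2).
    by apply: measurable_funM => //; apply: measurable_funX; exact: measurable_l1.
  have mG : mx_measurable setT (fun r => g r *: W r).
    by apply: mx_measurableZ => //; exact: Wl2.1.
  have H1 : (l2n mu (fun r => g r *: W r) <=
      \int[mu]_r (l1 (g r) ^+ 2 * nm (W r) ^+ 2)%:E)%E.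
    apply: le_integral_fin => //; first exact: measurable_nm_sqr.
    - by move=> r _; exact: sqr_ge0.
    - move=> r _; rewrite -exprMn ler_pXn2r ?nnegrE ?mulr_ge0 ?nm_ge0 ?l1_ge0//.
      exact: nmZ.
  have H2 : (\int[mu]_r (l1 (g r) ^+ 2 * nm (W r) ^+ 2)%:E <= (b ^+ 2 * L)%:E)%E.
    rewrite EFinM /L fineK// -integralZl_fin ?sqr_ge0//; last first.
      by move=> r _; exact: sqr_ge0.
    apply: le_integral_fin => //.
    - exact: measurable_funM.
    - by move=> r _; rewrite mulr_ge0// sqr_ge0.
    - move=> r _; rewrite ler_wpM2r ?sqr_ge0//.
      by rewrite ler_pXn2r ?nnegrE ?l1_ge0.
  split; last by split.
  by split => //; apply: (le_lt_trans H1 (le_lt_trans H2 _)); rewrite ltry.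
have N2 (q r : R3 R) : l1 (cis (- dot3 q r)) <= 2 by exact: l1_cis.
have Fl2 q : is_l2 mu (Fq q) by exact: (gW_l2 _ _ (mcN q) (N2 q)).1.
have Fb q : (l2n mu (Fq q) <= (4%:R * L)%:E)%E.
  have [_ [H1 H2]] := gW_l2 _ _ (mcN q) (N2 q).
  by rewrite (le_trans H1)// (le_trans H2)// -natrX.
pose tau q k := mx_integral mu setT (fun r => Fq q r *m X k r).
have tau_int q k := mx_integrable_l2M (Fl2 q) (Xl2 k).
have le_of_sqr (x y : R) : 0 <= y -> x ^+ 2 <= y ^+ 2 -> x <= y.
  by move=> y0 xy; rewrite leNgt; apply/negP => yx; move: xy; rewrite !expr2; nra.
have tauB q k q' k' : tau q k - tau q' k' =
    mx_integral mu setT (fun r => Fq q r *m X k r - Fq q' r *m X k' r).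
  have H := mx_integralD measurableT (tau_int q k)
    (mx_integrableZ measurableT (-1) (tau_int q' k')).
  rewrite (mx_integralZ measurableT _ (tau_int q' k')) scaleN1r in H.
  by rewrite -H; congr mx_integral; apply/funext => r; rewrite scaleN1r.
(* A bound [x ^+ 2 <= y] gives [x <= y + 1], which avoids a square root. *)
exists tau, (4%:R * L * c + 1); split.
- move=> q k.
  have H := nm_mx_integralM_sqr (Fl2 q) (Xl2 k) (Fb q) (Xc k).
  have := mulr_ge0 (mulr_ge0 (ler0n R 4) L0) c0.
  by move: H; rewrite expr2 -/(tau q k); move: (nm _) (_ * c) => x y; nra.
- move=> k_ k e kk e0.
  (* Cauchy-Schwarz bounds squares, hence [e ^+ 2]; the [+ 1] terms keep the denominator positive
     and at least [4 * L * c]. *)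
  pose e' := e ^+ 2 / (4%:R * L * (c + 1) + 1).
  have D0 : 0 < 4%:R * L * (c + 1) + 1 by rewrite ltr_wpDl// !mulr_ge0// addr_ge0.
  have e'0 : 0 < e' by rewrite divr_gt0// exprn_gt0.
  have [N HN] := gap_small 1 V1l2 kk e'0; exists N => j q Nj.
  apply: le_of_sqr; first exact: ltW.
  rewrite tauB.
  under eq_fun do rewrite -mulmxBr.
  have Xb : (l2n mu (fun r => X (k_ j) r - X k r)%R <= (c * e')%:E)%E.
    apply: (le_trans (Xd _ _)); rewrite EFinM lee_wpmul2l ?lee_fin//.
    have := HN j Nj; apply: le_trans; rewrite le_eqVlt; apply/orP; left; apply/eqP.
    by apply: eq_integral => r _; rewrite !mul1r.
  apply: (le_trans (nm_mx_integralM_sqr (Fl2 q) (is_l2B (Xl2 _) (Xl2 _)) (Fb q) Xb)).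
  rewrite mulrA /e' mulrCA -[leRHS]mulr1 ler_wpM2l ?sqr_ge0//.
  rewrite ler_pdivrMr// mul1r mulrDr mulr1 -addrA lerDl addr_ge0// mulr_ge0//.
- move=> q_ q e qq e0.
  pose e' := e ^+ 2 / (c + 1).
  have D0 : 0 < c + 1 by rewrite ltr_wpDl.
  have e'0 : 0 < e' by rewrite divr_gt0// exprn_gt0.
  have [N HN] := gap_small (-1) Wl2 qq e'0; exists N => j k Nj.
  apply: le_of_sqr; first exact: ltW.
  rewrite tauB.
  have mg := cmeasurableB (mcN (q_ j)) (mcN q).
  have gb r : l1 (cis (- dot3 (q_ j) r) - cis (- dot3 q r)) <= 4%:R.
    rewrite (le_trans (l1D _ _))// l1N.
    by have := N2 q r; have := N2 (q_ j) r; lra.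
  have [Gl2 [Gb _]] := gW_l2 _ _ mg gb.
  rewrite (_ : (fun r => _) = fun r =>
     ((cis (- dot3 (q_ j) r) - cis (- dot3 q r)) *: W r) *m X k r); last first.
    by apply/funext => r; rewrite scalerBl mulmxBl.
  have Gb' : (l2n mu (fun r => (cis (- dot3 (q_ j) r) - cis (- dot3 q r)) *: W r)%R
      <= e'%:E)%E.
    apply: (le_trans Gb); have := HN j Nj; apply: le_trans.
    rewrite le_eqVlt; apply/orP; left; apply/eqP.
    by apply: eq_integral => r _; rewrite !mulN1r.
  apply: (le_trans (nm_mx_integralM_sqr Gl2 (Xl2 k) Gb' (Xc k))).
  rewrite /e' -mulrA -[leRHS]mulr1 ler_wpM2l ?sqr_ge0//.
  by rewrite mulrC ler_pdivrMr// mul1r lerDl.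
- move=> n k El q.
  have [mP PE] := XE n k El.
  have mF : mx_measurable setT
      (fun r => cis (- dot3 q r) *: (V r *m phi m V V1 W1 n k r)).
    exact: mx_measurableZ.
  have Fi := mx_integrable_mulr measurableT (eigvec_hat m n k) (tau_int q k).
  have FE : {ae mu, forall r, cis (- dot3 q r) *: (V r *m phi m V V1 W1 n k r) =
     Fq q r *m X k r *m eigvec_hat m n k}.
    by apply: filterS PE => r ->; rewrite /Fq -!scalemxAl.
  split.
    split => //; apply: le_lt_trans Fi.2.
    rewrite le_eqVlt; apply/orP; left; apply/eqP.
    apply: ge0_ae_eq_integral => //.
    + by apply/measurable_EFinP; exact: measurable_nm.
    + by apply/measurable_EFinP; exact: measurable_nm Fi.1.
    + by move=> r _; rewrite lee_fin nm_ge0.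
    + by move=> r _; rewrite lee_fin nm_ge0.
    + by apply: filterS FE => r ->.
  rewrite -(mx_integral_mulr measurableT _ (tau_int q k)).
  apply: (ae_eq_mx_integral measurableT mF Fi.1).
  by apply: filterS FE => r E _.
Qed.

End Amplitude.

(** The set where [F] exceeds [a] is a countable union of rational boxes contained in it. A point of
    the set in no such box would be the limit of points with [F <= a], against sequential
    continuity. Convergence is expressed through [dot3] because this is the form in which momenta
    enter plane waves. *)
Lemma seq_continuous_measurable (R : realType) (F : R3 R -> R) :
  (forall k_ k e, (forall r, dot3 (k_ j) r @[j --> \oo] --> dot3 k r) -> 0 < e ->
     exists N, forall j, (N <= j)%N -> `|F (k_ j) - F k| <= e) ->
  measurable_fun setT F.
Proof.
move=> Fc.
apply: (measurability _ (RGenOInfty.measurableE R)) => _ [_ [a ->] <-].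
rewrite setTI; set S := F @^-1` _.
pose I := (rat * rat * rat * nat)%type.
pose box (b : I) : set (R3 R) :=
  [set x | [/\ `|(x.1.1 : R) - ratr b.1.1.1| < b.2.+1%:R^-1,
               `|(x.1.2 : R) - ratr b.1.1.2| < b.2.+1%:R^-1 &
               `|(x.2 : R) - ratr b.1.2| < b.2.+1%:R^-1]].
have mbox b : measurable (box b).
  pose J (q : rat) : set R := [set x | `|x - ratr q| < b.2.+1%:R^-1].
  have mJ q : measurable (J q : set (measurableTypeR R)).
    rewrite (_ : J q = `](ratr q - b.2.+1%:R^-1), (ratr q + b.2.+1%:R^-1)[%classic).
      exact: measurable_itv.
    by apply/seteqP; split => x; rewrite /J/= in_itv/= ltr_distl.
  rewrite (_ : box b = J b.1.1.1 `*` J b.1.1.2 `*` J b.1.2).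
    by apply: measurableX => //; exact: measurableX.
  by apply/seteqP; split => [x [? ? ?]|x [[? ?] ?]]; split.
(* Boxes are numbered through [pickle]: [A n] is the box with code [n] if it lies in [S], and empty
   otherwise. *)
pose A (n : nat) : set (R3 R) := [set x | exists b : I,
  [/\ pickle b = n, box b `<=` S & box b x]].
have -> : S = \bigcup_n A n.
  apply/seteqP; split => [k Sk|k [n _ [b [_ bS bk]]]]; last exact: bS.
  apply: contrapT => nA.
  have near_rat (x : R) n : exists q : rat, `|x - ratr q| < n.+1%:R^-1.
    have n0 : 0 < n.+1%:R^-1 :> R by rewrite invr_gt0.
    have /rat_in_itvoo[q] : x - n.+1%:R^-1 < x + n.+1%:R^-1.
      by rewrite ltrBlDr -addrA ltrDl addr_gt0.
    by rewrite in_itv/= -ltr_distlC => Hq; exists q.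
  (* A rational box of half-side [1 / (n + 1)] around [k] is not contained in [S], so it has a point
     outside [S]; both lie in the box, hence are at distance at most twice the half-side in each
     coordinate. *)
  have /choice[k_ Hk] n : exists y : R3 R, F y <= a /\
    [/\ `|(y.1.1 : R) - k.1.1| <= 2 * n.+1%:R^-1,
        `|(y.1.2 : R) - k.1.2| <= 2 * n.+1%:R^-1 &
        `|(y.2 : R) - k.2| <= 2 * n.+1%:R^-1].
    have [q1 H1] := near_rat k.1.1 n; have [q2 H2] := near_rat k.1.2 n.
    have [q3 H3] := near_rat k.2 n.
    pose b : I := (q1, q2, q3, n).
    have nbS : ~ (box b `<=` S).
      by move=> bS; apply: nA; exists (pickle b) => //; exists b; split.
    have [y [by_ ny]] : exists y, box b y /\ ~ S y.
      apply: contrapT => H; apply: nbS => y yb; apply: contrapT => nSy.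
      by apply: H; exists y.
    exists y; split.
      by move: ny; rewrite /S/= in_itv/= andbT => /negP; rewrite -leNgt.
    have tri (x z w d : R) : `|x - w| < d -> `|z - w| < d -> `|x - z| <= 2 * d.
      move=> xw zw; have := ler_distD w x z; rewrite [`|w - z|]distrC => H.
      by apply: (le_trans H); rewrite mulr2n mulrDl mul1r lerD// ltW.
    by move: by_ => [/= B1 B2 B3]; split;
      [exact: tri B1 H1|exact: tri B2 H2|exact: tri B3 H3].
  have cv (x : nat -> R) (z : R) : (forall n, `|x n - z| <= 2 * n.+1%:R^-1) ->
      x @ \oo --> z.
    move=> H; apply/cvgrPdist_le => e e0.
    have h0 : (fun n => 2 * @harmonic R n) @ \oo --> (2 * 0 : R).
      by apply: cvgM; [exact: cvg_cst|exact: cvg_harmonic].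
    rewrite mulr0 in h0; move/cvgrPdist_le : h0 => /(_ _ e0).
    apply: filterS => n; rewrite sub0r normrN => Hn.
    by rewrite distrC (le_trans (H n))// (le_trans (ler_norm _)).
  have Sk' : a < F k by move: Sk; rewrite /S/= in_itv/= andbT.
  have [||N HN] := Fc k_ k ((F k - a) / 2).
  - move=> r; have [H1 H2 H3] : [/\ (fun n => ((k_ n).1.1 : R)) @ \oo --> (k.1.1 : R),
      (fun n => ((k_ n).1.2 : R)) @ \oo --> (k.1.2 : R) &
      (fun n => ((k_ n).2 : R)) @ \oo --> (k.2 : R)].
      by split; apply: cv => n; have [_ []] := Hk n.
    apply: cvgD; last by apply: cvgM => //; exact: cvg_cst.
    by apply: cvgD; apply: cvgM => //; exact: cvg_cst.
  - by rewrite divr_gt0// subr_gt0.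
  - have := HN N (leqnn N); have [H _] := Hk N.
    by rewrite distrC => /ler_normlW; lra.
apply: bigcupT_measurable => n.
case: (pselect (exists b : I, pickle b = n /\ box b `<=` S)) => [[b [bn bS]]|nb].
  rewrite (_ : A n = box b)//; apply/seteqP; split => x; last by exists b; split.
  by move=> [b' [b'n _]]; rewrite (pcan_inj pickleK (etrans b'n (esym bn))).
rewrite (_ : A n = set0)//; apply/seteqP; split => // x [b [bn bS _]].
by apply: nb; exists b.
Qed.

Lemma seq_continuous_mx_measurable (R : realType) p q (F : R3 R -> 'M[R[i]]_(p, q)) :
  (forall k_ k e, (forall r, dot3 (k_ j) r @[j --> \oo] --> dot3 k r) -> 0 < e ->
     exists N, forall j, (N <= j)%N -> nm (F (k_ j) - F k) <= e) ->
  mx_measurable setT F.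
Proof.
move=> Fc i j; split; apply: seq_continuous_measurable => k_ k e kk e0;
  have [N HN] := Fc k_ k e kk e0; exists N => n Nn; apply: le_trans (HN n Nn);
  apply: le_trans (l1_nm _ i j); rewrite !mxE.
- by rewrite -cReN -cReD; exact: normRe_l1.
- by rewrite -cImN -cImD; exact: normIm_l1.
Qed.

(** Writing the inverse as [x * (x ^+ 2)^-1] reduces it to a power of a nonnegative number; at 0
    both expressions are 0. *)
Lemma measurable_fun_inv d (T : measurableType d) (R : realType) (f : T -> R) :
  measurable_fun setT f -> measurable_fun setT (fun x => (f x)^-1).
Proof.
move=> mf.
rewrite (_ : (fun x => _) = fun x => f x * (@powR R ^~ (-1)) (f x ^+ 2)).
  apply: measurable_funM => //.
  apply: (measurableT_comp (f := @powR R ^~ (-1)) (g := fun x => f x ^+ 2)).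
    exact: measurable_powR.
  exact: measurable_funX.
apply/funext => x; rewrite powR_inv1 ?sqr_ge0//.
have [->|fx0] := eqVneq (f x) 0; first by rewrite invr0 mul0r.
by rewrite expr2 invfM mulrA divff// mul1r.
Qed.

(** * Normalized free eigenvectors: measurability and bounds *)

Section FreeEigenvectors.
Variables (R : realType) (m : R).
Local Notation C := R[i].

Lemma measurable_omega : measurable_fun setT (omega m).
Proof.
have m11 : measurable_fun setT (fun x : R3 R => x.1.1 : R).
  exact: (measurableT_comp measurable_fst measurable_fst).
have m12 : measurable_fun setT (fun x : R3 R => x.1.2 : R).
  exact: (measurableT_comp measurable_snd measurable_fst).
have m2 : measurable_fun setT (fun x : R3 R => x.2 : R).
  exact: measurable_snd.
apply: (measurableT_comp (f := @Num.sqrt R)).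
  by apply: continuous_measurable_fun; exact: sqrt_continuous.
apply: measurable_funD => //.
by apply: measurable_funD; [apply: measurable_funD|]; apply: measurable_funM.
Qed.

Lemma mx_measurable_eigvec_hat n : mx_measurable setT (eigvec_hat m n).
Proof.
have m11 : measurable_fun setT (fun x : R3 R => x.1.1 : R).
  exact: (measurableT_comp measurable_fst measurable_fst).
have m12 : measurable_fun setT (fun x : R3 R => x.1.2 : R).
  exact: (measurableT_comp measurable_snd measurable_fst).
have m2 : measurable_fun setT (fun x : R3 R => x.2 : R).
  exact: measurable_snd.
have m11N : measurable_fun setT (fun x : R3 R => - (x.1.1 : R)).
  exact: measurableT_comp.
have m12N : measurable_fun setT (fun x : R3 R => - (x.1.2 : R)).
  exact: measurableT_comp.
have m2N : measurable_fun setT (fun x : R3 R => - (x.2 : R)).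
  exact: measurableT_comp.
have mD : measurable_fun setT (fun x : R3 R => m + omega m x).
  by apply: measurable_funD => //; exact: measurable_omega.
have mB : measurable_fun setT (fun x : R3 R => m - omega m x).
  by apply: measurable_funB => //; exact: measurable_omega.
have cdiv (f : R3 R -> C) (D : R3 R -> R) : cmeasurable setT f ->
    measurable_fun setT D -> cmeasurable setT (fun x => f x / (D x)%:C).
  move=> mf mD'; apply: cmeasurableM => //.
  under eq_fun do rewrite -fmorphV.
  by apply: cmeasurable_real; exact: measurable_fun_inv.
have cx (f g : R3 R -> R) : measurable_fun setT f -> measurable_fun setT g ->
  cmeasurable setT (fun x => f x +i* g x) by move=> mf mg; split.
have mg : mx_measurable setT (eigvec m n).
  apply: (@eq_mx_measurable _ _ _ _ _ _ (fun k => \matrix_(i, j) eigvec m n k i 0)).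
    by move=> k _; apply/matrixP => i j; rewrite mxE ord1.
  apply: mx_measurable_mx => i _.
  by case: n => [[|[|[|[|n]]]] //= Hn]; case: i => [[|[|[|[|i]]]] //= Hi];
    (under eq_fun do rewrite mxE /=); try exact: cmeasurable_cst;
    apply: cdiv => //; try exact: cx; exact: cmeasurable_real.
apply: mx_measurableZ => //; apply: cmeasurable_real; apply: measurable_fun_inv.
apply: (measurableT_comp (f := @Num.sqrt R)); last exact: measurable_vnormsq.
by apply: continuous_measurable_fun; exact: sqrt_continuous.
Qed.

(** [nm_le_vnormsq] in dimension 4 gives the square bound 8, below [3 ^ 2]; a zero vector would be
    normalized to 0. *)
Lemma nm_eigvec_hat n k : nm (eigvec_hat m n k) <= 3%:R.
Proof.
rewrite /eigvec_hat nmZr; set v := eigvec m n k.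
have [v0|v0] := eqVneq (vnormsq v) 0.
  by rewrite v0 sqrtr0 invr0 normr0 mul0r.
have vp : 0 < vnormsq v by rewrite lt_neqAle eq_sym v0 vnormsq_ge0.
have s0 : 0 < Num.sqrt (vnormsq v) by rewrite sqrtr_gt0.
rewrite ger0_norm; last by rewrite invr_ge0 ltW.
rewrite mulrC ler_pdivrMr//.
have := nm_le_vnormsq v; rewrite -{1}(sqr_sqrtr (vnormsq_ge0 v)).
move: s0 (nm_ge0 v); move: (Num.sqrt _) (nm v) => s x s0 x0.
have -> : (2 * 4)%:R = 8%:R :> R by [].
by rewrite !expr2 => H; nra.
Qed.

Lemma nm_U0 k : nm (U0 m k) <= 12%:R.
Proof.
rewrite /nm exchange_big/= (le_trans (ler_sum _ (_ : forall n, _ -> _ <= 3%:R)))//.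
  move=> n _; apply: le_trans (nm_eigvec_hat n k).
  by rewrite nm_cv ler_sum// => i _; rewrite mxE.
by rewrite sumr_const card_ord -[leLHS]mulr_natr -natrM.
Qed.

Lemma mx_measurable_U0 : mx_measurable setT (U0 m).
Proof.
apply: mx_measurable_mx => i n; apply: mx_measurable_entry.
exact: mx_measurable_eigvec_hat.
Qed.

End FreeEigenvectors.

(** * The scattering kernel on an energy shell *)

Section KernelOnShell.
Variables (R : realType) (m l : R).
Local Notation mu := (leb3_sf R).
Local Notation C := R[i].
Variables (V V1 W1 : R3 R -> 'M[C]_4) (v1 w1 : R).
Hypotheses (m0 : 0 < m) (V1l2 : is_l2 mu V1) (mW1 : mx_measurable setT W1)
  (V1b : forall r, nm (V1 r) <= v1) (W1b : forall r, nm (W1 r) <= w1)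
  (VE : forall r, V1 r *m W1 r *m V1 r = V r).

Let K q w := T_mx m V V1 W1 q (scale3 (varkappa m l) w).
Let E := Num.sqrt (m ^+ 2 + varkappa m l ^+ 2).

Let omegaE w : sphere w -> omega m (scale3 (varkappa m l) w) = E.
Proof.
move=> w1'; congr (Num.sqrt (_ + _)).
have := norm3_sqr w; rewrite w1' expr1n => w2.
by rewrite /dot3/= -!expr2 !exprMn -!mulrDr -w2 mulr1.
Qed.

(** Rebuilds [T_mx] from one amplitude per column: the row [delta_mx 0 n] places the vector
    [A n *m eigvec_hat m n k] in column [n]. The first two columns have energy [- E] and the last
    two [E], and the adjoint of [U0] then mixes them. *)
Let combine (k : R3 R) (A : 'I_4 -> 'M[C]_4) : 'M[C]_4 := ((2 * pi) ^- 3)%:C *: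
  ((\sum_n A n *m eigvec_hat m n k *m (delta_mx 0 n : 'rV_4)) *m (U0 m k)^t*).

Let nm_combine k A : nm (combine k A) <=
  `|(2 * pi) ^- 3| * ((\sum_n nm (A n) * 3%:R) * 12%:R).
Proof.
rewrite /combine nmZr ler_wpM2l//.
apply: (le_trans (nmM _ _)); apply: ler_pM; rewrite ?nm_ge0//; last first.
  by rewrite nm_trC nm_U0.
apply: (le_trans (nm_sum _ _ _)); apply: ler_sum => n _.
apply: (le_trans (nmM _ _)).
have d1 : nm (delta_mx 0 n : 'rV[C]_4) <= 1.
  rewrite /nm big_ord1 (bigD1 n)//= mxE !eqxx big1 ?addr0 => [|i ni].
    by rewrite -[1]/(1%:C) l1_real normr1.
  by rewrite mxE (negbTE ni) andbF l1_0.
rewrite -[leRHS]mulr1 ler_pM ?nm_ge0// (le_trans (nmM _ _))//.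
by rewrite ler_wpM2l ?nm_ge0// nm_eigvec_hat.
Qed.

Let combineB k A A' : combine k A - combine k A' = combine k (fun n => A n - A' n).
Proof.
rewrite /combine -scalerBr -mulmxBl -sumrB.
by under eq_bigr do rewrite -!mulmxBl.
Qed.

(** The two variables play different roles. In [q] only the amplitudes vary, so continuity, uniform
    on the sphere, survives. In [w] the eigenvectors vary too and are only known to be measurable
    and bounded, so measurability is what is claimed. *)
Lemma T_mx_on_shell : exists c : R,
  [/\ forall q w, sphere w -> nm (K q w) <= c,
      forall q, mx_measurable (@sphere R) (K q) &
      forall q_ q e, (forall r, dot3 (q_ j) r @[j --> \oo] --> dot3 q r) -> 0 < e ->
        exists N, forall j w, (N <= j)%N -> sphere w -> nm (K (q_ j) w - K q w) <= e].
Proof.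
have [tauM [cM [Mb Mk Mq ME]]] := amplitude m0 V1l2 mW1 V1b W1b VE (- E).
have [tauP [cP [Pb Pk Pq PE]]] := amplitude m0 V1l2 mW1 V1b W1b VE E.
pose tau (n : 'I_4) q k := if (n < 2)%N then tauM q k else tauP q k.
have KE q w : sphere w -> K q w =
    combine (scale3 (varkappa m l) w) (fun n => tau n q (scale3 (varkappa m l) w)).
  move=> w1'; set k := scale3 _ w.
  pose F n r := cis (- dot3 q r) *: (V r *m phi m V V1 W1 n k r).
  have HF n : mx_integrable mu setT (F n) /\
      mx_integral mu setT (F n) = tau n q k *m eigvec_hat m n k.
    rewrite /tau; case: ifPn => n2.
      by apply: ME; rewrite /eigval n2 omegaE.
    by apply: PE; rewrite /eigval (negbTE n2) omegaE.
  have iF n := mx_integrable_mulr measurableT (delta_mx 0 n : 'rV_4) (HF n).1.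
  have iS := mx_integrable_sum measurableT iF.
  rewrite /K /T_mx /combine; congr (_ *: _).
  under eq_bigr => n _ do rewrite -(HF n).2 -(mx_integral_mulr measurableT _ (HF n).1).
  rewrite -(mx_integral_sum measurableT iF) -(mx_integral_mulr measurableT _ iS).
  congr mx_integral; apply/funext => r; rewrite -/k.
  rewrite [LHS]scalemxAl; congr (_ *m _).
  apply/matrixP => a b.
  have key (v : 'cV[C]_4) n : (v *m (delta_mx 0 n : 'rV_4)) a b = v a 0 * (b == n)%:R.
    by rewrite mxE big_ord1 mxE eqxx.
  rewrite summxE (bigD1 b)//= big1 ?addr0 => [|n nb]; last first.
    by rewrite key eq_sym (negbTE nb) mulr0.
  rewrite key eqxx mulr1 /F 2!mxE [RHS]mxE [in RHS]mxE; congr (_ * _).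
  by apply: eq_bigr => j _; rewrite mxE.
have B0 : 0 <= `|(2 * pi) ^- 3 : R| by exact: normr_ge0.
exists (`|(2 * pi) ^- 3| * ((\sum_(n < 4) (cM + cP) * 3%:R) * 12%:R)); split.
- move=> q w w1'; rewrite KE//; apply: (le_trans (nm_combine _ _)).
  rewrite ler_wpM2l// ler_wpM2r// ler_sum// => n _; rewrite ler_wpM2r//.
  have cM0 := le_trans (nm_ge0 _) (Mb q q); have cP0 := le_trans (nm_ge0 _) (Pb q q).
  by rewrite /tau; case: ifPn => _; [apply: (le_trans (Mb _ _))|apply: (le_trans (Pb _ _))];
    rewrite ?lerDl ?lerDr.
- move=> q.
  have mtau n : mx_measurable setT (tau n q).
    rewrite /tau; apply: seq_continuous_mx_measurable => k_ k e kk e0.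
    case: ifPn => _.
      by have [N HN] := Mk k_ k e kk e0; exists N => j Nj; exact: (HN j q).
    by have [N HN] := Pk k_ k e kk e0; exists N => j Nj; exact: (HN j q).
  have mcomb : mx_measurable setT (fun k => combine k (fun n => tau n q k)).
    apply: mx_measurableZc; apply: mx_measurableM; last first.
      by apply: mx_measurable_trC; exact: mx_measurable_U0.
    apply: mx_measurable_sum => n; apply: mx_measurableM; last exact: mx_measurable_cst.
    by apply: mx_measurableM => //; exact: mx_measurable_eigvec_hat.
  have mscale : measurable_fun setT (fun w : R3 R => scale3 (varkappa m l) w).
    have m11 : measurable_fun setT (fun x : R3 R => x.1.1 : R).
      exact: (measurableT_comp measurable_fst measurable_fst).
    have m12 : measurable_fun setT (fun x : R3 R => x.1.2 : R).
      exact: (measurableT_comp measurable_snd measurable_fst).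
    have m2 : measurable_fun setT (fun x : R3 R => x.2 : R).
      exact: measurable_snd.
    apply: measurable_fun_pair; first apply: measurable_fun_pair.
    + by apply: measurable_funM => //; exact: measurable_cst.
    + by apply: measurable_funM => //; exact: measurable_cst.
    + by apply: measurable_funM => //; exact: measurable_cst.
  have mcs := mx_measurable_comp mcomb mscale.
  apply: (eq_mx_measurable _ (mx_measurable_subT _ mcs)) => w.
  by rewrite inE => w1'; rewrite KE.
- move=> q_ q e qq e0.
  (* 144 is the product of the constants in [nm_combine]: 4 columns, 3 for each eigenvector and 12
     for [U0]. *)
  pose c := `|(2 * pi) ^- 3 : R| * 144%:R + 1.
  have c0 : 0 < c by rewrite ltr_wpDl// mulr_ge0.
  have e'0 : 0 < e / c by rewrite divr_gt0.
  have [NM HM] := Mq q_ q _ qq e'0; have [NP HP] := Pq q_ q _ qq e'0.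
  exists (maxn NM NP) => j w; rewrite geq_max => /andP[jM jP] w1'.
  rewrite !KE// combineB; apply: (le_trans (nm_combine _ _)).
  apply: (@le_trans _ _ (`|(2 * pi) ^- 3| * ((\sum_(n < 4) (e / c) * 3%:R) * 12%:R))).
    rewrite ler_wpM2l// ler_wpM2r// ler_sum// => n _; rewrite ler_wpM2r//.
    by rewrite /tau; case: ifPn => _; [exact: HM|exact: HP].
  rewrite sumr_const card_ord -[X in X * 12%:R]mulr_natr.
  have -> : e / c * 3%:R * 4%:R * 12%:R = 144%:R * (e / c) by ring.
  rewrite mulrA [leLHS]mulrC mulrAC ler_pdivrMr//.
  rewrite [144%:R * e]mulrC -mulrA ler_wpM2l ?(ltW e0)// mulrC.
  by rewrite lerDl.
Qed.

End KernelOnShell.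

(** * Hilbert-Schmidt operators with bounded kernel *)

Section HilbertSchmidt.
Context d (T : measurableType d) (R : realType).
Variables (mu : {measure set T -> \bar R}) (D : set T).
Hypothesis mD : measurable D.
Local Notation C := R[i].

Lemma cauchy_schwarz_on (f g : T -> R) : measurable_fun D f -> measurable_fun D g ->
  (forall x, D x -> 0 <= f x) -> (forall x, D x -> 0 <= g x) ->
  ((\int[mu]_(x in D) (f x * g x)%:E) ^+ 2 <=
   \int[mu]_(x in D) (f x ^+ 2)%:E * \int[mu]_(x in D) (g x ^+ 2)%:E)%E.
Proof.
move=> mf mg f0 g0.
have mr (h : T -> R) : measurable_fun D h -> measurable_fun setT (h \_ D).
  by move=> mh; apply/(measurable_restrict _ mD measurableT); rewrite setTI.
have r0 (h : T -> R) : (forall x, D x -> 0 <= h x) -> forall x, 0 <= (h \_ D) x.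
  by move=> h0 x; rewrite patchE; case: ifPn => //; rewrite inE => /h0.
have := cauchy_schwarz mu (mr f mf) (mr g mg) (r0 f f0) (r0 g g0).
rewrite !(integral_mkcond D); congr (_ ^+ 2 <= _ * _)%E;
  by apply: eq_integral => x _; rewrite !patchE; case: ifP => _;
    rewrite ?mulr0 ?expr0n.
Qed.

(** * Bessel's inequality for unquotiented L^2 functions *)

Section Bessel.
Variable n : nat.
Implicit Types f g e : T -> 'cV[C]_n.
Local Notation L2 := (@L2 R _ _ mu D n).
Local Notation L2normsq := (L2normsq mu D).
Local Notation L2dot := (L2dot mu D).

Definition cnormsq (c : C) : R := complex.Re c ^+ 2 + complex.Im c ^+ 2.

Lemma L2_dot_integrable f g : L2 f -> L2 g ->
  mx_integrable mu D (fun x => (g x)^t* *m f x).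
Proof.
move=> [mf foo] [mg goo].
have mvf := measurable_vnormsq mf; have mvg := measurable_vnormsq mg.
apply: (mx_integrable_le mD (g := fun x =>
    (2 * n)%:R * (vnormsq (f x) + vnormsq (g x)))).
- by apply: mx_measurableM => //; exact: mx_measurable_trC.
- by apply: measurable_funM => //; exact: measurable_funD.
- move=> x _; rewrite (le_trans (nmM _ _))// nm_trC mulrDr.
  have := nm_le_vnormsq (f x); have := nm_le_vnormsq (g x).
  move: (nm_ge0 (f x)) (nm_ge0 (g x)).
  by move: (nm _) (nm _) (_ * vnormsq _) (_ * vnormsq _) => a b u v a0 b0 H1 H2;
    have := sqr_ge0 (a - b); rewrite sqrrB mulr2n; nra.
- rewrite integralZl_fin//; last 2 first.
  + exact: measurable_funD.
  + by move=> x _; rewrite addr_ge0// vnormsq_ge0.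
  rewrite integralD_fin//; try by move=> x _; exact: vnormsq_ge0.
  by rewrite lte_mul_pinfty// lte_add_pinfty.
Qed.

Lemma L2B f g (c : C) : L2 f -> L2 g -> L2 (fun x => f x - c *: g x).
Proof.
move=> [mf foo] [mg goo].
have mvf := measurable_vnormsq mf; have mvg := measurable_vnormsq mg.
have mh : mx_measurable D (fun x => f x - c *: g x).
  by apply: mx_measurableB => //; exact: mx_measurableZc.
split => //.
have [k k0 Hk] : exists2 k : R, 0 <= k & forall u v : 'cV[C]_n,
    vnormsq (u - c *: v) <= k * (vnormsq u + vnormsq v).
  exists (2 * (1 + l1 c ^+ 2) * (2 * n)%:R).
    by rewrite mulr_ge0// mulr_ge0// addr_ge0// sqr_ge0.
  move=> u v.
  apply: (le_trans (vnormsq_le_nm _)).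
  have H : nm (u - c *: v) <= nm u + l1 c * nm v.
    by rewrite (le_trans (nmD _ _))// nmN lerD2l nmZ.
  rewrite -mulrA [X in _ <= _ * X]mulrDr.
  have := nm_le_vnormsq u; have := nm_le_vnormsq v.
  move: H (nm_ge0 (u - c *: v)) (nm_ge0 u) (nm_ge0 v) (l1_ge0 c).
  move: (nm (u - _)) (nm u) (nm v) (l1 c) (_ * vnormsq _) (_ * vnormsq _).
  move=> a b d' y s t; rewrite !expr2 => H a0 b0 d0 y0 H1 H2.
  have := sqr_ge0 (b - y * d'); rewrite sqrrB mulr2n !expr2 => H3.
  have H4 : a * a <= (b + y * d') * (b + y * d') by rewrite ler_pM.
  have yy : 0 <= y * y by rewrite mulr_ge0.
  have H5 : y * y * (d' * d') <= y * y * _ := ler_wpM2l yy H1.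
  have H6 := le_trans (mulr_ge0 d0 d0) H1.
  have H7 := mulr_ge0 yy (le_trans (mulr_ge0 b0 b0) H2).
  lra.
apply: (@le_lt_trans _ _ (\int[mu]_(x in D) (k * (vnormsq (f x) + vnormsq (g x)))%:E)%E).
  apply: le_integral_fin => //; first exact: measurable_vnormsq.
  - by apply: measurable_funM => //; exact: measurable_funD.
  - by move=> x _; exact: vnormsq_ge0.
rewrite integralZl_fin//; last 2 first.
- exact: measurable_funD.
- by move=> x _; rewrite addr_ge0// vnormsq_ge0.
rewrite integralD_fin//; try by move=> x _; exact: vnormsq_ge0.
by rewrite lte_mul_pinfty// lte_add_pinfty.
Qed.

Let Hint f g : L2 f -> L2 g ->
  mu.-integrable D (EFin \o (fun x => complex.Re (((g x)^t* *m f x) 0 0))) /\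
  mu.-integrable D (EFin \o (fun x => complex.Im (((g x)^t* *m f x) 0 0))).
Proof. by move=> Lf Lg; exact: (mx_integrable_entry mD 0 0 (L2_dot_integrable Lf Lg)). Qed.

Lemma L2dotE f g : L2dot f g =
  (\int[mu]_(x in D) complex.Re (((g x)^t* *m f x) 0 0)) +i*
  (\int[mu]_(x in D) complex.Im (((g x)^t* *m f x) 0 0)).
Proof. by rewrite /Defs.L2dot mxE. Qed.

Lemma vnormsqE (v : 'cV[C]_n) : ((v^t* *m v) 0 0) = (vnormsq v)%:C.
Proof.
rewrite mxE /vnormsq rmorph_sum/=; apply: eq_bigr => i _.
rewrite !mxE; case: (v i 0) => a b; apply: eq_cReIm.
  by rewrite cReM cReJ cImJ /= mulNr opprK -!expr2.
by rewrite cImM cReJ cImJ /=; ring.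
Qed.

Lemma L2dotBl f e g (c : C) : L2 f -> L2 e -> L2 g ->
  L2dot (fun x => f x - c *: e x) g = L2dot f g - c * L2dot e g.
Proof.
move=> Lf Le Lg; rewrite /Defs.L2dot.
have If := L2_dot_integrable Lf Lg; have Ie := L2_dot_integrable Le Lg.
have H := mx_integralD mD If (mx_integrableZ mD (- c) Ie).
rewrite (mx_integralZ mD _ Ie) in H.
have -> : (fun x => (g x)^t* *m (f x - c *: e x)) =
    (fun x => (g x)^t* *m f x + (- c) *: ((g x)^t* *m e x)).
  by apply/funext => x; rewrite mulmxBr scaleNr scalemxAr.
by rewrite H mxE [X in _ + X]mxE mulNr.
Qed.

Lemma L2dotC f g : L2 f -> L2 g -> L2dot f g = (L2dot g f)^*%R.
Proof.
move=> Lf Lg; rewrite !L2dotE.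
have E x : ((g x)^t* *m f x) 0 0 = (((f x)^t* *m g x) 0 0)^*%R.
  rewrite !mxE rmorph_sum; apply: eq_bigr => i _.
  by rewrite !mxE rmorphM /= conjCK mulrC.
apply: eq_cReIm; rewrite ?cReJ ?cImJ /=.
  by apply: eq_Rintegral => x _; rewrite E cReJ.
rewrite -mulN1r -RintegralZl//; last exact: (Hint Lg Lf).2.
by apply: eq_Rintegral => x _; rewrite E cImJ mulN1r.
Qed.

Lemma cnormsqJ (c : C) : cnormsq (c^*)%R = cnormsq c.
Proof. by rewrite /cnormsq cReJ cImJ sqrrN. Qed.

Lemma L2normsqE f : L2 f -> L2normsq f = (complex.Re (L2dot f f))%:E.
Proof.
move=> Lf; rewrite L2dotE/=.
under eq_Rintegral do rewrite vnormsqE.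
rewrite /Rintegral fineK// ge0_fin_numE ?Lf.2//.
by apply: integral_ge0 => x _; rewrite lee_fin vnormsq_ge0.
Qed.

Let cRe_conj_sub (z c : C) : complex.Re z =
  complex.Re (z^*%R - c^*%R * c) + cnormsq c.
Proof.
rewrite cReD cReJ cReN cReM cReJ cImJ /cnormsq.
by move: (complex.Re z) (complex.Re c) (complex.Im c) => x y t; ring.
Qed.

Lemma normsq_projection f e : L2 f -> L2 e -> L2dot e e = 1 ->
  L2normsq f = (L2normsq (fun x => f x - L2dot f e *: e x)%R +
                (cnormsq (L2dot f e))%:E)%E.
Proof.
move=> Lf Le e1; set c := L2dot f e.
rewrite !L2normsqE//; last exact: L2B.
set h := fun x => f x - c *: e x; have Lh : L2 h by exact: L2B.
have ehE : L2dot e h = 0.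
  by rewrite L2dotC// L2dotBl// e1 mulr1 subrr rmorph0.
have hhE : L2dot h h = (L2dot f f)^*%R - c^*%R * c.
  rewrite {1}/h L2dotBl// ehE mulr0 subr0 L2dotC// L2dotBl//.
  by rewrite (L2dotC Le Lf) -/c rmorphB rmorphM /= conjCK.
by rewrite hhE -EFinD -cRe_conj_sub.
Qed.

(** The basis vectors are projected out one at a time; the remainder [h] keeps its coefficients
    against the vectors not yet used, so each Pythagoras step releases one coefficient of [g]
    itself. *)
Lemma bessel (I : eqType) (e_ : I -> T -> 'cV[C]_n) (r : seq I) g :
  (forall i, L2 (e_ i)) -> (forall i j, L2dot (e_ i) (e_ j) = (i == j)%:R) ->
  L2 g -> uniq r ->
  ((\sum_(i <- r) cnormsq (L2dot (e_ i) g))%:E <= L2normsq g)%E.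
Proof.
move=> Le on Lg ur.
suff [h [Lh _ <-]] : exists h, [/\ L2 h,
    forall j, j \notin r -> L2dot h (e_ j) = L2dot g (e_ j) &
    (L2normsq h + (\sum_(i <- r) cnormsq (L2dot (e_ i) g))%:E)%E = L2normsq g].
  rewrite leeDr//; apply: integral_ge0 => x _; rewrite lee_fin; exact: vnormsq_ge0.
elim: r ur => [_|i r ih /= /andP[ir /ih[h [Lh hj hE]]]].
  by exists g; split => //; rewrite big_nil adde0.
exists (fun x => h x - L2dot h (e_ i) *: e_ i x); split.
- exact: L2B.
- move=> j; rewrite inE negb_or => /andP[ji jr].
  by rewrite L2dotBl// hj// on eq_sym (negbTE ji) mulr0 subr0.
- rewrite big_cons EFinD addeA -hE; congr (_ + _)%E.
  rewrite (normsq_projection Lh (Le i)) ?on ?eqxx// hj//.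
  by rewrite (L2dotC (Le i) Lg) cnormsqJ.
Qed.

End Bessel.

(** * Operators with bounded kernel on a set of finite measure *)

Section BoundedKernel.
Variables (n : nat) (K : T -> T -> 'M[C]_n) (a c : R).
Let A (h : T -> 'cV[C]_n) w : 'cV[C]_n :=
  a%:C *: mx_integral mu D (fun w' => K w w' *m h w').
Hypotheses (muD : (mu D < +oo)%E) (c0 : 0 <= c)
  (Kb : forall w w', D w' -> nm (K w w') <= c)
  (mK : forall w, mx_measurable D (K w)).
Implicit Types h : T -> 'cV[C]_n.

Let t := fine (mu D).

Let tE : (t%:E = mu D)%E.
Proof. by rewrite fineK// ge0_fin_numE. Qed.

Let t0 : 0 <= t. Proof. exact: fine_ge0. Qed.

Lemma integral_nm_L2_le h : L2 mu D h ->
  ((\int[mu]_(x in D) (nm (h x))%:E) ^+ 2 <=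
     (fine (mu D))%:E * ((2 * n)%:R%:E * L2normsq mu D h))%E.
Proof.
move=> [mh hoo]; have mN := measurable_nm mh; have mv := measurable_vnormsq mh.
have := cauchy_schwarz_on (measurable_cst (1 : R)) mN (fun _ _ => ler01)
  (fun x _ => nm_ge0 (h x)).
under eq_integral do rewrite mul1r; move=> H; apply: (le_trans H).
under eq_integral do rewrite expr1n.
rewrite integral_cst// mul1e -tE lee_wpmul2l ?lee_fin//.
rewrite -integralZl_fin//; last by move=> x _; exact: vnormsq_ge0.
apply: le_integral_fin => //; first exact: measurable_funX.
- exact: measurable_funM.
- by move=> x _; exact: sqr_ge0.
- by move=> x _; exact: nm_le_vnormsq.
Qed.

(** On a set of finite measure, [x <= 1 + x ^+ 2] makes a square-integrable function integrable. *)
Lemma bounded_kernel_integrable h w : L2 mu D h ->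
  mx_integrable mu D (fun w' => K w w' *m h w').
Proof.
move=> Lh; have [mh hoo] := Lh; have mN := measurable_nm mh.
apply: (mx_integrable_le mD (g := fun w' => c * (1 + (2 * n)%:R * vnormsq (h w')))).
- by apply: mx_measurableM => //; exact: mK.
- apply: measurable_funM => //; apply: measurable_funD => //.
  by apply: measurable_funM => //; exact: measurable_vnormsq.
- move=> w' Dw'; rewrite (le_trans (nmM _ _))// ler_pM ?nm_ge0 ?Kb//.
  have := nm_le_vnormsq (h w'); have := sqr_ge0 (nm (h w') - 1).
  by have := nm_ge0 (h w'); rewrite !expr2; move: (nm _) (_ * vnormsq _) => x y; nra.
- have mv := measurable_vnormsq mh.
  rewrite integralZl_fin//; last 2 first.
  + by apply: measurable_funD => //; exact: measurable_funM.
  + by move=> x _; rewrite addr_ge0// mulr_ge0// vnormsq_ge0.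
  rewrite lte_mul_pinfty// integralD_fin//; last 2 first.
  + exact: measurable_funM.
  + by move=> x _; rewrite mulr_ge0// vnormsq_ge0.
  rewrite integral_cst// mul1e lte_add_pinfty// integralZl_fin//; last first.
    by move=> x _; exact: vnormsq_ge0.
  by rewrite lte_mul_pinfty.
Qed.

Hypothesis mA : forall h, L2 mu D h -> mx_measurable D (A h).

Let A_bounded h : L2 mu D h -> (L2normsq mu D (A h) <=
  ((`|a| * c) ^+ 2 * t ^+ 2 * (2 * n)%:R)%:E * L2normsq mu D h)%E.
Proof.
move=> Lh.
have I0 : (0 <= \int[mu]_(x in D) (nm (h x))%:E)%E.
  by apply: integral_ge0 => x _; rewrite lee_fin nm_ge0.
set I := (\int[mu]_(x in D) (nm (h x))%:E)%E in I0.
have Ah w : D w -> ((vnormsq (A h w))%:E <= ((`|a| * c) ^+ 2)%:E * I ^+ 2)%E.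
  move=> Dw; have Kh := bounded_kernel_integrable w Lh.
  have H : ((nm (A h w))%:E <= (`|a| * c)%:E * I)%E.
    rewrite /A nmZr !EFinM -muleA lee_wpmul2l ?lee_fin//.
    apply: (le_trans (nm_mx_integral mD Kh)).
    rewrite -integralZl_fin//; last 2 first.
    - exact: measurable_nm Lh.1.
    - by move=> x _; exact: nm_ge0.
    apply: le_integral_fin => //; first exact: measurable_nm Kh.1.
    - by apply: measurable_funM => //; exact: measurable_nm Lh.1.
    - by move=> x _; exact: nm_ge0.
    - move=> x Dx; rewrite (le_trans (nmM _ _))// ler_wpM2r ?nm_ge0//.
      exact: Kb.
  apply: (@le_trans _ _ ((nm (A h w))%:E * (nm (A h w))%:E)%E).
    by rewrite -EFinM lee_fin -expr2 vnormsq_le_nm.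
  have N0 : (0 <= (nm (A h w))%:E)%E by rewrite lee_fin nm_ge0.
  apply: (le_trans (lee_pmul N0 N0 H H)).
  by rewrite expe2 muleACA -EFinM -expr2.
apply: (@le_trans _ _ ((((`|a| * c) ^+ 2)%:E * I ^+ 2) * t%:E)%E).
  rewrite tE -integral_cst//; apply: ge0_le_integral => //.
  - by move=> x _; rewrite lee_fin vnormsq_ge0.
  - by apply/measurable_EFinP; apply: measurable_vnormsq; exact: mA.
have B0 : (0 <= ((`|a| * c) ^+ 2)%:E)%E by rewrite lee_fin sqr_ge0.
have H := integral_nm_L2_le Lh.
apply: (@le_trans _ _ (((`|a| * c) ^+ 2)%:E * (t%:E * ((2 * n)%:R%:E * L2normsq mu D h)) * t%:E)%E).
  by rewrite lee_wpmul2r ?lee_fin// lee_wpmul2l.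
rewrite le_eqVlt; apply/orP; left; apply/eqP.
move: ((`|a| * c) ^+ 2) t (2 * n)%:R (L2normsq mu D h) => b u k x.
by rewrite muleC !muleA -!EFinM; congr (_%:E * _)%E; ring.
Qed.

(** For fixed [w], the component [p] of [A (e_ i) w] is [a] times the inner product of [e_ i] with
    the conjugated row [p] of [K w]. That row is in L^2 with squared norm at most [c ^+ 2 * t], so
    Bessel bounds the sum over [i], and there are [n] rows. *)
Let A_sum (I : eqType) (e_ : I -> T -> 'cV[C]_n) (r : seq I) w :
  (forall i, L2 mu D (e_ i)) ->
  (forall i j, L2dot mu D (e_ i) (e_ j) = (i == j)%:R) -> uniq r -> D w ->
  \sum_(i <- r) vnormsq (A (e_ i) w) <= n%:R * (a ^+ 2 * (c ^+ 2 * t)).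
Proof.
move=> Le on ur Dw.
pose g p w' : 'cV[C]_n := (row p (K w w'))^t*.
have mg p : mx_measurable D (g p).
  apply: mx_measurable_trC; under eq_fun do rewrite rowE.
  by apply: mx_measurableM; [exact: mx_measurable_cst|exact: mK].
have gle p w' : D w' -> vnormsq (g p w') <= c ^+ 2.
  move=> Dw'; rewrite (le_trans (vnormsq_le_nm _))//.
  rewrite ler_pXn2r ?nnegrE ?nm_ge0// nm_trC (le_trans _ (Kb w Dw'))//.
  rewrite /nm big_ord1 [leRHS](bigD1 p)//= (eq_bigr (fun j => l1 (K w w' p j))).
    by rewrite lerDl; apply: sumr_ge0 => i _; apply: sumr_ge0 => j _; exact: l1_ge0.
  by move=> j _; rewrite mxE.
have gN p : (L2normsq mu D (g p) <= (c ^+ 2 * t)%:E)%E.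
  rewrite EFinM tE -integral_cst//; apply: ge0_le_integral => //.
  - by move=> x _; rewrite lee_fin vnormsq_ge0.
  - by apply/measurable_EFinP; exact: measurable_vnormsq.
  - by move=> x Dx; rewrite lee_fin; exact: gle.
have Lg p : L2 mu D (g p) by split=> //; apply: le_lt_trans (gN p) (ltry _).
have AE i p : A (e_ i) w p 0 = a%:C * L2dot mu D (e_ i) (g p).
  rewrite /A mxE; congr (_ * _).
  rewrite /L2dot [LHS]mxE [RHS]mxE.
  have E w' : (K w w' *m e_ i w') p 0 = ((g p w')^t* *m e_ i w') 0 0.
    by rewrite /g trmxCK -row_mul [RHS]mxE.
  by congr (_ +i* _); apply: eq_Rintegral => x _; rewrite E.
rewrite /vnormsq exchange_big/=.
rewrite (le_trans (ler_sum _ (_ : forall p, _ -> _ <= a ^+ 2 * (c ^+ 2 * t))))//.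
  move=> p _.
  rewrite (eq_bigr (fun i => a ^+ 2 * cnormsq (L2dot mu D (e_ i) (g p)))) => [|i _].
    rewrite -mulr_sumr ler_wpM2l ?sqr_ge0// -lee_fin.
    exact: le_trans (bessel Le on (Lg p) ur) (gN p).
  rewrite AE cReM cImM /cnormsq /=.
  by move: (complex.Re _) (complex.Im _) => x y; ring.
by rewrite sumr_const card_ord -[leLHS]mulr_natl.
Qed.

(** The sum over an arbitrary basis is a supremum of finite sums; each is exchanged with the
    integral over [w], and [A_sum] bounds the integrand by a constant. Only orthonormality enters
    this bound, so it holds in any closed subspace. *)
Lemma bounded_kernel_hilbert_schmidt N : closed_subspace mu D N ->
  hilbert_schmidt mu D N A.
Proof.
move=> [NL2 _ _ _]; split.
- move=> f /NL2 Lf; split; first exact: mA.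
  apply: (le_lt_trans (A_bounded Lf)); rewrite lte_mul_pinfty ?lee_fin ?Lf.2//.
  by rewrite mulr_ge0// mulr_ge0// sqr_ge0.
- move=> z f g /NL2 Lf /NL2 Lg; apply: aeW => w Dw.
  have If := bounded_kernel_integrable w Lf; have Ig := bounded_kernel_integrable w Lg.
  rewrite /A scalerA [z * _]mulrC -scalerA -scalerDr; congr (_ *: _).
  rewrite -(mx_integralZ mD z If) -(mx_integralD mD (mx_integrableZ mD z If) Ig).
  by congr mx_integral; apply/funext => w'; rewrite mulmxDr scalemxAr.
- by eexists => f /NL2; exact: A_bounded.
- move=> I e_ [Ne on _].
  have Le i : L2 mu D (e_ i) by exact: NL2.
  pose M := n%:R * (a ^+ 2 * (c ^+ 2 * t)).
  apply: (@le_lt_trans _ _ (M * t)%:E); last exact: ltry.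
  apply: ge_ereal_sup => _ [F [finF _] <-].
  rewrite fsbig_finite//= /L2normsq -ge0_integral_sum//; last 2 first.
  + by move=> i; apply/measurable_EFinP; apply: measurable_vnormsq; exact: mA.
  + by move=> i x _; rewrite lee_fin vnormsq_ge0.
  rewrite EFinM tE -integral_cst//; apply: ge0_le_integral => //.
  + by move=> x _; apply: sume_ge0 => i _; rewrite lee_fin vnormsq_ge0.
  + apply: emeasurable_sum => i; apply/measurable_EFinP.
    by apply: measurable_vnormsq; exact: mA.
  + by move=> x Dx; rewrite sumEFin lee_fin; exact: A_sum.
Qed.

End BoundedKernel.
End HilbertSchmidt.

(** * Integral operators on the sphere *)

Section SphereOperator.
Variable R : realType.
Local Notation C := R[i].
Local Notation D := (@sphere R).
Local Notation mu := (@sphere_measure R).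

Lemma measurable_sphere : measurable D.
Proof.
have -> : D = @norm3 R @^-1` [set 1] by [].
by rewrite -[X in measurable X]setTI; apply: measurable_norm3.
Qed.

Lemma sphere_measure_lty : (mu D < +oo)%E.
Proof.
rewrite /sphere_measure lte_mul_pinfty//.
have E : leb3 R (box 1) = ((2 * 1) ^+ 3)%:E by exact: leb3_box.
apply: (@le_lt_trans _ _ (leb3 R (box 1))); last by rewrite E ltry.
apply: le_measure; rewrite ?inE.
- apply: measurableI; last exact: measurable_punctured_ball.
  by rewrite -[X in measurable X]setTI; apply: measurable_normalize3 => //;
    exact: measurable_sphere.
- exact: measurable_box.
- by move=> x [_ /andP[_ x1]]; exact: box_norm3.
Qed.

Section Kernel.
Variables (K : R3 R -> R3 R -> 'M[C]_2) (a c : R).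
Let A (h : R3 R -> 'cV[C]_2) w : 'cV[C]_2 :=
  a%:C *: mx_integral mu D (fun w' => K w w' *m h w').
Hypotheses (c0 : 0 <= c) (Kb : forall w w', D w' -> nm (K w w') <= c)
  (mK : forall w, mx_measurable D (K w))
  (Kc : forall w_ w e, (forall r, dot3 (w_ j) r @[j --> \oo] --> dot3 w r) ->
     0 < e -> exists N, forall j w', (N <= j)%N -> D w' ->
       nm (K (w_ j) w' - K w w') <= e).

(** What remains is measurability of [A h]. The kernel is continuous in its first variable uniformly
    over the sphere, and [h] is integrable there by Cauchy-Schwarz, so [A h] is sequentially
    continuous. *)
Lemma sphere_kernel_hilbert_schmidt N : closed_subspace mu D N ->
  hilbert_schmidt mu D N A.
Proof.
have mD := measurable_sphere; have muD := sphere_measure_lty.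
apply: (bounded_kernel_hilbert_schmidt mD muD c0 Kb mK) => h Lh.
apply: mx_measurable_subT; apply: seq_continuous_mx_measurable => w_ w e ww e0.
have Ih0 : (0 <= \int[mu]_(x in D) (nm (h x))%:E)%E.
  by apply: integral_ge0 => x _; rewrite lee_fin nm_ge0.
have mN := measurable_nm Lh.1.
have Ihoo : (\int[mu]_(x in D) (nm (h x))%:E < +oo)%E.
  have := integral_nm_L2_le mD muD Lh.
  rewrite ltey; apply: contraTneq => ->.
  by rewrite -ltNge expe2 mulyy lte_mul_pinfty// lte_mul_pinfty//; exact: Lh.2.
have Ifin : (\int[mu]_(x in D) (nm (h x))%:E)%E \is a fin_num.
  by rewrite ge0_fin_numE.
pose I := fine (\int[mu]_(x in D) (nm (h x))%:E)%E.
have I0 : 0 <= I by exact: fine_ge0.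
have d0 : 0 < `|a| * I + 1 by rewrite ltr_wpDl// mulr_ge0.
have e'0 : 0 < e / (`|a| * I + 1) by rewrite divr_gt0.
have [n Hn] := Kc ww e'0; exists n => j nj.
have i1 := bounded_kernel_integrable mD muD c0 Kb mK (w_ j) Lh.
have i2 := bounded_kernel_integrable mD muD c0 Kb mK w Lh.
have H := mx_integralD mD i1 (mx_integrableZ mD (-1) i2).
have i3 := mx_integrableD mD i1 (mx_integrableZ mD (-1) i2).
rewrite (mx_integralZ mD _ i2) scaleN1r in H.
rewrite /A -scalerBr nmZr -H.
have : nm (mx_integral mu D (fun x => K (w_ j) x *m h x + -1 *: (K w x *m h x))) <=
    e / (`|a| * I + 1) * I.
  rewrite -lee_fin [leRHS]EFinM /I fineK//.
  apply: (le_trans (nm_mx_integral mD i3)).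
  rewrite -integralZl_fin//; last 2 first.
  - exact: ltW.
  - by move=> x _; exact: nm_ge0.
  apply: le_integral_fin => //; first exact: measurable_nm i3.1.
  - exact: measurable_funM.
  - by move=> x _; exact: nm_ge0.
  - move=> x Dx; rewrite scaleN1r -mulmxBl (le_trans (nmM _ _))//.
    by rewrite ler_wpM2r ?nm_ge0//; exact: Hn.
move=> le1; apply: (le_trans (ler_wpM2l (normr_ge0 a) le1)).
rewrite mulrCA mulrAC ler_pdivrMr// ler_wpM2l ?(ltW e0)//.
by rewrite lerDl.
Qed.

End Kernel.

Lemma nm_mxsub (f : 'I_2 -> 'I_4) (M : 'M[C]_4) : nm (mxsub f f M) <= 4%:R * nm M.
Proof.
have H i j : l1 (mxsub f f M i j) <= nm M by rewrite mxE l1_nm.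
apply: (le_trans (ler_sum _ (fun i _ => ler_sum _ (fun j _ => H i j)))).
by rewrite !sumr_const !card_ord -mulrnA mulr_natl.
Qed.

End SphereOperator.

(** * The operators T_1 and T_2 *)

Section Scattering.
Variables (R : realType) (m l : R).
Local Notation mu := (leb3_sf R).
Local Notation C := R[i].
Variables (V V1 W1 : R3 R -> 'M[C]_4) (v1 w1 : R).
Hypotheses (m0 : 0 < m) (V1l2 : is_l2 mu V1) (mW1 : mx_measurable setT W1)
  (V1b : forall r, nm (V1 r) <= v1) (W1b : forall r, nm (W1 r) <= w1)
  (VE : forall r, V1 r *m W1 r *m V1 r = V r).

(** The two diagonal blocks are handled at once: [f] selects the rows and columns kept from [T_mx].
    Momenta on the shell are [varkappa m l] times unit vectors, so convergence of directions passes
    to momenta by homogeneity of [dot3]. *)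
Lemma sphere_op_hilbert_schmidt (f : 'I_2 -> 'I_4) N :
  closed_subspace (@sphere_measure R) (@sphere R) N ->
  hilbert_schmidt (@sphere_measure R) (@sphere R) N
    (sphere_op m (fun q k => mxsub f f (T_mx m V V1 W1 q k)) l).
Proof.
have [c [Kb mK Kc]] := T_mx_on_shell l m0 V1l2 mW1 V1b W1b VE.
apply: (@sphere_kernel_hilbert_schmidt _ (fun w w' => mxsub f f
  (T_mx m V V1 W1 (scale3 (varkappa m l) w) (scale3 (varkappa m l) w'))) _
  (4%:R * `|c|)).
- by rewrite mulr_ge0.
- move=> w w' w'1; rewrite (le_trans (nm_mxsub _ _))// ler_wpM2l//.
  by rewrite (le_trans (Kb _ _ w'1))// ler_norm.
- move=> w; apply: (@eq_mx_measurable _ _ _ _ _ _ (fun w' => \matrix_(i, j)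
    T_mx m V V1 W1 (scale3 (varkappa m l) w) (scale3 (varkappa m l) w') (f i) (f j))).
    by move=> w' _; apply/matrixP => i j; rewrite !mxE.
  by apply: mx_measurable_mx => i j; apply: mx_measurable_entry; exact: mK.
- move=> w_ w e ww e0.
  have e'0 : 0 < e / 4%:R by rewrite divr_gt0.
  have [|n Hn] := Kc (fun j => scale3 (varkappa m l) (w_ j))
    (scale3 (varkappa m l) w) _ _ e'0.
    move=> r.
    have E (x : R3 R) : dot3 (scale3 (varkappa m l) x) r = varkappa m l * dot3 x r.
      by rewrite /dot3 /scale3/= !mulrDr !mulrA.
    rewrite E; under eq_fun do rewrite E.
    by apply: cvgM; [exact: cvg_cst|exact: ww].
  exists n => j w' nj w'1.
  rewrite (_ : _ - _ = mxsub f f (T_mx m V V1 W1 (scale3 (varkappa m l) (w_ j))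
      (scale3 (varkappa m l) w') - T_mx m V V1 W1 (scale3 (varkappa m l) w)
      (scale3 (varkappa m l) w'))); last by apply/matrixP => a b; rewrite !mxE.
  rewrite (le_trans (nm_mxsub _ _))// -ler_pdivlMl// mulrC.
  exact: Hn.
Qed.

End Scattering.

Theorem theorem6p4 (R : realType) (m e : R) (nu : R3 R -> R[i])
    (A : 'I_3 -> R3 R -> R[i]) (U : R3 R -> 'M[R[i]]_4) (d : R3 R -> 'rV[R]_4)
    (Mac : set (R3 R -> 'cV[R[i]]_2)) (lambda : R) :
  let V := potential e nu A in
  let V1 := fun r => sqrt_abs (U r) (d r) in
  let W1 := fun r => sign_mx (U r) (d r) in
  0 < m ->
  mx_measurable setT V ->
  (forall r, V r = (V r)^t*) ->
  (exists K : R, forall r, opnorm (V r) <= K) ->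
  (leb3 R).-integrable setT (fun r => (opnorm (V r))%:E) ->
  (forall eps : R, 0 < eps ->
    (\int[@lebesgue_measure R]_t
       sqrte (\int[leb3 R]_(r in [set r | (`|t : R| * eps < norm3 r)%R])
                ((opnorm (V r)) ^+ 2)%:E) < +oo)%E) ->
  (forall r, U r \is unitarymx /\
     V r = U r *m diag_mx (map_mx (real_complex R) (d r)) *m (U r)^t*) ->
  closed_subspace (@sphere_measure R) (@sphere R) Mac ->
  E_plus m V1 W1 lambda ->
  (lambda < - m ->
     hilbert_schmidt (@sphere_measure R) (@sphere R) Mac
       (T1_op m V V1 W1 lambda)) /\
  (m < lambda ->
     hilbert_schmidt (@sphere_measure R) (@sphere R) Mac
       (T2_op m V V1 W1 lambda)).
Proof.
move=> V V1 W1 m0 mV VH [K VK] Vint _ UV Nac _.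
have Uu r : U r \is unitarymx by exact: (UV r).1.
have VE r : V r = U r *m diag_mx (map_mx (real_complex R) (d r)) *m (U r)^t*.
  exact: (UV r).2.
pose K' := `|K| + 1.
have K'0 : 0 < K' by rewrite ltr_wpDl.
have dK r k : `|d r 0 k| <= K'.
  rewrite (le_trans (eigenvalue_le_opnorm Uu VE r k))// (le_trans (VK r))//.
  by rewrite (le_trans (ler_norm K))// lerDl.
have mV1 := mx_measurable_sqrt_abs Uu VE mV K'0 dK.
have mW1 := mx_measurable_sign_mx Uu VE mV K'0 dK.
have V1V := nm_sqrt_abs_sqr Uu VE; have o0 := opnorm_ge0 Uu VE.
have W1b := nm_sign_mx d Uu; have V1WV1 := sqrt_abs_sign_sqrt_abs Uu VE.
(* From here on only the existence of the bounds matters, so the numerical constants become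
   variables; their signs are forgotten, hence the absolute values below. *)
move: (64 * 4) ((64 * 4) ^+ 2) V1V W1b => w1 b V1V W1b.
(* Again [x ^+ 2 <= y] is used in the form [x <= y + 1]. *)
have V1b r : nm (V1 r) <= `|b| * `|K| + 1.
  have : nm (V1 r) ^+ 2 <= `|b| * `|K|.
    rewrite (le_trans (V1V r))// (le_trans (ler_norm _))// normrM ler_wpM2l//.
    by rewrite ger0_norm ?o0// (le_trans (VK r))// ler_norm.
  have := nm_ge0 (V1 r); move: (nm _) (`|b| * `|K|) => x y; rewrite expr2; nra.
have mop : measurable_fun setT (fun r => opnorm (V r)).
  by apply/measurable_EFinP; exact: (measurable_int _ Vint).
(* The squared norm of [V1] is at most a constant times [opnorm (V r)], so integrability of the
   potential is square integrability of [V1]. *)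
have V1l2 : is_l2 (leb3_sf R) V1.
  apply: (@is_l2_le _ _ _ _ _ _ _ (fun r => `|b| * opnorm (V r)) mV1).
  - by apply: measurable_funM; [exact: measurable_cst|exact: mop].
  - by move=> r; rewrite (le_trans (V1V r))// ler_wpM2r ?o0// ler_norm.
  - rewrite (integralZl_fin _ _ mop (normr_ge0 b) (fun r _ => o0 r)); last by [].
    rewrite lte_mul_pinfty//; have /integrableP[_] := Vint.
    apply: le_lt_trans; rewrite le_eqVlt; apply/orP; left; apply/eqP.
    by apply: eq_integral => r _; rewrite gee0_abs// lee_fin o0.
have HS f := sphere_op_hilbert_schmidt lambda m0 V1l2 mW1 V1b W1b V1WV1 f Nac.
pose up : 'I_2 -> 'I_4 := @lshift 2 2; pose down : 'I_2 -> 'I_4 := @rshift 2 2.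
split=> _.
  have E : (fun q k => mxsub up up (T_mx m V V1 W1 q k)) = T1_mx m V V1 W1.
    apply/funext => q; apply/funext => k; rewrite /T1_mx.
    by move: (T_mx _ _ _ _ _ _) => M; apply/matrixP => i j; rewrite !mxE.
  by rewrite /T1_op -E; exact: HS.
have E : (fun q k => mxsub down down (T_mx m V V1 W1 q k)) = T2_mx m V V1 W1.
  apply/funext => q; apply/funext => k; rewrite /T2_mx.
  by move: (T_mx _ _ _ _ _ _) => M; apply/matrixP => i j; rewrite !mxE.
by rewrite /T2_op -E; exact: HS.
Qed.
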